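(* Let $k$ be a field. Let $\mathcal A$ be the set of isomorphism classes of (finite-dimensional) monomial $k$-algebras, and let $\mathcal Y$ be the set of equivalence classes of pairs $(\Lambda,D)$, where $\Lambda=kQ_\Lambda/I_\Lambda$ is a symmetric $f_s$-BCA with a free f-degree function and $D$ is an admissible cut of $Q_\Lambda$; here $(\Lambda,D)$ and $(\Lambda',D')$ are equivalent if there is a $k$-algebra isomorphism $\Lambda\to\Lambda'$ that sends $D$ to $D'$. Then there is a bijection $\phi:\mathcal A\to\mathcal Y$ given, for $A\in\mathcal A$, by $$\phi(A)=(T(A),D),\qquad D=\{\alpha_m\mid m\text{ is a maximal path in }A\},$$ and conversely, for a pair $(\Lambda,D)$, $\phi^{-1}((\Lambda,D))=A$, where $A$ denotes the isomorphism class of the cut algebra $kQ_\Lambda/\langle I_\Lambda\cup D\rangle$ associated with $D$.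
   Context: Paths are written from right to left; $s(p),t(p),l(p)$ denote the source, target and length of a path $p$. **Monomial algebras.** $A=kQ/I$ with $Q$ a finite quiver and $I$ an ideal of $kQ$ generated by paths, contained in the ideal $kQ_{\ge 1}$ generated by the arrows and containing some power of $kQ_{\ge 1}$. A maximal path of $A$ is a path $p\notin I$ such that $\alpha p=0=p\alpha$ in $A$ for every arrow $\alpha\in Q_1$; $\mathcal M$ is the set of maximal paths. **Trivial extension.** $D(A)=\mathrm{Hom}_k(A,k)$, with $(afb)(x)=f(bxa)$; $T(A)=A\oplus D(A)$ with multiplication $(a,f)(b,h)=(ab,ah+fb)$. **f-BC.** A fractional Brauer configuration (f-BC) is a quadruple $E=(E,P,L,d)$ where $E$ is a $G$-set for $G=\langle g\rangle\cong(\mathbb Z,+)$, $P$ and $L$ are partitions of $E$ ($P(e)$, $L(e)$ denote the classes containing $e$), and $d:E\to\mathbb Z_{+}$ is a function to the positive integers, such that: (f1) $L(e)\subseteq P(e)$ and $P(e)$ is finite for each $e$; (f2) $L(e_1)=L(e_2)$ implies $P(g(e_1))=P(g(e_2))$; (f3) $d$ is constant on $\langle g\rangle$-orbits; (f4) $P(e_1)=P(e_2)$ iff $P(g^{d(e_1)}(e_1))=P(g^{d(e_2)}(e_2))$; (f5) $L(e_1)=L(e_2)$ iff $L(g^{d(e_1)}(e_1))=L(g^{d(e_2)}(e_2))$; (f6) for all $e,h\in E$ the formal sequence $L(g^{d(e)-1}(e))\cdots L(g(e))L(e)$ is not a proper subsequence (of consecutive terms) of $L(g^{d(h)-1}(h))\cdots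 L(g(h))L(h)$. $E$ is symmetric if $g^{d(e)}(e)=e$ for all $e$. The f-degree function of $E$ is free if $d(e)$ equals the cardinality of the $\langle g\rangle$-orbit of $e$, for all $e$. **Associated quiver and algebra.** $Q_E$ has vertices the classes $P(e)$ and arrows the classes $L(e)$, where $L(e)$ goes from $P(e)$ to $P(g(e))$. The path $L(g^{d(e)-1}(e))\cdots L(g(e))L(e)$ is the special path starting at $e$. $I_E$ is the ideal of $kQ_E$ generated by: (R1) $L(g^{d(e)-1-j}(e))\cdots L(g(e))L(e)-L(g^{d(h)-1-j}(h))\cdots L(g(h))L(h)$, if $P(e)=P(h)$, $j\ge 0$ (with $j<d(e)$, $j<d(h)$ so that the expression makes sense), and $L(g^{d(e)-i}(e))=L(g^{d(h)-i}(h))$ for $1\le i\le j$; (R2) $L(e_n)\cdots L(e_2)L(e_1)$, if $P(g(e_i))=P(e_{i+1})$ for $1\le i\le n-1$ and $\bigcap_{i=1}^n g^{n-i}(L(e_i))=\emptyset$; (R3) $L(g^{n-1}(e))\cdots L(g(e))L(e)$ for $n>d(e)$. The algebra $kQ_E/I_E$ is the fractional Brauer configuration algebra of $E$. **Type S.** A standard sequence is $p=(g^{n-1}(e),\dots,g(e),e)$ with $e\in E$, $0\le n\le d(e)$ (for $n=0$ the trivial sequence $()_e$). Put ${}^\wedge p=(g^{d(e)-1}(e),\dots,g^n(e))$ if $0<n<d(e)$, ${}^\wedge p=()_{g^{d(e)}(e)}$ if $n=d(e)$, ${}^\wedge p=(g^{d(e)-1}(e),\dots,e)$ if $n=0$;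 and $p^\wedge=(g^{-1}(e),\dots,g^{n-d(e)}(e))$ if $0<n<d(e)$, $p^\wedge=()_e$ if $n=d(e)$, $p^\wedge=(g^{-1}(e),\dots,g^{-d(e)}(e))$ if $n=0$. Put $L(p)=L(g^{n-1}(e))\cdots L(e)$ for $n>0$ and $L(()_e)=e_{P(e)}$ (the trivial path at $P(e)$). Write $p\equiv q$ if $L(p)=L(q)$. For a set $\mathcal X$ of standard sequences (a single sequence being viewed as a one-element set), $[\mathcal X]$ is the set of standard sequences $q$ with $q\equiv p$ for some $p\in\mathcal X$, and ${}^\wedge\mathcal X=\{{}^\wedge p\mid p\in\mathcal X\}$, $\mathcal X^\wedge=\{p^\wedge\mid p\in\mathcal X\}$. An f-BC is of type S (an $f_s$-BC) if: (f7) $p\equiv q$ implies $[[{}^\wedge p]^\wedge]=[[{}^\wedge q]^\wedge]$. Its algebra is then called an $f_s$-BCA; it is called symmetric if $E$ is finite and symmetric. **Standing assumptions on $\Lambda$.** $\Lambda=kQ_\Lambda/I_\Lambda$ with $Q_\Lambda=Q_E$, $I_\Lambda=I_E$ for a symmetric $f_s$-BC $E$ with finite angle set (so $\Lambda$ is finite-dimensional) and free f-degree function, and $I_\Lambda$ is an admissible ideal. **Cuts.** Since $E$ is symmetric, all special paths are cycles in $Q_\Lambda$, called special cycles. Let $C_1,\dots,C_t$ be representatives of the special cycles up to cyclic permutation. A cutting set $D$ of $Q_\Lambda$ is a set of arrows of $Q_\Lambda$ containing exactly one arrow from each $C_i$, $i=1,\dots,t$ (i.e. exactly one element of $D$ occurs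 in $C_i$). The cut algebra associated with $D$ is $kQ_\Lambda/\langle I_\Lambda\cup D\rangle$. A cutting set $D$ is an admissible cut if (c1) $D$ consists of $t$ distinct arrows, and (c2) each arrow in $D$ appears in any special cycle $C_i$ at most once. **$T(A)$ as an $f_s$-BCA.** For a monomial algebra $A$, the f-BC $E_A=(E,P,L,d)$ is: $E$ consists of all $(e_i,p)$ with $p=(e_1\to\cdots\to e_n)\in\mathcal M$, $1\le i\le n=l(p)+1$, where $e_i$ is the $i$-th vertex passed by $p$ (different positions give different angles); $P((e_i,p))=\{(e'_j,p')\mid e'_j=e_i\text{ in }Q_0\}$; for $i<n$, $L((e_i,p))$ is the set of $(e'_j,p')$ such that the arrow of $p'$ starting at position $j$ equals the arrow of $p$ starting at position $i$; $L((e_n,p))=\{(e_n,p)\}$; $d((e_i,p))=l(p)+1$; $g((e_i,p))=(e_{i+1},p)$ for $i<n$, $g((e_n,p))=(e_1,p)$. This is a symmetric $f_s$-BC with free f-degree function. For $m\in\mathcal M$ let $\alpha_m$ be the arrow $L((t(m),m))$ of $Q_{E_A}$ given by the last position of $m$; it goes from $t(m)$ to $s(m)$. Every other arrow of $Q_{E_A}$ corresponds to an arrow $\alpha$ of $Q$. $T(A)$ is identified with the $f_s$-BCA $kQ_{E_A}/I_{E_A}$ via $\alpha\mapsto(\alpha,0)$, $\alpha_m\mapsto(0,m^\vee)$, where $m^\vee\in D(A)$ is the dual basis element of $m$ with respect to the basis of $A$ consisting of the paths not in $I$. *)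

(* Defs.v *)
From HB Require Import structures.
From mathcomp Require Import all_boot all_fingroup all_algebra finmap generic_quotient.
From mathcomp Require Import boolp classical_sets functions cardinality.
From mathcomp Require Import monalg.

Set Implicit Arguments.
Unset Strict Implicit.
Unset Printing Implicit Defensive.

Import GRing.Theory.
Local Open Scope ring_scope.

(* An associative unital k-algebra, given by its structure map, a ring morphism
   from k to the centre of A; the scalar product of a and x is algmap a * x.
   GRing.Algebra is not used because it imposes 1 != 0, which fails for a
   quotient by an improper ideal and for the path algebra of the empty quiver. *)
HB.mixin Record isKAlgebra (k : fieldType) A of GRing.PzRing A := {
  algmap : k -> A;
  algmap_zmod : zmod_morphism algmap;
  algmap_monoid : monoid_morphism algmap;
  algmapC : forall a x, algmap a * x = x * algmap a }.

#[short(type="kalgType")]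
HB.structure Definition KAlgebra (k : fieldType) :=
  {A of GRing.PzRing A & isKAlgebra k A}.

Definition is_alg_iso (k : fieldType) (A B : kalgType k) (f : A -> B) :=
  [/\ zmod_morphism f, monoid_morphism f,
      forall a : k, f (algmap a) = algmap a & bijective f].

Definition is_ideal (A : pzRingType) (J : set A) :=
  [/\ J 0, forall x y, J x -> J y -> J (x + y)
    & forall a x, J x -> J (a * x) /\ J (x * a)].

Definition ideal_gen (A : pzRingType) (X : set A) : set A :=
  [set x | forall J : set A, is_ideal J -> (X `<=` J)%classic -> J x]%classic.

Fixpoint ideal_pow (A : pzRingType) (J : set A) (n : nat) : set A :=
  if n is n'.+1 then
    ideal_gen [set x * y | x in J & y in ideal_pow J n']%classic
  else setT.

Section Quotient.
Variables (k : fieldType) (A : kalgType k) (X : set A).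

Definition ideal_genb : pred A := fun x => `[< ideal_gen X x >].

Lemma ideal_gen_ideal : is_ideal (ideal_gen X).
Proof.
split=> [J [] //|x y Jx Jy J JI XJ|a x Jx].
  by case: (JI) => _ + _; apply; [apply: Jx|apply: Jy].
by split=> J JI XJ; case: (JI) => _ _ /(_ a x) -/(_ (Jx J JI XJ)) [].
Qed.

Fact ideal_genb_zmod : zmod_closed ideal_genb.
Proof.
have [J0 JD JM] := ideal_gen_ideal.
split=> [|x y /asboolP Jx /asboolP Jy]; apply/asboolP => //.
by apply: JD => //; rewrite -mulN1r; apply: (JM _ _ Jy).1.
Qed.
HB.instance Definition _ := GRing.isZmodClosed.Build A ideal_genb ideal_genb_zmod.

Definition quo := Quotient.quot (GRing.ZmodClosed.clone A ideal_genb _).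
HB.instance Definition _ := GRing.Zmodule.on quo.
HB.instance Definition _ := EqQuotient.on quo.

Definition qpi (x : A) : quo := (\pi_quo x)%qT.

Lemma qpi_eq x y : qpi x = qpi y <-> ideal_gen X (x - y).
Proof.
split=> [/eqP|h]; last apply/eqP.
  by rewrite -[_ == _]Quotient.idealrBE => /asboolP.
by rewrite -[_ == _]Quotient.idealrBE; apply/asboolP.
Qed.

Lemma qpiB x y : qpi (x - y) = qpi x - qpi y.
Proof. by rewrite /qpi !piE. Qed.
Lemma qpiD x y : qpi (x + y) = qpi x + qpi y.
Proof. by rewrite /qpi !piE. Qed.
Lemma qreprK (x : quo) : qpi (repr x) = x.
Proof. exact: reprK. Qed.
Lemma qrepr x : ideal_gen X (repr (qpi x) - x).
Proof. by apply/qpi_eq; rewrite qreprK. Qed.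

Definition quo_mul (x y : quo) : quo := qpi (repr x * repr y).
Lemma qpiM x y : quo_mul (qpi x) (qpi y) = qpi (x * y).
Proof.
have [J0 JD JM] := ideal_gen_ideal.
apply/qpi_eq.
have -> : repr (qpi x) * repr (qpi y) - x * y =
   (repr (qpi x) - x) * repr (qpi y) + x * (repr (qpi y) - y).
  by rewrite mulrBl mulrBr addrA subrK.
apply: JD; [exact: (JM _ _ (qrepr x)).2|exact: (JM _ _ (qrepr y)).1].
Qed.

Fact quo_mulA : associative quo_mul.
Proof.
by move=> x y z; rewrite -[x]qreprK -[y]qreprK -[z]qreprK !qpiM mulrA.
Qed.
Fact quo_mul1r : left_id (qpi 1) quo_mul.
Proof. by move=> x; rewrite -[x]qreprK !qpiM mul1r. Qed.
Fact quo_mulr1 : right_id (qpi 1) quo_mul.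
Proof. by move=> x; rewrite -[x]qreprK !qpiM mulr1. Qed.
Fact quo_mulDl : left_distributive quo_mul +%R.
Proof.
by move=> x y z; rewrite -[x]qreprK -[y]qreprK -[z]qreprK -qpiD !qpiM -qpiD mulrDl.
Qed.
Fact quo_mulDr : right_distributive quo_mul +%R.
Proof.
by move=> x y z; rewrite -[x]qreprK -[y]qreprK -[z]qreprK -qpiD !qpiM -qpiD mulrDr.
Qed.
HB.instance Definition _ := GRing.Zmodule_isPzRing.Build quo
  quo_mulA quo_mul1r quo_mulr1 quo_mulDl quo_mulDr.

Definition quo_algmap (a : k) : quo := qpi (algmap a).
Fact quo_algmap_zmod : zmod_morphism quo_algmap.
Proof. by move=> a b; rewrite /quo_algmap algmap_zmod qpiB. Qed.
Fact quo_algmap_monoid : monoid_morphism quo_algmap.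
Proof.
split=> [|a b]; first by rewrite /quo_algmap algmap_monoid.
by rewrite /quo_algmap algmap_monoid -qpiM.
Qed.
Fact quo_algmapC a x : quo_algmap a * x = x * quo_algmap a.
Proof.
rewrite -[x]qreprK /quo_algmap.
change (quo_mul (qpi (algmap a)) (qpi (repr x)) =
        quo_mul (qpi (repr x)) (qpi (algmap a))).
by rewrite !qpiM algmapC.
Qed.
HB.instance Definition _ := isKAlgebra.Build k quo
  quo_algmap_zmod quo_algmap_monoid quo_algmapC.

End Quotient.
Arguments qpi {k A} X x.

(* T(A) = A (+) D(A), with D(A) = Hom_k(A, k) the type dual *)
Section TrivialExtension.
Variables (k : fieldType) (A : kalgType k).

Definition is_form : pred (A -> k) := fun f =>
  `[< forall (a : k) (x y : A), f (algmap a * x + y) = a * f x + f y >].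

Fact is_form_zmod : zmod_closed is_form.
Proof.
split=> [|f h /asboolP fl /asboolP hl]; apply/asboolP => a x y.
  by rewrite -[(0 : A -> k) _]/0 -[(0 : A -> k) x]/0 mulr0 addr0.
have E z : (f - h) z = f z - h z by [].
by rewrite !E fl hl mulrBr opprD addrACA.
Qed.
HB.instance Definition _ := GRing.isZmodClosed.Build (A -> k) is_form is_form_zmod.

Record dual := Dual { dual_fun :> A -> k; dualP : is_form dual_fun }.
HB.instance Definition _ := [isSub for dual_fun].
HB.instance Definition _ := [Choice of dual by <:].
HB.instance Definition _ := [SubChoice_isSubZmodule of dual by <:].

Fact dual_lact_form (a : A) (h : dual) : is_form (fun x => h (x * a)).
Proof.
have /asboolP hl := dualP h; apply/asboolP => b x y.
by rewrite mulrDl -mulrA hl.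
Qed.
Fact dual_ract_form (f : dual) (b : A) : is_form (fun x => f (b * x)).
Proof.
have /asboolP fl := dualP f; apply/asboolP => c x y.
by rewrite mulrDr mulrA -algmapC -mulrA fl.
Qed.
Definition dual_lact a h := Dual (dual_lact_form a h).
Definition dual_ract f b := Dual (dual_ract_form f b).

Definition trivext := (A * dual)%type.
HB.instance Definition _ := GRing.Zmodule.on trivext.

Definition trivext_mul (u v : trivext) : trivext :=
  (u.1 * v.1, dual_lact u.1 v.2 + dual_ract u.2 v.1).

Lemma dual_eq (f h : dual) : (forall x, f x = h x) -> f = h.
Proof. by move=> e; apply/val_inj/funext. Qed.
Lemma dualD (f h : dual) x : (f + h) x = f x + h x. Proof. by []. Qed.
Lemma dual_lactE a (h : dual) x : dual_lact a h x = h (x * a). Proof. by []. Qed.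
Lemma dual_ractE (f : dual) b x : dual_ract f b x = f (b * x). Proof. by []. Qed.
Lemma dual_zero x : (0 : dual) x = 0. Proof. by []. Qed.
Lemma dual_add (f : dual) x y : f (x + y) = f x + f y.
Proof.
have /asboolP/(_ 1 x y) := dualP f.
by rewrite algmap_monoid.1 !mul1r.
Qed.
Lemma dual0 (f : dual) : f 0 = 0.
Proof. by apply: (addrI (f 0)); rewrite -dual_add !addr0. Qed.

Fact trivext_mulA : associative trivext_mul.
Proof.
move=> [a f] [b h] [c l]; congr (_, _); rewrite /= ?mulrA //.
by apply: dual_eq => x; rewrite !(dualD, dual_lactE, dual_ractE) !mulrA addrA.
Qed.
Fact trivext_mul1r : left_id (1, 0) trivext_mul.
Proof.
move=> [a f]; congr (_, _); rewrite /= ?mul1r //.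
by apply: dual_eq => x; rewrite !(dualD, dual_lactE, dual_ractE, dual_zero) mulr1 addr0.
Qed.
Fact trivext_mulr1 : right_id (1, 0) trivext_mul.
Proof.
move=> [a f]; congr (_, _); rewrite /= ?mulr1 //.
by apply: dual_eq => x; rewrite !(dualD, dual_lactE, dual_ractE, dual_zero) mul1r add0r.
Qed.
Fact trivext_mulDl : left_distributive trivext_mul +%R.
Proof.
move=> [a f] [b h] [c l]; congr (_, _); rewrite /= ?mulrDl //.
by apply: dual_eq => x; rewrite !(dualD, dual_lactE, dual_ractE) mulrDr dual_add addrACA.
Qed.
Fact trivext_mulDr : right_distributive trivext_mul +%R.
Proof.
move=> [a f] [b h] [c l]; congr (_, _); rewrite /= ?mulrDr //.
by apply: dual_eq => x; rewrite !(dualD, dual_lactE, dual_ractE) mulrDl dual_add addrACA.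
Qed.
HB.instance Definition _ := GRing.Zmodule_isPzRing.Build trivext
  trivext_mulA trivext_mul1r trivext_mulr1 trivext_mulDl trivext_mulDr.

Definition trivext_algmap (a : k) : trivext := (algmap a, 0).
Fact trivext_algmap_zmod : zmod_morphism trivext_algmap.
Proof.
by move=> a b; congr (_, _); rewrite /= ?algmap_zmod ?subr0.
Qed.
Fact trivext_algmap_monoid : monoid_morphism trivext_algmap.
Proof.
split=> [|a b]; congr (_, _); rewrite /= ?algmap_monoid //.
by apply: dual_eq => x; rewrite !(dualD, dual_lactE, dual_ractE, dual_zero) addr0.
Qed.
Fact trivext_algmapC a (x : trivext) : trivext_algmap a * x = x * trivext_algmap a.
Proof.
case: x => b f; congr (_, _); rewrite /= ?algmapC //.
by apply: dual_eq => x; rewrite !(dualD, dual_lactE, dual_ractE, dual_zero) algmapC addrC.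
Qed.
HB.instance Definition _ := isKAlgebra.Build k trivext
  trivext_algmap_zmod trivext_algmap_monoid trivext_algmapC.

End TrivialExtension.

Record quiver := Quiver {
  vert : finType;
  arrow : finType;
  src : arrow -> vert;
  tgt : arrow -> vert }.

Section Paths.
Variable Q : quiver.

Fixpoint walk (v : vert Q) (s : seq (arrow Q)) : bool :=
  if s is a :: s' then (src a == v) && walk (tgt a) s' else true.

(* A path is a source together with the arrows in the order in which they are
   traversed: the path written a_n ... a_1 is stored as [:: a_1; ...; a_n]. *)
Record qpath := QPath {
  pval : vert Q * seq (arrow Q);
  pvalP : walk pval.1 pval.2 }.
HB.instance Definition _ := [isSub for pval].
HB.instance Definition _ := [Choice of qpath by <:].

Definition psrc (p : qpath) := (val p).1.
Definition parr (p : qpath) := (val p).2.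
Definition ptgt (p : qpath) := last (psrc p) (map (@tgt Q) (parr p)).

Definition vpath (v : vert Q) : qpath := @QPath (v, [::]) isT.

Fact apath_walk (a : arrow Q) : walk (src a) [:: a].
Proof. by rewrite /= eqxx. Qed.
Definition apath (a : arrow Q) : qpath := @QPath (src a, [:: a]) (apath_walk a).

(* p q: first q, then p; meaningful when psrc p = ptgt q *)
Definition pcat (p q : qpath) : qpath := insubd q (psrc q, parr q ++ parr p).

Lemma walk_cat v s1 s2 :
  walk v (s1 ++ s2) = walk v s1 && walk (last v (map (@tgt Q) s1)) s2.
Proof. by elim: s1 v => //= a s IH v; rewrite IH andbA. Qed.

Lemma val_pcat p q : psrc p = ptgt q ->
  val (pcat p q) = (psrc q, parr q ++ parr p).
Proof.
move=> e; rewrite /pcat val_insubd /= walk_cat -/(ptgt q) -e.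
by case: p q {e} => [[v s] /= sP] [[w t] /= tP]; rewrite /psrc /parr /= sP tP.
Qed.
Lemma psrc_pcat p q : psrc p = ptgt q -> psrc (pcat p q) = psrc q.
Proof. by move=> e; rewrite /psrc val_pcat. Qed.
Lemma ptgt_pcat p q : psrc p = ptgt q -> ptgt (pcat p q) = ptgt p.
Proof.
move=> e; rewrite /ptgt psrc_pcat // /parr val_pcat //= map_cat last_cat.
by rewrite -/(ptgt q) -e.
Qed.
Lemma pcatA p q r : psrc p = ptgt q -> psrc q = ptgt r ->
  pcat p (pcat q r) = pcat (pcat p q) r.
Proof.
move=> e1 e2; apply: val_inj.
rewrite !val_pcat ?ptgt_pcat ?psrc_pcat // /parr !val_pcat //=.
by rewrite catA.
Qed.
Lemma pcat_vl v q : v = ptgt q -> pcat (vpath v) q = q.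
Proof. by move=> e; apply: val_inj; rewrite val_pcat // cats0; case: q {e} => [[]]. Qed.
Lemma pcat_vr v p : psrc p = v -> pcat p (vpath v) = p.
Proof. by move=> e; apply: val_inj; rewrite val_pcat //= -e; case: p {e} => [[]]. Qed.

End Paths.

Definition path_alg (k : fieldType) (Q : quiver) := {malg k[qpath Q]}.
HB.instance Definition _ k Q := GRing.Zmodule.on (path_alg k Q).

HB.lock Definition kpathc (k : fieldType) (Q : quiver) (c : k) (p : qpath Q) :
  path_alg k Q := << c *g p >>.
Canonical kpathc_unlockable := Unlockable kpathc.unlock.

(* c times the product p q, which is 0 when p and q do not compose *)
Definition path_mul (k : fieldType) (Q : quiver) (c : k) (p q : qpath Q) :
  path_alg k Q := if psrc p == ptgt q then kpathc c (pcat p q) else 0.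

HB.lock Definition kQ_mul (k : fieldType) (Q : quiver) (x y : path_alg k Q) :
  path_alg k Q :=
  \sum_(p <- msupp x) \sum_(q <- msupp y) path_mul (x@_p * y@_q) p q.
Canonical kQ_mul_unlockable := Unlockable kQ_mul.unlock.

Section PathAlgebra.
Variables (k : fieldType) (Q : quiver).
Local Notation kQ := (path_alg k Q).

Definition kQ_algmap (a : k) : kQ := \sum_(v : vert Q) kpathc a (vpath v).

Lemma kpathc0 p : kpathc 0 p = 0 :> kQ.
Proof. by rewrite unlock; exact: monalgU0. Qed.
Lemma kpathcD c d p : kpathc (c + d) p = kpathc c p + kpathc d p :> kQ.
Proof. by rewrite unlock; exact: monalgUD. Qed.
Lemma kpathcB c d p : kpathc (c - d) p = kpathc c p - kpathc d p :> kQ.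
Proof. by rewrite unlock; exact: monalgUB. Qed.
Lemma mcoeff_kpathc c p q : (kpathc c p : kQ)@_q = c *+ (p == q).
Proof. by rewrite unlock; exact: mcoeffU. Qed.
Lemma msupp_kpathc c p : (msupp (kpathc c p : kQ) `<=` [fset p])%fset.
Proof. by rewrite unlock; exact: msuppU_le. Qed.

Lemma path_mul0 p q : path_mul 0 p q = 0 :> kQ.
Proof. by rewrite /path_mul kpathc0 if_same. Qed.
Lemma path_mulD c d p q :
  path_mul (c + d) p q = path_mul c p q + path_mul d p q :> kQ.
Proof. by rewrite /path_mul; case: (_ == _); rewrite ?kpathcD ?addr0. Qed.

Lemma kQ_mulw (dx dy : {fset qpath Q}) (x y : kQ) :
  (msupp x `<=` dx)%fset -> (msupp y `<=` dy)%fset ->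
  kQ_mul x y = \sum_(p <- dx) \sum_(q <- dy) path_mul (x@_p * y@_q) p q.
Proof.
move=> sx sy; rewrite unlock.
rewrite (big_fset_incl _ sx) => [|p _ px]; last first.
  by apply: big1 => q _; rewrite (mcoeff_outdom px) mul0r path_mul0.
apply: eq_bigr => p _; rewrite (big_fset_incl _ sy) // => q _ qy.
by rewrite (mcoeff_outdom qy) mulr0 path_mul0.
Qed.

Lemma kQ_mulDl : left_distributive (@kQ_mul k Q) +%R.
Proof.
move=> x y z; pose d := (msupp x `|` msupp y)%fset.
have sz := fsubset_refl (msupp z).
rewrite (@kQ_mulw d _ (x + y) z (msuppD_le x y) sz).
rewrite (@kQ_mulw d _ x z (fsubsetUl _ _) sz) (@kQ_mulw d _ y z (fsubsetUr _ _) sz).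
rewrite -big_split; apply: eq_bigr => p _; rewrite -big_split.
by apply: eq_bigr => q _; rewrite mcoeffD mulrDl path_mulD.
Qed.
Lemma kQ_mulDr : right_distributive (@kQ_mul k Q) +%R.
Proof.
move=> z x y; pose d := (msupp x `|` msupp y)%fset.
have sz := fsubset_refl (msupp z).
rewrite (@kQ_mulw _ d z (x + y) sz (msuppD_le x y)).
rewrite (@kQ_mulw _ d z x sz (fsubsetUl _ _)) (@kQ_mulw _ d z y sz (fsubsetUr _ _)).
rewrite -big_split; apply: eq_bigr => p _; rewrite -big_split.
by apply: eq_bigr => q _; rewrite mcoeffD mulrDr path_mulD.
Qed.
Lemma kQ_mul0l (x : kQ) : kQ_mul 0 x = 0.
Proof. by apply: (addrI (kQ_mul 0 x)); rewrite -kQ_mulDl !addr0. Qed.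
Lemma kQ_mul0r (x : kQ) : kQ_mul x 0 = 0.
Proof. by apply: (addrI (kQ_mul x 0)); rewrite -kQ_mulDr !addr0. Qed.

Lemma kQ_mul_kpathc (c d : k) (p q : qpath Q) :
  kQ_mul (kpathc c p) (kpathc d q) = path_mul (c * d) p q.
Proof.
rewrite (kQ_mulw (msupp_kpathc c p) (msupp_kpathc d q)).
by rewrite !big_seq_fset1 !mcoeff_kpathc !eqxx !mulr1n.
Qed.

Lemma kQ_ind (P : kQ -> Prop) : P 0 ->
  (forall x y, P x -> P y -> P (x + y)) -> (forall c p, P (kpathc c p)) ->
  forall x, P x.
Proof.
move=> P0 PD PU x; rewrite [x]monalgE; apply: big_ind => // p _.
by have := PU (x@_p) p; rewrite unlock.
Qed.

Fact kQ_mulA : associative (@kQ_mul k Q).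
Proof.
move=> x y z; elim/kQ_ind: x => [|x x' IH IH'|c p]; first by rewrite !kQ_mul0l.
  by rewrite !kQ_mulDl IH IH'.
elim/kQ_ind: y => [|y y' IH IH'|d q]; first by rewrite !(kQ_mul0l, kQ_mul0r).
  by rewrite !(kQ_mulDl, kQ_mulDr) IH IH'.
elim/kQ_ind: z => [|z z' IH IH'|e r]; first by rewrite !kQ_mul0r.
  by rewrite !kQ_mulDr IH IH'.
rewrite !kQ_mul_kpathc /path_mul.
case: (psrc q =P ptgt r) => qr; case: (psrc p =P ptgt q) => pq.
- rewrite !kQ_mul_kpathc /path_mul psrc_pcat // ptgt_pcat //.
  by rewrite pq qr !eqxx mulrA pcatA.
- by rewrite kQ_mul_kpathc kQ_mul0l /path_mul ptgt_pcat // (introF eqP pq).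
- by rewrite kQ_mul_kpathc kQ_mul0r /path_mul psrc_pcat // (introF eqP qr).
by rewrite kQ_mul0r kQ_mul0l.
Qed.

Lemma kQ_algmap_mull a c p : kQ_mul (kQ_algmap a) (kpathc c p) = kpathc (a * c) p.
Proof.
have -> : kQ_mul (kQ_algmap a) (kpathc c p) =
    \sum_(v : vert Q) kQ_mul (kpathc a (vpath v)) (kpathc c p).
  rewrite /kQ_algmap; elim/big_rec2: _ => [|v x y _ <-]; first exact: kQ_mul0l.
  exact: kQ_mulDl.
rewrite (bigD1 (ptgt p)) //= kQ_mul_kpathc /path_mul eqxx pcat_vl //.
rewrite big1 ?addr0 // => v /negPf vp; rewrite kQ_mul_kpathc /path_mul.
by rewrite [psrc _]/= /psrc /= vp.
Qed.
Lemma kQ_algmap_mulr a c p : kQ_mul (kpathc c p) (kQ_algmap a) = kpathc (c * a) p.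
Proof.
have -> : kQ_mul (kpathc c p) (kQ_algmap a) =
    \sum_(v : vert Q) kQ_mul (kpathc c p) (kpathc a (vpath v)).
  rewrite /kQ_algmap; elim/big_rec2: _ => [|v x y _ <-]; first exact: kQ_mul0r.
  exact: kQ_mulDr.
rewrite (bigD1 (psrc p)) //= kQ_mul_kpathc /path_mul eqxx pcat_vr //.
rewrite big1 ?addr0 // => v /negPf vp; rewrite kQ_mul_kpathc /path_mul.
by rewrite eq_sym [ptgt _]/= vp.
Qed.

Fact kQ_mul1r : left_id (kQ_algmap 1) (@kQ_mul k Q).
Proof.
move=> x; elim/kQ_ind: x => [|x x' IH IH'|c p]; first by rewrite kQ_mul0r.
  by rewrite kQ_mulDr IH IH'.
by rewrite kQ_algmap_mull mul1r.
Qed.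
Fact kQ_mulr1 : right_id (kQ_algmap 1) (@kQ_mul k Q).
Proof.
move=> x; elim/kQ_ind: x => [|x x' IH IH'|c p]; first by rewrite kQ_mul0l.
  by rewrite kQ_mulDl IH IH'.
by rewrite kQ_algmap_mulr mulr1.
Qed.
HB.instance Definition _ := GRing.Zmodule_isPzRing.Build kQ
  kQ_mulA kQ_mul1r kQ_mulr1 kQ_mulDl kQ_mulDr.

Fact kQ_algmap_zmod : zmod_morphism kQ_algmap.
Proof.
move=> a b; rewrite /kQ_algmap -sumrB.
by apply: eq_bigr => v _; rewrite kpathcB.
Qed.
Fact kQ_algmapC a (x : kQ) : kQ_algmap a * x = x * kQ_algmap a.
Proof.
elim/kQ_ind: x => [|x x' IH IH'|c p]; first by rewrite mulr0 mul0r.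
  by rewrite mulrDl mulrDr IH IH'.
change (kQ_mul (kQ_algmap a) (kpathc c p) = kQ_mul (kpathc c p) (kQ_algmap a)).
by rewrite kQ_algmap_mull kQ_algmap_mulr mulrC.
Qed.
Fact kQ_algmap_monoid : monoid_morphism kQ_algmap.
Proof.
split=> // a b.
rewrite {3}/kQ_algmap mulr_sumr; apply: eq_bigr => v _.
exact/esym/kQ_algmap_mull.
Qed.
HB.instance Definition _ := isKAlgebra.Build k kQ
  kQ_algmap_zmod kQ_algmap_monoid kQ_algmapC.

Definition kpath (p : qpath Q) : kQ := kpathc 1 p.

(* the product a_n ... a_1 in kQ, for s = [:: a_1; ...; a_n] *)
Definition arrow_prod (s : seq (arrow Q)) : kQ :=
  \prod_(a <- rev s) kpath (apath a).

(* the ideal kQ_{>=1} *)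
Definition arrow_ideal : set kQ := ideal_gen (range (fun a => kpath (apath a))).

Definition admissible_ideal (J : set kQ) :=
  [/\ is_ideal J, (J `<=` ideal_pow arrow_ideal 2)%classic
    & exists N, (ideal_pow arrow_ideal N `<=` J)%classic].

Definition monomial_ideal (J : set kQ) :=
  [/\ exists X : set (qpath Q), J = ideal_gen (kpath @` X)%classic,
      (J `<=` arrow_ideal)%classic
    & exists N, (ideal_pow arrow_ideal N `<=` J)%classic].

End PathAlgebra.

(* Only finite angle sets are considered, which makes the finiteness of P(e) in
   (f1) automatic; the generator g of the infinite cyclic group acts by rotate. *)
Record fbc_data := FbcData {
  angle : finType;
  rotate : {perm angle};
  Ppart : {set {set angle}};
  Lpart : {set {set angle}};
  fdeg : angle -> nat;
  Ppart_partition : finset.partition Ppart [set: angle];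
  Lpart_partition : finset.partition Lpart [set: angle] }.

Section FractionalBrauerConfiguration.
Variable E : fbc_data.
Local Notation g := (@rotate E).
Implicit Types e h : angle E.

Definition Pcl e : {set angle E} := finset.pblock (Ppart E) e.
Definition Lcl e : {set angle E} := finset.pblock (Lpart E) e.

Definition Lseq e n : seq {set angle E} := [seq Lcl (iter i g e) | i <- iota 0 n].

Record is_fBC : Prop := {
  fdeg_gt0 : forall e, (0 < fdeg e)%N;
  fBC_f1 : forall e, Lcl e \subset Pcl e;
  fBC_f2 : forall e1 e2, Lcl e1 = Lcl e2 -> Pcl (g e1) = Pcl (g e2);
  fBC_f3 : forall e h, h \in porbit g e -> fdeg h = fdeg e;
  fBC_f4 : forall e1 e2,
    Pcl e1 = Pcl e2 <-> Pcl (iter (fdeg e1) g e1) = Pcl (iter (fdeg e2) g e2);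
  fBC_f5 : forall e1 e2,
    Lcl e1 = Lcl e2 <-> Lcl (iter (fdeg e1) g e1) = Lcl (iter (fdeg e2) g e2);
  fBC_f6 : forall e h, infix (Lseq e (fdeg e)) (Lseq h (fdeg h)) ->
    Lseq e (fdeg e) = Lseq h (fdeg h) }.

Definition fbc_symmetric := forall e, iter (fdeg e) g e = e.

Definition fdeg_free := forall e, fdeg e = #|porbit g e|.

(* The standard sequence (g^{n-1}(e), ..., g(e), e) is encoded as (e, n), the
   trivial sequence at e being (e, 0). *)
Definition standard : set (angle E * nat) := [set p | (p.2 <= fdeg p.1)%N]%classic.

Definition lcompl (p : angle E * nat) : angle E * nat :=
  (iter p.2 g p.1, (fdeg p.1 - p.2)%N).
Definition rcompl (p : angle E * nat) : angle E * nat :=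
  (iter (fdeg p.1 - p.2) (g^-1)%g p.1, (fdeg p.1 - p.2)%N).

(* L(p), as the pair of a source and a sequence of arrows *)
Definition Lstd (p : angle E * nat) := (Pcl p.1, Lseq p.1 p.2).

Definition std_closure (X : set (angle E * nat)) : set (angle E * nat) :=
  [set q | standard q /\ exists2 p, X p & Lstd q = Lstd p]%classic.

Definition type_S := forall p q, standard p -> standard q -> Lstd p = Lstd q ->
  std_closure (rcompl @` std_closure [set lcompl p])%classic =
  std_closure (rcompl @` std_closure [set lcompl q])%classic.

Fact Pcl_in e : Pcl e \in Ppart E.
Proof.
by rewrite finset.pblock_mem // (cover_partition (Ppart_partition E)) finset.in_setT.
Qed.
Fact Lcl_in e : Lcl e \in Lpart E.
Proof.
by rewrite finset.pblock_mem // (cover_partition (Lpart_partition E)) finset.in_setT.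
Qed.

Definition QE_vert : finType := {x : {set angle E} | x \in Ppart E}.
Definition QE_arrow : finType := {x : {set angle E} | x \in Lpart E}.
Definition Pvert e : QE_vert := exist _ (Pcl e) (Pcl_in e).
Definition Larrow e : QE_arrow := exist _ (Lcl e) (Lcl_in e).

Fact Larrow_ex (a : QE_arrow) : exists e, e \in val a.
Proof.
apply/set0Pn; apply: contraL (valP a) => /eqP ->.
by have /and3P[] := Lpart_partition E.
Qed.

(* The source and the target of the arrow L(e) are P(e) and P(g(e)); by (f1)
   and (f2) they do not depend on the element e chosen in the class. *)
Definition QE : quiver :=
  @Quiver QE_vert QE_arrow (fun a => Pvert (xchoose (Larrow_ex a)))
    (fun a => Pvert (g (xchoose (Larrow_ex a)))).

Definition Larrows e n : seq (arrow QE) := [seq Larrow (iter i g e) | i <- iota 0 n].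

Definition special e : seq (arrow QE) := Larrows e (fdeg e).

Inductive IE_rel (k : fieldType) : path_alg k QE -> Prop :=
| IE_R1 e h j of Pcl e = Pcl h & (j < fdeg e)%N & (j < fdeg h)%N
    & (forall i, (1 <= i <= j)%N ->
         Lcl (iter (fdeg e - i) g e) = Lcl (iter (fdeg h - i) g h)) :
    IE_rel (arrow_prod k (Larrows e (fdeg e - j)) -
            arrow_prod k (Larrows h (fdeg h - j)))
(* the sequence e_1, ..., e_n of (R2) is e 0, ..., e n.-1 *)
| IE_R2 n (e : nat -> angle E) of (0 < n)%N
    & (forall i, (i.+1 < n)%N -> Pcl (g (e i)) = Pcl (e i.+1))
    & (\bigcap_(i < n) [set iter (n.-1 - i) g x | x in Lcl (e i)] = finset.set0)%SET :
    IE_rel (arrow_prod k [seq Larrow (e i) : arrow QE | i <- iota 0 n])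
| IE_R3 e n of (fdeg e < n)%N :
    IE_rel (arrow_prod k (Larrows e n)).

Definition IE (k : fieldType) : set (path_alg k QE) := ideal_gen (@IE_rel k).
Arguments IE k : clear implicits.

Definition fBCA (k : fieldType) : kalgType k := quo (IE k).

Definition cyclic_eq : rel (angle E) := fun e h =>
  [exists i : 'I_(fdeg e).+1, special h == rot i (special e)].

Definition ncycles : nat := #|equivalence_partition cyclic_eq [set: angle E]|.

Definition cutting_set (D : {set arrow QE}) :=
  forall e, #|[set a in D | a \in special e]| = 1%N.

Definition admissible_cut (D : {set arrow QE}) :=
  [/\ cutting_set D, #|D| = ncycles
    & forall a e, a \in D -> (count_mem a (special e) <= 1)%N].

Definition cut_algebra (k : fieldType) (D : {set arrow QE}) : kalgType k :=
  quo (IE k `|` [set kpath k (apath a) | a in [set` D]])%classic.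

Definition sym_fsBC (k : fieldType) :=
  [/\ is_fBC, type_S, fbc_symmetric, fdeg_free & admissible_ideal (IE k)].

End FractionalBrauerConfiguration.
Arguments IE E k : clear implicits.

Section TrivialExtensionOfMonomial.
Variables (k : fieldType) (Q : quiver) (J : set (path_alg k Q)).

Definition maximal_path (p : qpath Q) :=
  ~ J (kpath k p) /\ forall a : arrow Q,
    qpi J (kpath k (apath a) * kpath k p) = 0 /\
    qpi J (kpath k p * kpath k (apath a)) = 0.

(* There are finitely many maximal paths as soon as J contains a power of the
   arrow ideal; fset_set would return the empty set otherwise. *)
Definition maximal_paths : {fset qpath Q} := fset_set maximal_path.

(* The angle (e_{i+1}, m) is encoded as the maximal path m together with the
   position i, 0 <= i <= l(m). *)
Definition EA_angle : finType := {m : maximal_paths & 'I_(size (parr (val m))).+1}.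

Definition EA_rot (x : EA_angle) : EA_angle := Tagged _ (ordS (tagged x)).
Definition EA_unrot (x : EA_angle) : EA_angle := Tagged _ (ord_pred (tagged x)).
Fact EA_rotK : cancel EA_rot EA_unrot.
Proof. by case=> m i; rewrite /EA_rot /EA_unrot /= ordSK. Qed.

Definition EA_vertex (x : EA_angle) : vert Q :=
  let m := val (tag x) in
  nth (psrc m) (psrc m :: map (@tgt Q) (parr m)) (tagged x).

(* the arrow of m starting at position i, or the angle itself at the last
   position *)
Definition EA_label (x : EA_angle) : arrow Q + EA_angle :=
  if onth (parr (val (tag x))) (tagged x) is Some a then inl a else inr x.

Definition EA_deg (x : EA_angle) : nat := (size (parr (val (tag x)))).+1.

Definition EA : fbc_data := FbcData (perm (can_inj EA_rotK)) EA_deg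
  (preim_partitionP EA_vertex [set: EA_angle])
  (preim_partitionP EA_label [set: EA_angle]).

Definition alpha (m : maximal_paths) : arrow (QE EA) :=
  @Larrow EA (existT _ m ord_max : EA_angle).

Definition alphas : {set arrow (QE EA)} := [set alpha m | m : maximal_paths].

(* f = m^\vee, for the basis of A = kQ/J given by the paths not in J *)
Definition is_dual_basis_elt (m : qpath Q) (f : dual (quo J)) :=
  forall p, ~ J (kpath k p) -> f (qpi J (kpath k p)) = (p == m)%:R.

(* {(0, m^\vee) | m maximal path} in T(A) *)
Definition dual_maximal : set (trivext (quo J)) :=
  [set x | x.1 = 0 /\ exists2 m, maximal_path m & is_dual_basis_elt m x.2]%classic.

Definition TA_identification (f : fBCA EA k -> trivext (quo J)) :=
  [/\ is_alg_iso f,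
      forall x : EA_angle,
        f (qpi (IE _ k) (kpath k (vpath (@Pvert EA x : vert (QE EA))))) =
        (qpi J (kpath k (vpath (EA_vertex x))), 0),
      forall (x : EA_angle) (a : arrow Q), EA_label x = inl a ->
        f (qpi (IE _ k) (kpath k (apath (@Larrow EA x : arrow (QE EA))))) =
        (qpi J (kpath k (apath a)), 0)
    & forall m : maximal_paths,
        exists2 h : dual (quo J), is_dual_basis_elt (val m) h &
          f (qpi (IE _ k) (kpath k (apath (alpha m)))) = (0, h)].

End TrivialExtensionOfMonomial.
Arguments dual_maximal {k Q} J x.

(* Isomorphism classes are plain predicates because the type of k-algebras does
   not fit in the universe of [set]. *)
Section Classes.
Variable k : fieldType.

Definition iso_class (A : kalgType k) : kalgType k -> Prop :=
  fun B => exists f : A -> B, is_alg_iso f.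

Record alg_pair := AlgPair { pair_alg : kalgType k; pair_set : set pair_alg }.
Arguments pair_set : clear implicits.

Definition pair_class (X : alg_pair) : alg_pair -> Prop :=
  fun Y => exists2 f : pair_alg X -> pair_alg Y,
    is_alg_iso f & (f @` pair_set X = pair_set Y)%classic.

(* The pair (Lambda, D), D being viewed as a set of elements of Lambda *)
Definition cut_pair (E : fbc_data) (D : {set arrow (QE E)}) : alg_pair :=
  @AlgPair (fBCA E k) [set qpi (IE E k) (kpath k (apath a)) | a in [set` D]]%classic.

Definition monomial_classes := {C : kalgType k -> Prop |
  exists (Q : quiver) (J : set (path_alg k Q)),
    monomial_ideal J /\ C = iso_class (quo J)}.

Definition cut_classes := {C : alg_pair -> Prop |
  exists (E : fbc_data) (D : {set arrow (QE E)}),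
    [/\ sym_fsBC E k, admissible_cut D & C = pair_class (cut_pair D)]}.

Definition monomial_class (Q : quiver) (J : set (path_alg k Q))
    (hJ : monomial_ideal J) : monomial_classes :=
  exist _ (iso_class (quo J))
    (ex_intro _ Q (ex_intro _ J (conj hJ erefl))).

Definition cut_class (E : fbc_data) (D : {set arrow (QE E)})
    (hE : sym_fsBC E k) (hD : admissible_cut D) : cut_classes :=
  exist _ (pair_class (cut_pair D))
    (ex_intro _ E (ex_intro _ D (And3 hE hD erefl))).

End Classes.

(* Main.v *)
Require Import Defs.
From mathcomp Require Import all_boot all_fingroup all_algebra finmap generic_quotient.
From mathcomp Require Import boolp classical_sets functions cardinality.
From mathcomp Require Import monalg zify.

Set Implicit Arguments.
Unset Strict Implicit.
Unset Printing Implicit Defensive.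

Import GRing.Theory.
Local Open Scope ring_scope.

(** Why the theorem is true. Three statements carry the proof.

    (1) Let D be an admissible cut of the algebra L of a symmetric configuration
    E. There are as many arrows in D as special cycles up to rotation, so each
    arrow of D lies on one cycle, at one place (admissible_cycle_cut). A path
    that goes through D therefore determines its complement, the path that
    closes it up to a special cycle (compl_inj), and relation IE_R1 says exactly
    that two complements of the same path are equal in L (compl_R1). After the
    cut, both sides of IE_R1 vanish or are the same path (R1_cut), hence the cut
    algebra A is monomial; its nonzero paths are the standard paths that avoid D
    (cut_idealE). The other nonzero paths of L go through D once, and modulo
    IE_R1 they correspond to their complements, which are the nonzero paths of
    A. Let tr be the sum of the coefficients at the special cycles. Then
    y |-> (y, x |-> tr (x y)) is a morphism from L to T(A), because of the three
    factors of a special cycle exactly one goes through D (pairingM), and it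
    maps a basis to a basis (cut_map_iso). The paths that complete an arrow of D
    are the maximal paths of A (maximal_compl, compl_maximal). One half of this
    uses that the ideal is admissible: otherwise IE_R1 could identify an arrow
    with a longer path. So D corresponds to the dual basis elements of the
    maximal paths, and (L, D) is equivalent to the pair of T(A)
    (cut_pair_trivext).

    (2) The configuration EA J of a monomial algebra kQ/J satisfies the
    hypotheses of (1), and its cut algebra is kQ/J: a standard path that avoids
    the arrows alpha_m is a factor of a maximal path m, and every nonzero path
    of kQ/J is such a factor (EA_path_iso). Condition type_S and admissibility
    also come from the cut (cycle_cut_type_S, EA_admissible). By (1), the
    algebra of EA J is identified with T(kQ/J).

    (3) If two monomial algebras are isomorphic, then there is a bijection
    between their nonzero paths that respects compositions (iso_path_iso). An
    isomorphism F respects the radical filtration and permutes the characters,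
    hence the vertices. Its linear part on arrows is an invertible matrix, and a
    nonzero term of the determinant gives a bijection s of the nonzero arrows
    along which the matrix does not vanish; it is compatible with the permutation
    of the vertices. If p vanishes then so does F(p), whose coefficient at s(p)
    is a nonzero product unless s(p) vanishes too. Thus s maps zero paths to zero
    paths, and counting nonzero paths, for F and for its inverse, shows that s
    preserves nonzero paths as well.

    By (3) the pair of T(A) depends only on the isomorphism class of A, and the
    cut algebra of a pair depends only on its class because it is the quotient
    by the ideal that D generates (cut_pair_cut_algebra). The two maps on
    classes are then mutually inverse by (1) and (2). *)

(** * Algebra morphisms, quotients and trivial extensions *)

Definition is_alg_mor (k : fieldType) (A B : kalgType k) (f : A -> B) :=
  [/\ zmod_morphism f, monoid_morphism f & forall a : k, f (algmap a) = algmap a].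

Section AlgMor.
Variable k : fieldType.
Implicit Types A B C : kalgType k.

Lemma amorB A B (f : A -> B) : is_alg_mor f -> {morph f : x y / x - y}.
Proof. by case. Qed.
Lemma amor0 A B (f : A -> B) : is_alg_mor f -> f 0 = 0.
Proof. by move=> fm; rewrite -(subrr 0) amorB ?subrr. Qed.
Lemma amorD A B (f : A -> B) : is_alg_mor f -> {morph f : x y / x + y}.
Proof.
move=> fm x y; have fN z : f (- z) = - f z.
  by have := amorB fm 0 z; rewrite (amor0 fm) !sub0r.
by have := amorB fm x (- y); rewrite opprK fN opprK.
Qed.
Lemma amorM A B (f : A -> B) : is_alg_mor f -> {morph f : x y / x * y}.
Proof. by case=> _ []. Qed.
Lemma amor1 A B (f : A -> B) : is_alg_mor f -> f 1 = 1.
Proof. by case=> _ []. Qed.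
Lemma amorZ A B (f : A -> B) : is_alg_mor f -> forall a, f (algmap a) = algmap a.
Proof. by case. Qed.
Lemma amor_sum A B (f : A -> B) : is_alg_mor f ->
  forall I (r : seq I) (P : pred I) (F : I -> A),
  f (\sum_(i <- r | P i) F i) = \sum_(i <- r | P i) f (F i).
Proof. by move=> fm I r P F; apply: (big_morph f (amorD fm) (amor0 fm)). Qed.

Lemma amor_comp A B C (g : B -> C) (f : A -> B) :
  is_alg_mor g -> is_alg_mor f -> is_alg_mor (g \o f).
Proof.
move=> gm fm; split=> [x y|| a] /=; rewrite ?amorB ?amorZ //.
by split=> [|x y] /=; rewrite ?amor1 ?amorM.
Qed.

Lemma iso_mor A B (f : A -> B) : is_alg_iso f -> is_alg_mor f.
Proof. by case. Qed.
Lemma mor_iso A B (f : A -> B) : is_alg_mor f -> bijective f -> is_alg_iso f.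
Proof. by case. Qed.

Lemma iso_id A : is_alg_iso (@idfun A).
Proof. by split=> //; exists idfun. Qed.

Lemma iso_comp A B C (g : B -> C) (f : A -> B) :
  is_alg_iso g -> is_alg_iso f -> is_alg_iso (g \o f).
Proof.
move=> gi fi; apply: mor_iso; first by apply: amor_comp; apply: iso_mor.
by case: gi fi => _ _ _ gb [_ _ _ fb]; apply: bij_comp.
Qed.

Lemma iso_inv A B (f : A -> B) : is_alg_iso f ->
  exists g : B -> A, [/\ is_alg_iso g, cancel f g & cancel g f].
Proof.
move=> fi; have fm := iso_mor fi; case: (fi) => _ _ _ [g fK gK].
exists g; split=> //; split=> [x y|| a|]; last by exists f.
- by rewrite -[x in LHS]gK -[y in LHS]gK -(amorB fm) fK.
- split=> [|x y]; first by rewrite -(amor1 fm) fK.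
  by rewrite -[x in LHS]gK -[y in LHS]gK -(amorM fm) fK.
- by rewrite -(amorZ fm) fK.
Qed.

Lemma iso_classE A B (f : A -> B) : is_alg_iso f -> iso_class A = iso_class B.
Proof.
move=> fi; have [g [gi _ _]] := iso_inv fi; apply/funext => C; apply/propext.
by split=> [[h hi]|[h hi]]; eexists; apply: iso_comp hi _; eassumption.
Qed.

Lemma iso_class_ex A B : iso_class A = iso_class B ->
  exists f : A -> B, is_alg_iso f.
Proof.
move=> e; have : iso_class B B by exists idfun; exact: iso_id.
by rewrite -e.
Qed.

Lemma pair_classE (X Y : alg_pair k) (f : pair_alg X -> pair_alg Y) :
  is_alg_iso f -> (f @` @pair_set k X = @pair_set k Y)%classic ->
  pair_class X = pair_class Y.
Proof.
move=> fi fXY; have [g [gi fK gK]] := iso_inv fi.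
have gYX : (g @` @pair_set k Y = @pair_set k X)%classic.
  rewrite -fXY image_comp; apply/seteqP; split=> [_ [x Xx <-]|x Xx] /=.
    by rewrite fK.
  by exists x => //=; rewrite fK.
apply/funext => Z; apply/propext; split=> [[h hi hXZ]|[h hi hYZ]].
  by exists (h \o g); [exact: iso_comp|rewrite -image_comp gYX].
by exists (h \o f); [exact: iso_comp|rewrite -image_comp fXY].
Qed.

Lemma pair_class_ex (X Y : alg_pair k) : pair_class X = pair_class Y ->
  exists2 f : pair_alg X -> pair_alg Y,
    is_alg_iso f & (f @` @pair_set k X = @pair_set k Y)%classic.
Proof.
move=> e; have : pair_class Y Y.
  by exists idfun; [exact: iso_id|exact: image_id].
by rewrite -e.
Qed.

End AlgMor.

Section Ideals.
Variable A : pzRingType.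
Implicit Types (J X : set A).

Lemma ideal0 J : is_ideal J -> J 0. Proof. by case. Qed.
Lemma idealD J : is_ideal J -> forall x y, J x -> J y -> J (x + y).
Proof. by case. Qed.
Lemma idealMl J : is_ideal J -> forall a x, J x -> J (a * x).
Proof. by case=> _ _ JM a x /(JM a x) []. Qed.
Lemma idealMr J : is_ideal J -> forall a x, J x -> J (x * a).
Proof. by case=> _ _ JM a x /(JM a x) []. Qed.
Lemma idealN J : is_ideal J -> forall x, J x -> J (- x).
Proof. by move=> JI x Jx; rewrite -mulN1r; apply: idealMl. Qed.
Lemma idealB J : is_ideal J -> forall x y, J x -> J y -> J (x - y).
Proof. by move=> JI x y Jx Jy; apply: idealD => //; apply: idealN. Qed.
Lemma ideal_sum J : is_ideal J -> forall I (r : seq I) (P : pred I) (F : I -> A),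
  (forall i, P i -> J (F i)) -> J (\sum_(i <- r | P i) F i).
Proof.
by move=> JI I r P F FJ; elim/big_ind: _ => //; [exact: ideal0|exact: idealD].
Qed.

Lemma sub_ideal_gen X : (X `<=` ideal_gen X)%classic.
Proof. by move=> x Xx J _; apply. Qed.
Lemma ideal_genS X J : is_ideal J -> (X `<=` J)%classic ->
  (ideal_gen X `<=` J)%classic.
Proof. by move=> JI XJ x; apply. Qed.
Lemma ideal_genid J : is_ideal J -> ideal_gen J = J.
Proof.
by move=> JI; apply/seteqP; split; [exact: ideal_genS|exact: sub_ideal_gen].
Qed.
End Ideals.

Section QuoMor.
Variables (k : fieldType) (A : kalgType k) (X : set A).

Lemma qpi_mul (x y : A) : qpi X (x * y) = qpi X x * qpi X y.
Proof. exact: (esym (qpiM X x y)). Qed.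
Lemma qpi_mor : is_alg_mor (qpi X).
Proof. by split=> [x y|| a] //; [exact: qpiB|split=> // x y; exact: qpi_mul]. Qed.
Lemma qpi_eq0 x : qpi X x = 0 <-> ideal_gen X x.
Proof. by rewrite -(amor0 qpi_mor) qpi_eq subr0. Qed.
Lemma quo_ind (P : quo X -> Prop) : (forall x, P (qpi X x)) -> forall x, P x.
Proof. by move=> h x; rewrite -[x]qreprK. Qed.

Variables (B : kalgType k) (f : A -> B).
Hypothesis fm : is_alg_mor f.

Lemma ker_ideal : is_ideal [set x | f x = 0]%classic.
Proof.
split=> [|x y /= fx fy|a x /= fx] /=; first exact: amor0.
  by rewrite amorD // fx fy addr0.
by rewrite !amorM // fx mulr0 mul0r.
Qed.

Definition qlift (x : quo X) : B := f (repr x).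

Hypothesis fX : forall x, X x -> f x = 0.

Lemma qliftE x : qlift (qpi X x) = f x.
Proof.
apply/eqP; rewrite -subr_eq0 -(amorB fm); apply/eqP.
exact: (ideal_genS ker_ideal fX (@qrepr k A X x)).
Qed.

Lemma qlift_mor : is_alg_mor qlift.
Proof.
split=> [x y|| a]; last by rewrite -(amorZ qpi_mor) qliftE amorZ.
  by elim/quo_ind: x => x; elim/quo_ind: y => y; rewrite -qpiB !qliftE amorB.
split=> [|x y]; first by rewrite -(amor1 qpi_mor) qliftE amor1.
by elim/quo_ind: x => x; elim/quo_ind: y => y; rewrite -qpi_mul !qliftE amorM.
Qed.
End QuoMor.

Section QuoIso.
Variables (k : fieldType) (A B : kalgType k) (X : set A) (Y : set B).

(** The maps start from A and B rather than from the quotients, so that only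
    generators of the ideals have to be killed. *)
Lemma quo_iso (f : A -> quo Y) (g : B -> quo X) :
  is_alg_mor f -> is_alg_mor g ->
  (forall x, X x -> f x = 0) -> (forall y, Y y -> g y = 0) ->
  (forall x, qlift g (f x) = qpi X x) -> (forall y, qlift f (g y) = qpi Y y) ->
  is_alg_iso (qlift f : quo X -> quo Y).
Proof.
move=> fm gm fX gY fg gf; apply: mor_iso; first exact: qlift_mor.
exists (qlift g); elim/quo_ind => x; first by rewrite (qliftE fm fX).
by rewrite (qliftE gm gY).
Qed.
End QuoIso.

(** The cut algebra is the quotient by a set of generators, while monomial
    algebras are quotients by ideals; this lemma passes from one to the
    other. *)
Lemma quo_gen_iso (k : fieldType) (A : kalgType k) (X : set A) :
  is_alg_iso (qlift (qpi (ideal_gen X)) : quo X -> quo (ideal_gen X)).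
Proof.
have GE : ideal_gen (ideal_gen X) = ideal_gen X.
  exact/ideal_genid/ideal_gen_ideal.
have fX x : X x -> qpi (ideal_gen X) x = 0.
  by move=> Xx; apply/qpi_eq0; rewrite GE; apply: sub_ideal_gen.
have gX x : ideal_gen X x -> qpi X x = 0 by move=> Xx; apply/qpi_eq0.
apply: (quo_iso (g := qpi X)) => //; try exact: qpi_mor.
  by move=> x; apply: qliftE; [exact: qpi_mor|exact: gX].
by move=> x; apply: qliftE; [exact: qpi_mor|exact: fX].
Qed.

Section TrivextMap.
Variables (k : fieldType) (A B : kalgType k) (F : A -> B) (G : B -> A).
Hypotheses (Fi : is_alg_iso F) (FK : cancel F G) (GK : cancel G F).

Lemma inv_mor : is_alg_mor G.
Proof.
have [G' [G'i FG' _]] := iso_inv Fi.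
suff -> : G = G' by exact: iso_mor.
by apply/funext => y; rewrite -[y in RHS]GK FG'.
Qed.

Lemma dual_form (f : dual A) (a : k) x y : f (algmap a * x + y) = a * f x + f y.
Proof. by have /asboolP := dualP f. Qed.

Fact dual_pull_form (f : dual A) : is_form (fun y => f (G y)).
Proof.
apply/asboolP => a x y.
by rewrite (amorD inv_mor) (amorM inv_mor) (amorZ inv_mor) dual_form.
Qed.
(** The bimodule D(A) is contravariant in A, hence the use of the inverse G
    of F on linear forms. *)
Definition dual_pull f := Dual (dual_pull_form f).
Definition trivext_map (u : trivext A) : trivext B := (F u.1, dual_pull u.2).

Lemma trivext_map_mor : is_alg_mor trivext_map.
Proof.
have Fm := iso_mor Fi; have Gm := inv_mor.
split=> [u v||a]; last 2 first.
- split=> [|u v]; congr (_, _) => /=; rewrite ?amor1 ?amorM //.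
    by apply: dual_eq => x.
  apply: dual_eq => x.
  change (v.2 (G x * u.1) + u.2 (v.1 * G x) =
          v.2 (G (x * F u.1)) + u.2 (G (F v.1 * x))).
  by rewrite !(amorM Gm) !FK.
- by congr (_, _) => /=; [rewrite amorZ|apply: dual_eq => x].
by congr (_, _) => /=; [rewrite amorB|apply: dual_eq => x].
Qed.
End TrivextMap.

Lemma trivext_map_iso (k : fieldType) (A B : kalgType k) (F : A -> B) (G : B -> A)
    (Fi : is_alg_iso F) (FK : cancel F G) (GK : cancel G F) :
  is_alg_iso (trivext_map Fi GK).
Proof.
apply: mor_iso; first exact: trivext_map_mor.
have Gi : is_alg_iso G by apply: mor_iso; [exact: (inv_mor Fi GK)|exists F].
exists (trivext_map Gi FK) => -[x f]; congr (_, _) => /=; rewrite ?FK ?GK //.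
  by apply: dual_eq => y /=; rewrite FK.
by apply: dual_eq => y /=; rewrite GK.
Qed.

(** * Path algebras and monomial ideals *)

Section PathCuts.
Variable Q : quiver.
Implicit Types (p q r : qpath Q) (v : vert Q) (s : seq (arrow Q)).

Lemma qpath_eq p q : psrc p = psrc q -> parr p = parr q -> p = q.
Proof.
by move=> e1 e2; apply: val_inj; rewrite [LHS]surjective_pairing [RHS]surjective_pairing -/(psrc p) -/(parr p) e1 e2.
Qed.
Lemma qpathP p : walk (psrc p) (parr p).
Proof. exact: pvalP. Qed.
Lemma parr_pcat p q : psrc p = ptgt q -> parr (pcat p q) = parr q ++ parr p.
Proof. by move=> e; rewrite /parr val_pcat. Qed.
Lemma psrc_head p a s : parr p = a :: s -> psrc p = src a.
Proof. by move=> e; have := qpathP p; rewrite e /= => /andP[/eqP]. Qed.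
Lemma ptgt_nil p : parr p = [::] -> ptgt p = psrc p.
Proof. by rewrite /ptgt => ->. Qed.
Lemma path_nil p : parr p = [::] -> p = vpath (psrc p).
Proof. by move=> e; apply: qpath_eq. Qed.

Lemma path_apath p a : parr p = [:: a] -> p = apath a.
Proof. by move=> e; apply: qpath_eq => //; apply: psrc_head e. Qed.

Definition ptake i p : qpath Q := insubd p (psrc p, take i (parr p)).
Definition pdrop i p : qpath Q :=
  insubd p (last (psrc p) (map (@tgt Q) (take i (parr p))), drop i (parr p)).

Lemma val_ptake i p : val (ptake i p) = (psrc p, take i (parr p)).
Proof.
rewrite val_insubd; have := qpathP p.
by rewrite -{1}(cat_take_drop i (parr p)) walk_cat /= => /andP[->].
Qed.
Lemma val_pdrop i p : val (pdrop i p) =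
  (last (psrc p) (map (@tgt Q) (take i (parr p))), drop i (parr p)).
Proof.
rewrite val_insubd; have := qpathP p.
by rewrite -{1}(cat_take_drop i (parr p)) walk_cat /= => /andP[_ ->].
Qed.
Lemma psrc_ptake i p : psrc (ptake i p) = psrc p.
Proof. by rewrite /psrc val_ptake. Qed.
Lemma parr_ptake i p : parr (ptake i p) = take i (parr p).
Proof. by rewrite /parr val_ptake. Qed.
Lemma parr_pdrop i p : parr (pdrop i p) = drop i (parr p).
Proof. by rewrite /parr val_pdrop. Qed.
Lemma psrc_pdrop i p : psrc (pdrop i p) = ptgt (ptake i p).
Proof. by rewrite /ptgt psrc_ptake parr_ptake {1}/psrc val_pdrop. Qed.
Lemma pcat_drop_take i p : pcat (pdrop i p) (ptake i p) = p.
Proof.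
by apply: qpath_eq; rewrite ?psrc_pcat ?parr_pcat ?psrc_pdrop ?psrc_ptake //
  parr_ptake parr_pdrop cat_take_drop.
Qed.
Lemma ptake_pcat p q : psrc p = ptgt q -> ptake (size (parr q)) (pcat p q) = q.
Proof.
move=> e; apply: qpath_eq; rewrite ?psrc_ptake ?psrc_pcat //.
by rewrite parr_ptake parr_pcat // take_size_cat.
Qed.
Lemma pdrop_pcat p q : psrc p = ptgt q -> pdrop (size (parr q)) (pcat p q) = p.
Proof.
move=> e; apply: qpath_eq; first by rewrite psrc_pdrop ptake_pcat.
by rewrite parr_pdrop parr_pcat // drop_size_cat.
Qed.
Lemma ptgt_pdrop i p : ptgt (pdrop i p) = ptgt p.
Proof. by rewrite -[in RHS](pcat_drop_take i p) ptgt_pcat // psrc_pdrop. Qed.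

Lemma ptake0 p : ptake 0 p = vpath (psrc p).
Proof. by apply: qpath_eq; rewrite ?psrc_ptake ?parr_ptake ?take0. Qed.
Lemma pdrop0 p : pdrop 0 p = p.
Proof.
by apply: qpath_eq; rewrite ?parr_pdrop ?drop0 // psrc_pdrop ptake0.
Qed.
Lemma ptake_size p : ptake (size (parr p)) p = p.
Proof. by apply: qpath_eq; rewrite ?psrc_ptake ?parr_ptake ?take_size. Qed.
Lemma pdrop_size p : pdrop (size (parr p)) p = vpath (ptgt p).
Proof.
by apply: qpath_eq; rewrite ?parr_pdrop ?drop_size // psrc_pdrop ptake_size.
Qed.

Definition factor_closed (N : qpath Q -> Prop) :=
  forall p i, N p -> N (ptake i p) /\ N (pdrop i p).

End PathCuts.

Section PathAlgebraTheory.
Variables (k : fieldType) (Q : quiver).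
Local Notation kQ := (path_alg k Q).
Implicit Types (x y : kQ) (p q r : qpath Q) (N : qpath Q -> Prop).

Lemma kpathcM (c d : k) p q :
  (kpathc c p : kQ) * kpathc d q = path_mul (c * d) p q.
Proof. exact: kQ_mul_kpathc. Qed.
Lemma kpathM p q : psrc p = ptgt q ->
  kpath k p * kpath k q = kpath k (pcat p q).
Proof. by move=> e; rewrite kpathcM /path_mul e eqxx mulr1. Qed.
Lemma kpathM0 p q : psrc p <> ptgt q -> kpath k p * kpath k q = 0.
Proof. by move=> e; rewrite kpathcM /path_mul (introF eqP e). Qed.
Lemma algmapM (c d : k) p : (algmap c : kQ) * kpathc d p = kpathc (c * d) p.
Proof. exact: kQ_algmap_mull. Qed.
Lemma kpathcE (c : k) p : kpathc c p = (algmap c : kQ) * kpath k p.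
Proof. by rewrite algmapM mulr1. Qed.
Lemma kpath_sum x : x = \sum_(p <- msupp x) kpathc (x@_p) p.
Proof. by rewrite [LHS]monalgE; apply: eq_bigr => p _; rewrite unlock. Qed.
Lemma one_vpath : (1 : kQ) = \sum_(v : vert Q) kpath k (vpath v).
Proof. by []. Qed.

Lemma mcoeff_algmap (c : k) x p : (algmap c * x)@_p = c * x@_p.
Proof.
elim/kQ_ind: x => [|x y IH IH'|d q]; first by rewrite mulr0 !mcoeff0 mulr0.
  by rewrite mulrDr !mcoeffD mulrDr IH IH'.
by rewrite algmapM !mcoeff_kpathc mulrnAr.
Qed.

Lemma mcoeff_sum I (r : seq I) (P : pred I) (F : I -> kQ) p :
  (\sum_(i <- r | P i) F i)@_p = \sum_(i <- r | P i) (F i)@_p.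
Proof. by apply: (big_morph (fun x : kQ => x@_p)); [exact: mcoeffD|exact: mcoeff0]. Qed.

(** A path p is a product of two paths in as many ways as there are places to
    cut it. *)
Lemma mcoeffM x y p : (x * y)@_p =
  \sum_(i < (size (parr p)).+1) x@_(pdrop i p) * y@_(ptake i p).
Proof.
elim/kQ_ind: x => [|x x' IH IH'|c q].
- by rewrite mul0r mcoeff0 big1 // => i _; rewrite mcoeff0 mul0r.
- rewrite mulrDl mcoeffD IH IH' -big_split; apply: eq_bigr => i _ /=.
  by rewrite mcoeffD mulrDl.
elim/kQ_ind: y => [|y y' IH IH'|d r].
- by rewrite mulr0 mcoeff0 big1 // => i _; rewrite mcoeff0 mulr0.
- rewrite mulrDr mcoeffD IH IH' -big_split; apply: eq_bigr => i _ /=.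
  by rewrite mcoeffD mulrDr.
have E (i : nat) : (kpathc c q : kQ)@_(pdrop i p) * (kpathc d r : kQ)@_(ptake i p) =
    (c * d) *+ ((q == pdrop i p) && (r == ptake i p)).
  by rewrite !mcoeff_kpathc mulrnAl mulrnAr -mulrnA mulnb andbC.
under eq_bigr => i _ do rewrite E.
rewrite kpathcM /path_mul; case: (psrc q =P ptgt r) => e; last first.
  rewrite mcoeff0 big1 // => i _; case: eqP => [eq1|] //=; case: eqP => [eq2|] //=.
  by case: e; rewrite eq1 eq2 psrc_pdrop.
rewrite mcoeff_kpathc; case: (pcat q r =P p) => [<-|ne]; last first.
  rewrite big1 // => i _; case: eqP => [eq1|] //=; case: eqP => [eq2|] //=.
  by case: ne; rewrite eq1 eq2 pcat_drop_take.
have lt : (size (parr r) < (size (parr (pcat q r))).+1)%N.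
  by rewrite parr_pcat // size_cat ltnS leq_addr.
rewrite (bigD1 (Ordinal lt)) //= pdrop_pcat // ptake_pcat // !eqxx /=.
rewrite big1 ?addr0 // => i /eqP ni; case: eqP => //= _; case: eqP => //= eq2.
case: ni; apply: val_inj => /=.
have -> : parr r = take i (parr (pcat q r)) by rewrite -parr_ptake -eq2.
by rewrite size_takel // -ltnS.
Qed.

(** The monomial ideals are the subspaces of this form for suitable N, the
    set of the nonzero paths of the quotient. Membership in such an ideal is
    a condition on coefficients, which is easier to use than the existence of
    an expression in terms of generators. *)
Definition vanish N : set kQ := [set x | forall p, N p -> x@_p = 0]%classic.

(** A coefficient of a product at p involves only coefficients at factors of
    p. *)
Lemma vanish_ideal N : factor_closed N -> is_ideal (vanish N).
Proof.
move=> Nf; split=> [p _|x y Kx Ky p Np|a x Kx]; first exact: mcoeff0.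
  by rewrite mcoeffD Kx ?Ky ?addr0.
split=> p Np; rewrite mcoeffM big1 // => i _; have [N1 N2] := Nf p i Np.
  by rewrite [X in _ * X]Kx ?mulr0.
by rewrite [X in X * _]Kx ?mul0r.
Qed.

Lemma vanish_path N p : vanish N (kpath k p) <-> ~ N p.
Proof.
split=> [Kp Np|nNp q Nq].
  by have /eqP := Kp p Np; rewrite mcoeff_kpathc eqxx oner_eq0.
by rewrite mcoeff_kpathc; case: eqP => // e; case: nNp; rewrite e.
Qed.

Lemma vanish_sub N (J : set kQ) : is_ideal J ->
  (forall p, ~ N p -> J (kpath k p)) -> (vanish N `<=` J)%classic.
Proof.
move=> JI NJ x Kx; rewrite [x]kpath_sum; apply: ideal_sum => // p _.
have [Np|nNp] := pselect (N p); first by rewrite (Kx p Np) kpathc0; apply: ideal0.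
by rewrite kpathcE; apply: idealMl => //; apply: NJ.
Qed.

Definition nz (J : set kQ) p : Prop := ~ J (kpath k p).

Lemma nz_vanish N : nz (vanish N) = N.
Proof.
apply/funext => p; apply/propext; rewrite /nz vanish_path.
by split=> [/contrapT //|Np]; apply.
Qed.

Lemma nz_fc (J : set kQ) : is_ideal J -> factor_closed (nz J).
Proof.
move=> JI p i nJ; split=> h; apply: nJ; rewrite -(pcat_drop_take i p) -kpathM ?psrc_pdrop //.
  exact: idealMl.
exact: idealMr.
Qed.

Lemma arrow_prod_nil : arrow_prod k (Q := Q) [::] = 1.
Proof. by rewrite /arrow_prod big_nil. Qed.
Lemma arrow_prod_cat s t :
  arrow_prod k (s ++ t : seq (arrow Q)) = arrow_prod k t * arrow_prod k s.
Proof. by rewrite /arrow_prod rev_cat big_cat. Qed.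
Lemma arrow_prod1 (a : arrow Q) : arrow_prod k [:: a] = kpath k (apath a).
Proof. by rewrite /arrow_prod /rev /= big_seq1. Qed.

Lemma kpath_arrowl p a s : parr p = rcons s a ->
  kpath k p = kpath k (apath a) * kpath k (ptake (size s) p).
Proof.
move=> e.
have e1 : parr (pdrop (size s) p) = [:: a] by rewrite parr_pdrop e -cats1 drop_size_cat.
by rewrite -(path_apath e1) kpathM ?psrc_pdrop // pcat_drop_take.
Qed.

Lemma arrow_prod_path p : parr p <> [::] -> arrow_prod k (parr p) = kpath k p.
Proof.
move e: (parr p) => s; elim/last_ind: s p e => [|s a IH] p e // _.
have e' : parr (ptake (size s) p) = s by rewrite parr_ptake e -cats1 take_size_cat.
rewrite -cats1 arrow_prod_cat arrow_prod1.
have [s0|/eqP sn] := eqVneq s [::]; last by rewrite (IH _ e' sn) (kpath_arrowl e).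
have p1 : parr p = [:: a] by rewrite e s0.
rewrite s0 arrow_prod_nil mulr1; congr (kpath k _).
by rewrite (path_apath p1).
Qed.

Definition shorter n p : Prop := (size (parr p) < n)%N.

Lemma shorter_fc n : factor_closed (shorter n).
Proof.
move=> p i pn; rewrite /shorter parr_ptake parr_pdrop size_take size_drop.
split; last exact: leq_ltn_trans (leq_subr _ _) pn.
by case: (ltnP i (size (parr p))) => // h; apply: ltn_trans h pn.
Qed.

Lemma arrow_idealE : @arrow_ideal k Q = vanish (shorter 1).
Proof.
apply/seteqP; split.
  apply: ideal_genS; first exact/vanish_ideal/shorter_fc.
  by move=> _ [a _ <-]; apply/vanish_path.
apply: vanish_sub; first exact: ideal_gen_ideal.
move=> p; rewrite /shorter ltnS leqn0 size_eq0.
case/lastP e: (parr p) => [|s a] // _; rewrite (kpath_arrowl e).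
apply: (idealMr (J := @arrow_ideal k Q)); first exact: (@ideal_gen_ideal k).
by apply: sub_ideal_gen; exists a.
Qed.

(** Splitting off the last arrow of a long path shows that the powers of the
    arrow ideal are the terms of the length filtration. *)
Lemma ideal_powE n : ideal_pow (@arrow_ideal k Q) n = vanish (shorter n).
Proof.
elim: n => [|n IH] /=; first by apply/seteqP; split=> x //= _ p.
rewrite IH; apply/seteqP; split.
  apply: ideal_genS; first exact/vanish_ideal/shorter_fc.
  move=> _ [x Jx] [y Jy <-] p pn; rewrite mcoeffM big1 // => i _.
  have ip : (i <= size (parr p))%N by rewrite -ltnS.
  have [lt|ge] := ltnP i n.
    rewrite [X in _ * X]Jy ?mulr0 // /shorter parr_ptake size_takel //.
  rewrite arrow_idealE in Jx; rewrite [X in X * _]Jx ?mul0r // /shorter parr_pdrop size_drop.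
  rewrite ltn_subLR // addn1; exact: leq_trans pn _.
apply: vanish_sub; first exact: ideal_gen_ideal.
move=> p np; have {np} : (n < size (parr p))%N by rewrite ltnNge -ltnS; apply/negP.
case/lastP e: (parr p) => [|s a] //; rewrite size_rcons ltnS (kpath_arrowl e) => ns.
apply: sub_ideal_gen; exists (kpath k (apath a)); first by apply: sub_ideal_gen; exists a.
exists (kpath k (ptake (size s) p)) => //; apply/vanish_path.
by rewrite /shorter parr_ptake e -cats1 take_size_cat // ltnNge ns.
Qed.

Lemma vanish_gen N : factor_closed N ->
  vanish N = ideal_gen (@kpath k Q @` [set p | ~ N p])%classic.
Proof.
move=> Nf; apply/seteqP; split.
  apply: vanish_sub; first exact: ideal_gen_ideal.
  by move=> p nN; apply: sub_ideal_gen; exists p.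
apply: ideal_genS; first exact: vanish_ideal.
by move=> _ [p nN <-]; apply/vanish_path.
Qed.

(** The trivial paths in N keep the ideal inside the arrow ideal, and the
    bound on lengths makes it contain a power of the arrow ideal. *)
Lemma monomial_vanish N n : factor_closed N -> (forall v, N (vpath v)) ->
  (forall p, N p -> (size (parr p) < n)%N) -> monomial_ideal (vanish N).
Proof.
move=> Nf Nv Nn; split; first by exists [set p | ~ N p]%classic; exact: vanish_gen.
  rewrite arrow_idealE => x Kx p; rewrite /shorter ltnS leqn0 size_eq0 => /eqP e.
  by apply: Kx; rewrite (path_nil e).
by exists n; rewrite ideal_powE => x Kx p Np; apply: Kx; apply: Nn.
Qed.

Section Monomial.
Variable J : set kQ.
Hypothesis hJ : monomial_ideal J.

Lemma mono_ideal : is_ideal J.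
Proof. by case: hJ => -[X ->] _ _; apply: ideal_gen_ideal. Qed.
Lemma mono_fc : factor_closed (nz J).
Proof. exact/nz_fc/mono_ideal. Qed.
Lemma mono_vanish : J = vanish (nz J).
Proof.
apply/seteqP; split; last first.
  by apply: vanish_sub => [|p /contrapT //]; exact: mono_ideal.
case: hJ => -[X JX] _ _; rewrite {1}JX; apply: ideal_genS.
  exact/vanish_ideal/mono_fc.
by move=> _ [p Xp <-]; apply/vanish_path; rewrite /nz => /(_ _); apply;
  rewrite JX; apply: sub_ideal_gen; exists p.
Qed.
Lemma mono_gen : ideal_gen J = J.
Proof. exact/ideal_genid/mono_ideal. Qed.
Lemma nz_vpath v : nz J (vpath v).
Proof.
move=> Jv; case: hJ => _ /(_ _ Jv) + _; rewrite arrow_idealE => /(_ (vpath v)).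
by rewrite mcoeff_kpathc eqxx => /(_ isT)/eqP; rewrite oner_eq0.
Qed.
Lemma nz_bounded : exists n, forall p, nz J p -> (size (parr p) < n)%N.
Proof.
case: hJ => _ _ [n Jn]; exists n => p Np; rewrite ltnNge; apply/negP => np.
apply: Np; apply: Jn; rewrite ideal_powE; apply/vanish_path.
by rewrite /shorter ltnNge np.
Qed.

Lemma qpi0 x : qpi J x = 0 <-> J x.
Proof. by rewrite qpi_eq0 mono_gen. Qed.

End Monomial.

Lemma bounded_finite n : finite_set [set p : qpath Q | (size (parr p) < n)%N].
Proof.
pose B := [set: vert Q * {i : 'I_n & i.-tuple (arrow Q)}]%classic.
pose h (b : vert Q * {i : 'I_n & i.-tuple (arrow Q)}) : qpath Q :=
  insubd (vpath b.1) (b.1, tval (tagged b.2)).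
apply: (@sub_finite_set _ _ (h @` B)%classic); last exact/finite_image/finite_finset.
move=> p /= pn; exists (psrc p, existT (fun i : 'I_n => i.-tuple (arrow Q)) (Ordinal pn) (in_tuple (parr p))) => //.
apply: val_inj; rewrite val_insubd /= qpathP.
by rewrite /psrc /parr -surjective_pairing.
Qed.

Lemma nz_finite (J : set kQ) : monomial_ideal J -> finite_set (nz J).
Proof.
move=> hJ; have [n Jn] := nz_bounded hJ; apply: sub_finite_set (bounded_finite n).
exact: Jn.
Qed.

End PathAlgebraTheory.

(** * Coefficients in a monomial algebra *)

Section Coefficients.
Variables (k : fieldType) (Q : quiver) (J : set (path_alg k Q)).
Hypothesis hJ : monomial_ideal J.
Local Notation kQ := (path_alg k Q).
Local Notation A := (quo J).
Implicit Types (x y : A) (p q : qpath Q).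

Definition nzset : {fset qpath Q} := fset_set (nz J).
Lemma in_nzset p : (p \in nzset) = `[< nz J p >].
Proof. by rewrite in_fset_set ?inE //; exact: nz_finite. Qed.
Lemma nzsetP p : reflect (nz J p) (p \in nzset).
Proof. by rewrite in_nzset; apply: asboolP. Qed.

Definition cf p x : k := (repr x : kQ)@_p.

Lemma cf_qpi p (z : kQ) : nz J p -> cf p (qpi J z) = z@_p.
Proof.
move=> Np; apply/eqP; rewrite -subr_eq0 /cf -mcoeffB; apply/eqP.
have := @qrepr k _ J z; rewrite mono_gen // {1}(mono_vanish hJ); exact.
Qed.
Lemma cfD p x y : nz J p -> cf p (x + y) = cf p x + cf p y.
Proof.
move=> Np; elim/quo_ind: x => x; elim/quo_ind: y => y.
by rewrite -(amorD (qpi_mor J)) !cf_qpi // mcoeffD.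
Qed.
Lemma cfB p x y : nz J p -> cf p (x - y) = cf p x - cf p y.
Proof.
move=> Np; elim/quo_ind: x => x; elim/quo_ind: y => y.
by rewrite -(amorB (qpi_mor J)) !cf_qpi // mcoeffB.
Qed.
Lemma cfZ p (a : k) x : nz J p -> cf p (algmap a * x) = a * cf p x.
Proof.
move=> Np; elim/quo_ind: x => x.
rewrite -(amorZ (qpi_mor J)) -qpi_mul !cf_qpi //; exact: mcoeff_algmap.
Qed.
Lemma cf0 p : nz J p -> cf p 0 = 0.
Proof. by move=> Np; rewrite -(amor0 (qpi_mor J)) cf_qpi // mcoeff0. Qed.
Lemma cf_sum p I (r : seq I) (P : pred I) (F : I -> A) : nz J p ->
  cf p (\sum_(i <- r | P i) F i) = \sum_(i <- r | P i) cf p (F i).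
Proof.
by move=> Np; apply: (big_morph (cf p)); [move=> x y; exact: cfD|exact: cf0].
Qed.
Lemma cfM p x y : nz J p ->
  cf p (x * y) = \sum_(i < (size (parr p)).+1) cf (pdrop i p) x * cf (ptake i p) y.
Proof.
move=> Np; elim/quo_ind: x => x; elim/quo_ind: y => y; rewrite -qpi_mul cf_qpi // mcoeffM.
apply: eq_bigr => i _; have [N1 N2] := mono_fc hJ i Np.
by rewrite !cf_qpi.
Qed.
Lemma cf_kpath p q : nz J p -> cf p (qpi J (kpath k q)) = (q == p)%:R.
Proof. by move=> Np; rewrite cf_qpi // mcoeff_kpathc. Qed.
Lemma quo_ext x y : (forall p, nz J p -> cf p x = cf p y) -> x = y.
Proof.
elim/quo_ind: x => x; elim/quo_ind: y => y e; apply/qpi_eq.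
rewrite mono_gen // (mono_vanish hJ) => p Np.
by rewrite mcoeffB -!cf_qpi // e // subrr.
Qed.

(** The normal form of x, its only representative supported on nonzero paths. *)
Definition nform x : kQ := \sum_(p <- nzset) kpathc (cf p x) p.

Lemma mcoeff_nform p x : (nform x)@_p = if p \in nzset then cf p x else 0.
Proof.
rewrite mcoeff_sum; case: ifP => [pN|/negP pN].
  rewrite (big_fsetD1 p) //= mcoeff_kpathc eqxx big1_seq ?addr0 // => q.
  by rewrite !inE mcoeff_kpathc => /andP[_ /andP[/negPf->]].
rewrite big1_seq // => q /andP[_ qN]; rewrite mcoeff_kpathc.
by case: eqP => // e; case: pN; rewrite -e.
Qed.
Lemma nformK x : qpi J (nform x) = x.
Proof.
by apply: quo_ext => p Np; rewrite cf_qpi // mcoeff_nform (introT (nzsetP p) Np).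
Qed.
Lemma nformD x y : nform (x + y) = nform x + nform y.
Proof.
apply/malgP => p; rewrite mcoeffD !mcoeff_nform.
by case: nzsetP => [Np|]; rewrite ?cfD ?addr0.
Qed.
Lemma nform0 : nform 0 = 0.
Proof. by apply: (addrI (nform 0)); rewrite -nformD !addr0. Qed.
Lemma nformZ a x : nform (algmap a * x) = algmap a * nform x.
Proof.
apply/malgP => p; rewrite mcoeff_algmap !mcoeff_nform.
by case: nzsetP => [Np|]; rewrite ?cfZ ?mulr0.
Qed.
Lemma nform_path c p : nz J p -> nform (qpi J (kpathc c p)) = kpathc c p.
Proof.
move=> Np; apply/malgP => q; rewrite mcoeff_nform.
case: nzsetP => [Nq|Nq]; first by rewrite cf_qpi.
by rewrite mcoeff_kpathc; case: eqP => // e; case: Nq; rewrite -e.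
Qed.
Lemma qpi_zero_path c p : ~ nz J p -> qpi J (kpathc c p) = 0.
Proof.
move=> /contrapT Jp; apply/qpi0 => //; rewrite kpathcE.
exact: (idealMl (mono_ideal hJ)).
Qed.
Lemma quo_kpath_ind (P : A -> Prop) : P 0 -> (forall x y, P x -> P y -> P (x + y)) ->
  (forall c p, nz J p -> P (qpi J (kpathc c p))) -> forall x, P x.
Proof.
move=> P0 PD PU x; rewrite -[x]nformK /nform (amor_sum (qpi_mor J)).
rewrite big_seq_cond; apply: big_ind => // p; rewrite andbT => /nzsetP Np.
exact: PU.
Qed.
End Coefficients.

Section PathIso.
Variables (k : fieldType).

(** Total functions on paths, of which only the values on the nonzero paths
    carry meaning; this spares a type of nonzero paths. Compositions that are
    zero in the source are not constrained here: they are handled by asking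
    that the inverse satisfies the same conditions. *)
Record pmor (Q Q' : quiver) (J : set (path_alg k Q)) (J' : set (path_alg k Q'))
    (b : qpath Q -> qpath Q') : Prop := {
  pm_nz : forall p, nz J p -> nz J' (b p);
  pm_comp : forall p q, nz J p -> nz J q -> psrc p = ptgt q ->
    psrc (b p) = ptgt (b q);
  pm_cat : forall p q, psrc p = ptgt q -> nz J (pcat p q) ->
    b (pcat p q) = pcat (b p) (b q);
  pm_size : forall p, nz J p -> size (parr (b p)) = size (parr p) }.

Record path_iso (Q Q' : quiver) (J : set (path_alg k Q)) (J' : set (path_alg k Q'))
    (b : qpath Q -> qpath Q') (b' : qpath Q' -> qpath Q) : Prop := {
  pi_mor : pmor J J' b;
  pi_mor' : pmor J' J b';
  pi_K : forall p, nz J p -> b' (b p) = p;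
  pi_K' : forall p, nz J' p -> b (b' p) = p }.

Lemma path_iso_sym (Q Q' : quiver) (J : set (path_alg k Q)) (J' : set (path_alg k Q'))
    b b' : path_iso J J' b b' -> path_iso J' J b' b.
Proof. by case. Qed.

Section Map.
Variables (Q Q' : quiver) (J : set (path_alg k Q)) (J' : set (path_alg k Q')).
Hypotheses (hJ : monomial_ideal J) (hJ' : monomial_ideal J').

Definition path_map (b : qpath Q -> qpath Q') (x : quo J) : quo J' :=
  \sum_(p <- nzset J) qpi J' (kpathc (cf p x) (b p)).

Lemma path_mapD b : {morph path_map b : x y / x + y}.
Proof.
move=> x y; rewrite /path_map -big_split big_seq [RHS]big_seq.
apply: eq_bigr => p /nzsetP Np /=.
by rewrite cfD ?kpathcD ?(amorD (qpi_mor J')) //; exact: Np.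
Qed.
Lemma path_map_kpath b c p : nz J p ->
  path_map b (qpi J (kpathc c p)) = qpi J' (kpathc c (b p)).
Proof.
move=> Np; have pN := introT (nzsetP hJ p) Np.
rewrite /path_map (big_fsetD1 p) //= cf_qpi // mcoeff_kpathc eqxx.
rewrite big1_seq ?addr0 // => q; rewrite !inE => /andP[_ /andP[/negPf qp /nzsetP Nq]].
rewrite cf_qpi // ?mcoeff_kpathc 1?eq_sym ?qp ?kpathc0 ?(amor0 (qpi_mor J')) //.
exact: Nq.
Qed.
Lemma path_map0 b : path_map b 0 = 0.
Proof. by apply: (addrI (path_map b 0)); rewrite -path_mapD !addr0. Qed.
End Map.

Variables (Q Q' : quiver) (J : set (path_alg k Q)) (J' : set (path_alg k Q')).
Hypotheses (hJ : monomial_ideal J) (hJ' : monomial_ideal J').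
Variables (b : qpath Q -> qpath Q') (b' : qpath Q' -> qpath Q).
Hypothesis bi : path_iso J J' b b'.
Local Notation F := (@path_map Q Q' J J' b).
Local Notation G := (@path_map Q' Q J' J b').

Lemma path_mapK : cancel F G.
Proof.
elim/(quo_kpath_ind hJ) => [|x y IH IH'|c p Np]; first by rewrite !path_map0.
  by rewrite !path_mapD // IH IH'.
rewrite !path_map_kpath //; first by rewrite (pi_K bi).
exact: (pm_nz (pi_mor bi)).
Qed.
End PathIso.

Section PathIsoMor.
Variables (k : fieldType) (Q Q' : quiver).
Variables (J : set (path_alg k Q)) (J' : set (path_alg k Q')).
Hypotheses (hJ : monomial_ideal J) (hJ' : monomial_ideal J').
Variables (b : qpath Q -> qpath Q') (b' : qpath Q' -> qpath Q).
Hypothesis bi : path_iso J J' b b'.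
Local Notation F := (@path_map k Q Q' J J' b).
Local Notation G := (@path_map k Q' Q J' J b').

(** If b p and b q had a nonzero product although p and q do not, the inverse
    map would send this product to a nonzero path that is the product of p
    and q. *)
Lemma path_mapM : {morph F : x y / x * y}.
Proof.
have bm := pi_mor bi; have bm' := pi_mor' bi.
move=> x y; elim/(quo_kpath_ind hJ): x => [|x x' IH IH'|c p Np].
- by rewrite mul0r path_map0 // mul0r.
- by rewrite mulrDl !path_mapD // IH IH' mulrDl.
elim/(quo_kpath_ind hJ): y => [|y y' IH IH'|d q Nq].
- by rewrite mulr0 path_map0 // mulr0.
- by rewrite mulrDr !path_mapD // IH IH' mulrDr.
rewrite !path_map_kpath // -!qpi_mul !kpathcM /path_mul.
have [e|ne] := eqVneq (psrc p) (ptgt q); last first.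
  rewrite ifN ?(amor0 (qpi_mor _)) ?path_map0 //; apply: contra_neq ne => e.
  rewrite -(pi_K bi Np) -(pi_K bi Nq).
  by apply: (pm_comp bm') e; exact: (pm_nz bm).
have e' := pm_comp bm Np Nq e; rewrite e' eqxx.
have [Npq|nN] := pselect (nz J (pcat p q)).
  by rewrite path_map_kpath // (pm_cat bm).
rewrite (qpi_zero_path hJ) // path_map0 // (qpi_zero_path hJ') // => N'.
apply: nN; have := pm_nz bm' N'.
by rewrite (pm_cat bm') // !(pi_K bi).
Qed.

Lemma path_map_iso : is_alg_iso F.
Proof.
have FK := path_mapK hJ hJ' bi; have GK := path_mapK hJ' hJ (path_iso_sym bi).
have F1 : F 1 = 1 by rewrite -[LHS]mulr1 -[X in _ * X](GK 1) -path_mapM mul1r GK.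
have FZ a : F (algmap a) = algmap a.
  rewrite -[RHS]mulr1 -F1 -[algmap a in LHS]mulr1.
  elim/(quo_kpath_ind hJ): (1 : quo J) => [|x y IH IH'|c p Np].
  - by rewrite mulr0 path_map0 // mulr0.
  - by rewrite mulrDr !path_mapD // IH IH' mulrDr.
  rewrite -(amorZ (qpi_mor J)) -qpi_mul algmapM !path_map_kpath //.
  by rewrite -(amorZ (qpi_mor J')) -qpi_mul algmapM.
split=> //; last by exists G.
- move=> x y; apply: (addIr (F y)); rewrite -path_mapD // subrK.
  by rewrite subrK.
- by split=> //; exact: path_mapM.
Qed.
End PathIsoMor.

(** * Maximal paths and the trivial extension *)

Section MaximalPaths.
Variables (k : fieldType) (Q : quiver) (J : set (path_alg k Q)).
Hypothesis hJ : monomial_ideal J.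
Implicit Types (p q m : qpath Q).

Lemma size1_apath p : size (parr p) = 1%N -> exists a, p = apath a.
Proof.
by case e : (parr p) => [|a [|]] // _; exists a; exact: path_apath.
Qed.

Lemma maximal_pathP p : maximal_path J p <->
  [/\ nz J p, forall a, src a = ptgt p -> ~ nz J (pcat (apath a) p)
    & forall a, psrc p = tgt a -> ~ nz J (pcat p (apath a))].
Proof.
have E x : J x <-> qpi J x = 0 by apply: iff_sym; exact: qpi0.
split=> [[Np pm]|[Np p1 p2]]; split=> // a.
- move=> e Na; have [h _] := pm a; apply: Na.
  by rewrite -kpathM //; apply/E; rewrite qpi_mul in h *.
- move=> e Na; have [_ h] := pm a; apply: Na.
  by rewrite -kpathM //; apply/E; rewrite qpi_mul in h *.
split; rewrite ?qpi_mul -?qpi_mul; apply/qpi0 => //.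
  have [e|e] := pselect (psrc (apath a) = ptgt p); last first.
    by rewrite kpathM0 //; exact: (ideal0 (mono_ideal hJ)).
  by rewrite kpathM //; exact: contrapT (p1 a e).
have [e|e] := pselect (psrc p = ptgt (apath a)); last first.
  by rewrite kpathM0 //; exact: (ideal0 (mono_ideal hJ)).
by rewrite kpathM //; exact: contrapT (p2 a e).
Qed.

Lemma in_maximal_paths m : (m \in maximal_paths J) = `[< maximal_path J m >].
Proof.
rewrite in_fset_set ?inE //; apply: sub_finite_set (nz_finite hJ).
by move=> p /maximal_pathP[].
Qed.

(** Extend p by arrows at both ends as long as the result is nonzero; this
    stops because lengths are bounded. The position i and the length n of p
    in m are recorded, since the angles of the configuration are positions in
    maximal paths. *)
Lemma maximal_ext p : nz J p -> exists m, [/\ maximal_path J m &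
  exists i n, [/\ (i + n <= size (parr m))%N, p = ptake n (pdrop i m)
     & n = size (parr p)]].
Proof.
have [B JB] := nz_bounded hJ.
suff H d m : (B - size (parr m) <= d)%N -> nz J m ->
    (exists i n, [/\ (i + n <= size (parr m))%N, p = ptake n (pdrop i m)
     & n = size (parr p)]) -> exists m', [/\ maximal_path J m' &
  exists i n, [/\ (i + n <= size (parr m'))%N, p = ptake n (pdrop i m')
     & n = size (parr p)]].
  move=> Np; apply: (H _ p (leqnn _) Np); exists 0%N, (size (parr p)); split=> //.
  apply: qpath_eq; rewrite ?psrc_ptake ?psrc_pdrop ?ptgt_nil ?psrc_ptake ?parr_ptake ?take0 //.
  by rewrite parr_pdrop drop0 take_size.
elim: d m => [|d IH] m; first by rewrite leqn0 subn_eq0 leqNgt => /negP h /JB.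
move=> md Nm [i [n [le ep en]]].
have step m' : nz J m' -> size (parr m') = (size (parr m)).+1 ->
    (B - size (parr m') <= d)%N.
  by move=> Nm' ->; rewrite subnS; case: (B - _)%N md.
have [mm|nm] := pselect (maximal_path J m); first by exists m; split=> //; exists i, n.
have [[a e Na]|h1] := pselect (exists2 a, src a = ptgt m & nz J (pcat (apath a) m)).
  have sz : parr (pcat (apath a) m) = rcons (parr m) a by rewrite parr_pcat // cats1.
  apply: (IH _ _ Na); first by apply: step => //; rewrite sz size_rcons.
  exists i, n; rewrite sz size_rcons; split=> //; first exact: leqW.
  have lei : (i <= size (parr m))%N by apply: leq_trans le; apply: leq_addr.
  rewrite ep; apply: qpath_eq.
    rewrite !psrc_ptake !psrc_pdrop /ptgt !psrc_ptake !parr_ptake psrc_pcat // sz.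
    by rewrite -cats1 takel_cat.
  rewrite !parr_ptake !parr_pdrop sz drop_rcons // -cats1 takel_cat //.
  by rewrite size_drop leq_subRL.
have [[a e Na]|h2] := pselect (exists2 a, psrc m = tgt a & nz J (pcat m (apath a))).
  have sz : parr (pcat m (apath a)) = a :: parr m by rewrite parr_pcat.
  apply: (IH _ _ Na); first by apply: step => //; rewrite sz.
  exists i.+1, n; rewrite sz; split=> //.
  rewrite ep; apply: qpath_eq; last by rewrite !parr_ptake !parr_pdrop sz.
  by rewrite !psrc_ptake !psrc_pdrop /ptgt !psrc_ptake !parr_ptake psrc_pcat // sz /= e.
case: nm; apply/maximal_pathP; split=> // a e Na; first by apply: h1; exists a.
by apply: h2; exists a.
Qed.
End MaximalPaths.

Section PathIsoTrivext.
Variables (k : fieldType) (Q Q' : quiver).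
Variables (J : set (path_alg k Q)) (J' : set (path_alg k Q')).
Hypotheses (hJ : monomial_ideal J) (hJ' : monomial_ideal J').
Variables (b : qpath Q -> qpath Q') (b' : qpath Q' -> qpath Q).
Hypothesis bi : path_iso J J' b b'.
Local Notation F := (@path_map k Q Q' J J' b).
Local Notation G := (@path_map k Q' Q J' J b').

Definition path_trivext : trivext (quo J) -> trivext (quo J') :=
  trivext_map (path_map_iso hJ hJ' bi) (path_mapK hJ' hJ (path_iso_sym bi)).

Lemma path_trivext_iso : is_alg_iso path_trivext.
Proof. by apply: trivext_map_iso; exact: path_mapK. Qed.

(** An extension of b m by an arrow pulls back to an extension of m by a path
    of the same length 1. *)
Lemma path_iso_maximal m : maximal_path J m -> maximal_path J' (b m).
Proof.
have bm := pi_mor bi; have bm' := pi_mor' bi.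
move=> /(maximal_pathP hJ) [Nm m1 m2]; have Nbm := pm_nz bm Nm.
apply/(maximal_pathP hJ'); split=> // a e Na.
  have Naa : nz J' (apath a).
    by have [_] := mono_fc hJ' (size (parr (b m))) Na; rewrite pdrop_pcat.
  have [c ec] := size1_apath (pm_size bm' Naa).
  have e' : psrc (b' (apath a)) = ptgt (b' (b m)) by apply: (pm_comp bm').
  apply: (m1 c); first by rewrite -(pi_K bi Nm) -e' ec.
  by have := pm_nz bm' Na; rewrite (pm_cat bm') // (pi_K bi Nm) ec.
have Naa : nz J' (apath a).
  by have [+ _] := mono_fc hJ' 1 Na; rewrite (ptake_pcat (q := apath a)).
have [c ec] := size1_apath (pm_size bm' Naa).
have e' : psrc (b' (b m)) = ptgt (b' (apath a)) by apply: (pm_comp bm').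
apply: (m2 c); first by rewrite -(pi_K bi Nm) e' ec.
by have := pm_nz bm' Na; rewrite (pm_cat bm') // (pi_K bi Nm) ec.
Qed.

Lemma path_trivext_dual m x : nz J m -> x.1 = 0 -> is_dual_basis_elt m x.2 ->
  (path_trivext x).1 = 0 /\ is_dual_basis_elt (b m) (path_trivext x).2.
Proof.
move=> Nm x0 xm; split=> [|p Np] /=; first by rewrite x0 path_map0.
rewrite path_map_kpath // xm; last exact: (pm_nz (pi_mor' bi)).
congr (_%:R); congr nat_of_bool; apply/eqP/eqP => [<-|->]; last by rewrite (pi_K bi).
by rewrite (pi_K' bi).
Qed.

Lemma path_trivext_sub :
  (path_trivext @` dual_maximal J `<=` dual_maximal J')%classic.
Proof.
move=> _ [x [x0 [m mm xm]] <-].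
have Nm : nz J m by case/(maximal_pathP hJ): (mm).
have [h1 h2] := path_trivext_dual Nm x0 xm.
by split=> //; exists (b m) => //; exact: path_iso_maximal.
Qed.
End PathIsoTrivext.

Lemma path_trivext_maximal (k : fieldType) (Q Q' : quiver)
    (J : set (path_alg k Q)) (J' : set (path_alg k Q'))
    (hJ : monomial_ideal J) (hJ' : monomial_ideal J') b b'
    (bi : path_iso J J' b b') :
  (path_trivext hJ hJ' bi @` dual_maximal J = dual_maximal J')%classic.
Proof.
apply/seteqP; split; first exact: path_trivext_sub.
move=> y Dy; exists (path_trivext hJ' hJ (path_iso_sym bi) y).
  by apply: (path_trivext_sub (bi := path_iso_sym bi)); exists y.
case: y {Dy} => x f; congr (_, _) => /=; first by rewrite path_mapK //; exact: path_iso_sym.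
by apply: dual_eq => z /=; rewrite path_mapK //; exact: path_iso_sym.
Qed.

(** A bijection of nonzero paths carries the dual basis to the dual basis and
    maximal paths to maximal paths, so it extends to the trivial extensions
    together with their distinguished elements. *)
Lemma path_iso_pair_class (k : fieldType) (Q Q' : quiver)
    (J : set (path_alg k Q)) (J' : set (path_alg k Q'))
    (hJ : monomial_ideal J) (hJ' : monomial_ideal J') b b'
    (bi : path_iso J J' b b') :
  pair_class (@AlgPair k (trivext (quo J)) (dual_maximal J)) =
  pair_class (@AlgPair k (trivext (quo J')) (dual_maximal J')).
Proof.
apply: (@pair_classE _ (AlgPair _) (AlgPair _) (path_trivext hJ hJ' bi)).
  exact: path_trivext_iso.
exact: path_trivext_maximal.
Qed.

(** * Maps of paths induced by maps of arrows *)

(** The map si is partial because the zero arrows of a monomial algebra have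
    no image; a trivial path is used as default value. *)
Definition arrow_map (Q Q' : quiver) (pi : vert Q -> vert Q') 
    (si : arrow Q -> option (arrow Q'))
    (p : qpath Q) : qpath Q' :=
  insubd (vpath (pi (psrc p))) (pi (psrc p), pmap si (parr p)).

Section ArrowCorrespondence.
Variables (k : fieldType) (Q Q' : quiver).

Variables (pi : vert Q -> vert Q') (si : arrow Q -> option (arrow Q')).
Hypothesis ends : forall a c, si a = Some c -> src c = pi (src a) /\ tgt c = pi (tgt a).
Implicit Types p q : qpath Q.

Lemma arrow_map_walk v s : all (fun a => isSome (si a)) s -> walk v s ->
  walk (pi v) (pmap si s) /\
  last (pi v) (map (@tgt Q') (pmap si s)) = pi (last v (map (@tgt Q) s)).
Proof.
elim: s v => //= a s IH v /andP[]; case e: (si a) => [c|] //= _ h /andP[/eqP <- w].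
by have [-> ->] := ends e; rewrite eqxx /=; exact: IH.
Qed.

Lemma val_arrow_map p : all (fun a => isSome (si a)) (parr p) ->
  val (arrow_map pi si p) = (pi (psrc p), pmap si (parr p)).
Proof.
by move=> h; rewrite val_insubd /= (arrow_map_walk h (qpathP p)).1.
Qed.
Lemma psrc_arrow_map p : psrc (arrow_map pi si p) = pi (psrc p).
Proof. by rewrite /psrc val_insubd; case: ifP. Qed.
Lemma parr_arrow_map p : all (fun a => isSome (si a)) (parr p) ->
  parr (arrow_map pi si p) = pmap si (parr p).
Proof. by move=> h; rewrite /parr val_arrow_map. Qed.
Lemma ptgt_arrow_map p : all (fun a => isSome (si a)) (parr p) ->
  ptgt (arrow_map pi si p) = pi (ptgt p).
Proof.
move=> h; rewrite /ptgt psrc_arrow_map parr_arrow_map //.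
by have [] := arrow_map_walk h (qpathP p).
Qed.
Lemma size_arrow_map p : all (fun a => isSome (si a)) (parr p) ->
  size (parr (arrow_map pi si p)) = size (parr p).
Proof. by move=> h; rewrite parr_arrow_map // size_pmap; apply/eqP; rewrite -all_count. Qed.
Lemma arrow_map_cat p q : psrc p = ptgt q ->
  all (fun a => isSome (si a)) (parr p) -> all (fun a => isSome (si a)) (parr q) ->
  arrow_map pi si (pcat p q) = pcat (arrow_map pi si p) (arrow_map pi si q).
Proof.
move=> e hp hq; have h : all (fun a => isSome (si a)) (parr (pcat p q)).
  by rewrite parr_pcat // all_cat hp hq.
have e' : psrc (arrow_map pi si p) = ptgt (arrow_map pi si q).
  by rewrite psrc_arrow_map ptgt_arrow_map // e.
apply: qpath_eq; first by rewrite psrc_pcat // !psrc_arrow_map psrc_pcat.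
by rewrite parr_pcat // !parr_arrow_map // parr_pcat // pmap_cat.
Qed.

Variables (J : set (path_alg k Q)) (J' : set (path_alg k Q')).
Hypothesis hJ : monomial_ideal J.
Hypothesis def : forall p, nz J p -> all (fun a => isSome (si a)) (parr p).
Hypothesis map_nz : forall p, nz J p -> nz J' (arrow_map pi si p).

Lemma arrow_map_pmor : pmor J J' (arrow_map pi si).
Proof.
split=> // [p q Np Nq e|p q e Npq|p Np]; last exact: size_arrow_map (def Np).
  by rewrite psrc_arrow_map ptgt_arrow_map ?e //; exact: def.
have [Nq _] := mono_fc hJ (size (parr q)) Npq; rewrite ptake_pcat // in Nq.
have [_ Np] := mono_fc hJ (size (parr q)) Npq; rewrite pdrop_pcat // in Np.
by apply: arrow_map_cat => //; exact: def.
Qed.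

Variables (pi' : vert Q' -> vert Q) (si' : arrow Q' -> option (arrow Q)).
Hypothesis piK : cancel pi pi'.
Hypothesis siK : forall a c, si a = Some c -> si' c = Some a.

Lemma arrow_mapK p : all (fun a => isSome (si a)) (parr p) ->
  arrow_map pi' si' (arrow_map pi si p) = p.
Proof.
move=> h; have E : pmap si' (pmap si (parr p)) = parr p.
  elim: (parr p) h => //= a s IH /andP[]; case e: (si a) => [c|] //= _ /IH ->.
  by rewrite (siK e).
apply: val_inj; rewrite val_insubd /= psrc_arrow_map parr_arrow_map // E piK.
by rewrite qpathP /psrc /parr -surjective_pairing.
Qed.
End ArrowCorrespondence.

(** * Isomorphic monomial algebras are combinatorially isomorphic *)

(** One of the terms of the Leibniz expansion of a nonzero determinant is not
    zero. *)
Lemma invertible_transversal (k : fieldType) m n (C : 'M[k]_(m, n)) (D : 'M[k]_(n, m)) :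
  C *m D = 1%:M -> D *m C = 1%:M ->
  exists2 s : 'I_m -> 'I_n, bijective s & forall i, C i (s i) != 0.
Proof.
move=> CD DC; have mn : m = n.
  by apply/eqP; rewrite eqn_leq (mulmx1_min CD) (mulmx1_min DC).
subst n; have [Cu _] := mulmx1_unit CD.
have : \det C != 0 by move: Cu; rewrite unitmxE unitfE.
have [/existsP[s /forallP sP]|] := boolP [exists s : 'S_m, [forall i, C i (s i) != 0]].
  by exists s => //; exists (s^-1)%g; [exact: permK|exact: permKV].
rewrite negb_exists => /forallP h /eqP[]; apply: big1 => s _.
have := h s; rewrite negb_forall => /existsP[i /negPn/eqP Ci].
by rewrite (bigD1 i) //= Ci mul0r mulr0.
Qed.

Lemma invertible_pairing (k : fieldType) (T T' : finType) (P : pred T) (P' : pred T')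
    (c : T -> T' -> k) (d : T' -> T -> k) :
  (forall a a', P a -> P a' -> \sum_(x in P') c a x * d x a' = (a == a')%:R) ->
  (forall x x', P' x -> P' x' -> \sum_(a in P) d x a * c a x' = (x == x')%:R) ->
  exists (s : T -> option T') (s' : T' -> option T),
  [/\ forall a x, s a = Some x <-> s' x = Some a,
      forall a, P a -> s a, forall x, P' x -> s' x
    & forall a x, s a = Some x -> [/\ P a, P' x & c a x != 0]].
Proof.
move=> cd dc.
pose C := \matrix_(i < #|P|, j < #|P'|) c (enum_val i) (enum_val j).
pose D := \matrix_(j < #|P'|, i < #|P|) d (enum_val j) (enum_val i).
have CD : C *m D = 1%:M.
  apply/matrixP => i j; rewrite !mxE -(inj_eq enum_val_inj) -cd; try exact: enum_valP.
  by rewrite [RHS]big_enum_val; apply: eq_bigr => l _; rewrite !mxE.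
have DC : D *m C = 1%:M.
  apply/matrixP => i j; rewrite !mxE -(inj_eq enum_val_inj) -dc; try exact: enum_valP.
  by rewrite [RHS]big_enum_val; apply: eq_bigr => l _; rewrite !mxE.
have [f [g fK gK] Cf] := invertible_transversal CD DC.
pose s a := omap (fun i : 'I_#|P| => enum_val (f i)) [pick i | enum_val i == a].
pose s' x := omap (fun j : 'I_#|P'| => enum_val (g j)) [pick j | enum_val j == x].
have sE i : s (enum_val i) = Some (enum_val (f i)).
  by rewrite /s; case: pickP => [j /eqP/enum_val_inj ->|/(_ i)] //=; rewrite eqxx.
have s'E j : s' (enum_val j) = Some (enum_val (g j)).
  by rewrite /s'; case: pickP => [i /eqP/enum_val_inj ->|/(_ j)] //=; rewrite eqxx.
have sP a x : s a = Some x -> exists2 i, a = enum_val i & x = enum_val (f i).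
  by rewrite /s; case: pickP => //= i /eqP <- [<-]; exists i.
have s'P a x : s' x = Some a -> exists2 j, x = enum_val j & a = enum_val (g j).
  by rewrite /s'; case: pickP => //= i /eqP <- [<-]; exists i.
exists s, s'; split=> [a x|a Pa|x Px|a x /sP[i -> ->]].
- by split=> [/sP[i -> ->]|/s'P[j -> ->]]; rewrite ?s'E ?sE ?fK ?gK.
- by rewrite -(enum_rankK_in Pa Pa) sE.
- by rewrite -(enum_rankK_in Px Px) s'E.
by have := Cf i; rewrite mxE; split=> //; exact: enum_valP.
Qed.

Section Filtration.
Variables (k : fieldType) (Q : quiver) (J : set (path_alg k Q)).
Hypothesis hJ : monomial_ideal J.
Local Notation A := (quo J).
Implicit Types (x y : A) (p q : qpath Q) (v : vert Q) (a : arrow Q).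

(** The n-th power of the radical of the monomial algebra. *)
Definition fil n x := forall p, nz J p -> (size (parr p) < n)%N -> cf p x = 0.
(** The character of the algebra attached to the vertex v. *)
Definition chi v x := cf (vpath v) x.

Lemma fil_le m n x : (m <= n)%N -> fil n x -> fil m x.
Proof. by move=> mn xn p Np pm; apply: xn => //; apply: leq_trans mn. Qed.
Lemma filM m n x y : fil m x -> fil n y -> fil (m + n) (x * y).
Proof.
move=> xm yn p Np pmn; rewrite cfM // big1 // => i _.
have [N1 N2] := mono_fc hJ i Np; have ip : (i <= size (parr p))%N by rewrite -ltnS.
have [lt|ge] := ltnP i n; first by rewrite yn ?mulr0 // parr_ptake size_takel.
by rewrite xm ?mul0r // parr_pdrop size_drop ltn_subLR //; apply: leq_trans pmn _;
  rewrite addnC leq_add2r.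
Qed.
Lemma filX n x : fil 1 x -> fil n (x ^+ n).
Proof. by move=> x1; elim: n => // n IH; rewrite exprS -add1n; apply: filM. Qed.
Lemma fil0 n : fil n 0. Proof. by move=> p Np _; apply: cf0. Qed.
Lemma filD n x y : fil n x -> fil n y -> fil n (x + y).
Proof. by move=> xn yn p Np pn; rewrite cfD // xn // yn // addr0. Qed.
Lemma fil_kpath p : fil (size (parr p)) (qpi J (kpath k p)).
Proof. by move=> q Nq qp; rewrite cf_kpath //; case: eqP => // e; rewrite e ltnn in qp. Qed.
Lemma fil1P x : fil 1 x <-> forall v, chi v x = 0.
Proof.
split=> [x1 v|xv p Np]; first by apply: x1 => //; exact: nz_vpath.
by rewrite ltnS leqn0 size_eq0 => /eqP/path_nil ->; apply: xv.
Qed.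
Lemma fil_nilp : exists n, forall x, fil n x -> x = 0.
Proof.
have [n Jn] := nz_bounded hJ; exists n => x xn; apply: (quo_ext hJ) => p Np.
by rewrite xn ?cf0 //; apply: Jn.
Qed.

Lemma chiM v x y : chi v (x * y) = chi v x * chi v y.
Proof.
rewrite /chi cfM //; last exact: nz_vpath.
by rewrite big_ord1 pdrop0 ptake0.
Qed.
Lemma chiX v x n : chi v (x ^+ n.+1) = chi v x ^+ n.+1.
Proof. by elim: n => // n IH; rewrite exprS chiM IH -exprS. Qed.
Lemma chi_vpath v w : chi v (qpi J (kpath k (vpath w))) = (v == w)%:R.
Proof.
rewrite /chi cf_kpath //; last exact: nz_vpath.
congr (nat_of_bool _)%:R; apply/eqP/eqP => [|-> //].
by move/(congr1 (@psrc Q)).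
Qed.
Lemma vpathM v w : qpi J (kpath k (vpath v)) * qpi J (kpath k (vpath w)) =
  if v == w then qpi J (kpath k (vpath v)) else 0.
Proof.
rewrite -qpi_mul; case: eqP => [->|e]; first by rewrite kpathM // pcat_vl.
by rewrite kpathM0 // (amor0 (qpi_mor J)).
Qed.
Lemma cf_arrowM a x y : nz J (apath a) -> cf (apath a) (x * y) =
  cf (apath a) x * chi (src a) y + chi (tgt a) x * cf (apath a) y.
Proof.
move=> Na; rewrite cfM // big_ord_recl big_ord1 /=.
by rewrite pdrop0 ptake0 (pdrop_size (apath a)) (ptake_size (apath a)).
Qed.

End Filtration.

Section AlgIso.
Variables (k : fieldType) (Q Q' : quiver).
Variables (J : set (path_alg k Q)) (J' : set (path_alg k Q')).
Hypotheses (hJ : monomial_ideal J) (hJ' : monomial_ideal J').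
Variable F : quo J -> quo J'.
Hypothesis Fm : is_alg_mor F.
Local Notation e v := (qpi J (kpath k (vpath v))).

(** The composite of F and a character takes the values 0 and 1 on the
    orthogonal idempotents of the vertices. As they have sum 1, the value is
    1 exactly once. *)
Lemma pull_vertex : exists r : vert Q' -> vert Q,
  forall w v, chi w (F (e v)) = (v == r w)%:R.
Proof.
suff H w : exists v0, forall v, chi w (F (e v)) = (v == v0)%:R.
  by have [r rP] := choice H; exists r.
have orth v v' : v != v' -> chi w (F (e v)) * chi w (F (e v')) = 0.
  move=> /negPf vv; rewrite -(chiM hJ') -(amorM Fm) vpathM vv (amor0 Fm).
  by rewrite /chi cf0 //; exact: nz_vpath.
have [v0 v0n] : exists v0, chi w (F (e v0)) != 0.
  apply/existsP; apply: contraT; rewrite negb_exists => /forallP h.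
  have: chi w (F (qpi J 1)) = 0.
    rewrite one_vpath (amor_sum (qpi_mor J)) (amor_sum Fm) /chi cf_sum //; last exact: nz_vpath.
    by apply: big1 => v _; apply/eqP; have := h v; rewrite negbK.
  rewrite (amor1 (qpi_mor J)) (amor1 Fm) -(amor1 (qpi_mor J')) one_vpath.
  rewrite (amor_sum (qpi_mor J')) /chi cf_sum //; last exact: nz_vpath.
  rewrite (bigD1 w) //= -/(chi _ _) chi_vpath // eqxx big1 => [|w' ne].
    by rewrite addr0 => /eqP; rewrite oner_eq0.
  by rewrite -/(chi _ _) chi_vpath // eq_sym (negPf ne).
exists v0 => v; have [->|ne] := eqVneq v v0; last first.
  by have /eqP := orth _ _ ne; rewrite mulf_eq0 (negPf v0n) orbF => /eqP.
have : chi w (F (e v0)) * chi w (F (e v0)) = chi w (F (e v0)).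
  by rewrite -(chiM hJ') -(amorM Fm) vpathM eqxx.
by move/eqP; rewrite -[X in _ == X]mulr1 (inj_eq (mulfI v0n)) => /eqP.
Qed.

(** Elements of the radical are nilpotent, and characters vanish on nilpotent
    elements. This holds even if F sends the idempotents of the vertices to
    idempotents of another kind. *)
Lemma mor_fil1 x : fil 1 x -> fil 1 (F x).
Proof.
move=> x1; apply/(fil1P hJ') => w.
have [n nP] := fil_nilp hJ; have x0 : x ^+ n.+1 = 0.
  by apply: nP; apply: fil_le (filX hJ (n := n.+1) x1); exact: leqnSn.
have FX m : F (x ^+ m) = F x ^+ m.
  by elim: m => [|m IH]; rewrite ?expr0 ?(amor1 Fm) // !exprS (amorM Fm) IH.
have := chiX hJ' w (F x) n; rewrite -FX x0 (amor0 Fm) /chi cf0 //; last exact: nz_vpath.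
by move/esym/eqP; rewrite expf_eq0 => /andP[_ /eqP].
Qed.

Lemma mor_fil_path p : fil (size (parr p)) (F (qpi J (kpath k p))).
Proof.
move es : (parr p) => s; elim/last_ind: s p es => [|s a IH] p es; first by move=> q Nq.
have es' : parr (ptake (size s) p) = s by rewrite parr_ptake es -cats1 take_size_cat.
rewrite (kpath_arrowl _ es) qpi_mul (amorM Fm) size_rcons -add1n.
apply: (filM hJ'); last exact: IH.
by apply: mor_fil1; exact: (fil_kpath hJ (p := apath a)).
Qed.

Lemma mor_fil n x : fil n x -> fil n (F x).
Proof.
move=> xn; rewrite -[x](nformK hJ) /nform (amor_sum (qpi_mor J)) (amor_sum Fm).
rewrite big_seq_cond; apply: big_ind => [||p].
- exact: fil0.
- by move=> y z; apply: filD.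
rewrite andbT => /(nzsetP hJ) Np; have [lt|ge] := ltnP (size (parr p)) n.
  by rewrite xn // kpathc0 (amor0 (qpi_mor J)) (amor0 Fm); exact: fil0.
apply: (fil_le ge); rewrite kpathcE qpi_mul (amorM Fm) (amorZ (qpi_mor J)) (amorZ Fm).
by move=> q Nq qp; rewrite cfZ // (mor_fil_path (p := p)) ?mulr0.
Qed.

(** The coefficients of the linear part of F on arrows, that is, of the map
    induced by F on the quotient of the radical by its square. *)
Definition lin a c : k := cf (apath c) (F (qpi J (kpath k (apath a)))).

(** Among paths q of the same length as p, the coefficient of F(p) at q is
    the product of the linear coefficients along p and q, since F(p) is a
    product of elements of the radical. *)
Lemma lin_path p q : nz J' q -> parr p <> [::] ->
  all2 (fun a c => lin a c != 0) (parr p) (parr q) ->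
  cf q (F (qpi J (kpath k p))) != 0.
Proof.
move es : (parr p) => s; elim/last_ind: s p q es => [|s a IH] p q es Nq // _.
case/lastP eq : (parr q) => [|t c]; first by rewrite all2E size_rcons.
rewrite all2E !size_rcons eqSS => /andP[/eqP st].
rewrite zip_rcons // all_rcons => /andP[ac stl].
have es' : parr (ptake (size s) p) = s by rewrite parr_ptake es -cats1 take_size_cat.
have eq' : parr (ptake (size t) q) = t by rewrite parr_ptake eq -cats1 take_size_cat.
have ed : parr (pdrop (size t) q) = [:: c] by rewrite parr_pdrop eq -cats1 drop_size_cat.
have dc := path_apath ed.
have [Nt _] := mono_fc hJ' (size t) Nq.
have [/size0nil s0|sn] := eqVneq (size s) 0%N.
  have t0 : t = [::] by apply: size0nil; rewrite -st s0.
  have p1 : p = apath a by apply: path_apath; rewrite es s0.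
  have q1 : q = apath c by apply: path_apath; rewrite eq t0.
  by rewrite p1 q1.
rewrite (kpath_arrowl _ es) qpi_mul (amorM Fm) cfM // eq size_rcons.
have lt : (size t < (size t).+2)%N by rewrite ltnS leqnSn.
rewrite (bigD1 (Ordinal lt)) //= dc big1 ?addr0 => [|i ne]; last first.
  have [Ni Nd] := mono_fc hJ' i Nq; have [it|ti] := ltnP i (size t).
    rewrite [X in _ * X](mor_fil_path (p := ptake (size s) p)) ?mulr0 //.
    by rewrite es' parr_ptake eq size_takel ?size_rcons ?st // ltnW // ltnW.
  have ei : i = (size t).+1 :> nat.
    apply/eqP; rewrite eqn_leq -ltnS ltn_ord /= ltn_neqAle ti andbT.
    by apply: contra ne => /eqP h; apply/eqP/val_inj.
  rewrite [X in X * _](mor_fil_path (p := apath a)) ?mul0r //.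
  by rewrite parr_pdrop ei eq size_drop size_rcons subnn.
rewrite mulf_neq0 // IH //; first by move=> s0; rewrite s0 in sn.
by rewrite eq' all2E st eqxx.
Qed.

(** Modulo the square of the radical, F(a) = F(a) F(v) only sees the
    character values of F(v), where v is the source of a; likewise for the
    target. *)
Lemma lin_ends r a c : (forall w v, chi w (F (e v)) = (v == r w)%:R) ->
  nz J' (apath c) -> lin a c != 0 -> src a = r (src c) /\ tgt a = r (tgt c).
Proof.
move=> rP Nc ne.
have Fa1 v : chi v (F (qpi J (kpath k (apath a)))) = 0.
  by move: v; apply/(fil1P hJ'); apply: mor_fil1; exact: (fil_kpath hJ (p := apath a)).
split.
  have E : kpath k (apath a) = kpath k (apath a) * kpath k (vpath (src a)).
    by rewrite kpathM // pcat_vr.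
  move: ne; rewrite /lin E qpi_mul (amorM Fm) cf_arrowM // Fa1 mul0r addr0 rP.
  by case: (src a =P _); rewrite ?mulr0 ?eqxx.
have E : kpath k (apath a) = kpath k (vpath (tgt a)) * kpath k (apath a).
  by rewrite kpathM // pcat_vl.
move: ne; rewrite /lin E qpi_mul (amorM Fm) cf_arrowM // Fa1 mulr0 add0r rP.
by case: (tgt a =P _); rewrite ?mul0r ?eqxx.
Qed.
End AlgIso.

Section InverseLinearParts.
Variables (k : fieldType) (Q Q' : quiver).
Variables (J : set (path_alg k Q)) (J' : set (path_alg k Q')).
Hypotheses (hJ : monomial_ideal J) (hJ' : monomial_ideal J').
Variables (F : quo J -> quo J') (G : quo J' -> quo J).
Hypotheses (Fm : is_alg_mor F) (Gm : is_alg_mor G) (FK : cancel F G) (GK : cancel G F).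

Definition nz_arrow (Q0 : quiver) (J0 : set (path_alg k Q0)) : pred (arrow Q0) :=
  fun a => `[< nz J0 (apath a) >].

Lemma apath_inj (Q0 : quiver) (a c : arrow Q0) : (apath a == apath c) = (a == c).
Proof. by apply/eqP/eqP => [/(congr1 (@parr Q0)) [] |->]. Qed.

(** The linear parts of mutually inverse isomorphisms are mutually inverse
    matrices, because G maps the square of the radical into itself. *)
Lemma lin_inv a a' : nz J (apath a) -> nz J (apath a') ->
  \sum_(c in nz_arrow J') lin F a c * lin G c a' = (a == a')%:R.
Proof.
move=> Na Na'; pose x := qpi J (kpath k (apath a)).
pose t c : quo J' := algmap (lin F a c) * qpi J' (kpath k (apath c)).
have x1 : fil 1 (F x).
  by apply: (mor_fil1 hJ hJ' Fm); exact: (fil_kpath hJ (p := apath a)).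
have xt : fil 2 (F x - \sum_(c in nz_arrow J') t c).
  move=> p Np; rewrite cfB // cf_sum // leq_eqVlt eqSS => /orP[/eqP p1|p0]; last first.
    rewrite x1 // big1 ?subrr // => c _; rewrite cfZ // cf_kpath //.
    by case: eqP => [e|_]; rewrite ?mulr0 //; rewrite -e in p0.
  have [c e] := size1_apath p1; rewrite e in Np *.
  rewrite (bigD1 c) /=; last exact/asboolP.
  rewrite cfZ // cf_kpath // eqxx mulr1 big1 ?addr0 ?subrr // => c' /andP[_ ne].
  by rewrite cfZ // cf_kpath // apath_inj (negPf ne) mulr0.
have := mor_fil hJ' hJ Gm xt Na' (ltnSn _).
rewrite (amorB Gm) FK (amor_sum Gm) cfB // cf_kpath // apath_inj => /eqP.
rewrite subr_eq0 => /eqP ->; rewrite cf_sum //; apply: eq_bigr => c _.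
by rewrite /t (amorM Gm) (amorZ Gm) cfZ.
Qed.
End InverseLinearParts.

Lemma nz_arrow_in (k : fieldType) (Q : quiver) (J : set (path_alg k Q)) p a :
  monomial_ideal J -> nz J p -> a \in parr p -> nz J (apath a).
Proof.
move=> hJ Np; case/splitPr e : _ / => [s t].
have [_ N1] := mono_fc hJ (size s) Np; have [N2 _] := mono_fc hJ 1 N1.
rewrite -(path_apath (p := ptake 1 (pdrop (size s) p))) //.
by rewrite parr_ptake parr_pdrop e drop_size_cat //= take0.
Qed.

Section CombinatorialIso.
Variables (k : fieldType) (Q Q' : quiver).
Variables (J : set (path_alg k Q)) (J' : set (path_alg k Q')).
Hypotheses (hJ : monomial_ideal J) (hJ' : monomial_ideal J').
Variables (F : quo J -> quo J') (G : quo J' -> quo J).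
Hypotheses (Fm : is_alg_mor F) (Gm : is_alg_mor G) (FK : cancel F G) (GK : cancel G F).

(** The image by G of the idempotent of w is congruent to a sum of
    idempotents of vertices modulo the radical; applying F and the character
    of w singles out the vertex r w. *)
Lemma pull_vertexK (r : vert Q' -> vert Q) (r' : vert Q -> vert Q') :
  (forall w v, chi w (F (qpi J (kpath k (vpath v)))) = (v == r w)%:R) ->
  (forall v w, chi v (G (qpi J' (kpath k (vpath w)))) = (w == r' v)%:R) ->
  cancel r r'.
Proof.
move=> rP r'P w; pose x := G (qpi J' (kpath k (vpath w))).
pose y := \sum_v algmap (chi v x) * qpi J (kpath k (vpath v)).
have xy : fil 1 (x - y).
  apply/(fil1P hJ) => v; rewrite /chi cfB //; last exact: nz_vpath.
  rewrite cf_sum //; last exact: nz_vpath.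
  rewrite (bigD1 v) //= cfZ //; last exact: nz_vpath.
  rewrite -/(chi v (qpi _ _)) chi_vpath // eqxx mulr1 big1 ?addr0 ?subrr // => u uv.
  rewrite cfZ //; last exact: nz_vpath.
  by rewrite -/(chi v (qpi _ _)) chi_vpath // eq_sym (negPf uv) mulr0.
have /(fil1P hJ')/(_ w) := mor_fil1 hJ hJ' Fm xy.
rewrite (amorB Fm) (amor_sum Fm) /x GK /chi cfB //; last exact: nz_vpath.
rewrite -/(chi w (qpi _ _)) chi_vpath // eqxx cf_sum //; last exact: nz_vpath.
rewrite (bigD1 (r w)) //= big1 => [|v /negPf vr]; last first.
  rewrite (amorM Fm) (amorZ Fm) cfZ //; last exact: nz_vpath.
  by rewrite -/(chi w _) rP vr mulr0.
rewrite (amorM Fm) (amorZ Fm) cfZ //; last exact: nz_vpath.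
rewrite -/(chi w _) rP eqxx mulr1 addr0 -/(chi (r w) _) r'P.
by case: eqP => // _ /eqP; rewrite subr0 oner_eq0.
Qed.

End CombinatorialIso.

Section IsoCorrespondence.
Variables (k : fieldType) (Q Q' : quiver).
Variables (J : set (path_alg k Q)) (J' : set (path_alg k Q')).
Hypotheses (hJ : monomial_ideal J) (hJ' : monomial_ideal J').
Variables (F : quo J -> quo J') (G : quo J' -> quo J).
Hypotheses (Fm : is_alg_mor F) (Gm : is_alg_mor G) (FK : cancel F G) (GK : cancel G F).

(** Let s be a bijection of arrows along which the linear part of F does not
    vanish. If q is nonzero, then so is the path p corresponding to q, since
    the coefficient of F(p) at q is a product of nonzero linear coefficients. *)
Lemma iso_correspondence :
  exists (r : vert Q' -> vert Q) (r' : vert Q -> vert Q')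
         (s : arrow Q -> option (arrow Q')) (s' : arrow Q' -> option (arrow Q)),
  [/\ cancel r r', cancel r' r, forall a c, s a = Some c <-> s' c = Some a
    & [/\ forall c a, s' c = Some a -> src a = r (src c) /\ tgt a = r (tgt c),
       forall p, nz J p -> all (fun a => isSome (s a)) (parr p),
       forall q, nz J' q -> all (fun c => isSome (s' c)) (parr q)
     & forall q, nz J' q -> nz J (arrow_map r s' q)]].
Proof.
have [r rP] := pull_vertex hJ' Fm; have [r' r'P] := pull_vertex hJ Gm.
have rK := pull_vertexK hJ hJ' Fm GK rP r'P.
have r'K := pull_vertexK hJ' hJ Gm FK r'P rP.
have [s [s' [ss' sP s'P sn]]] := @invertible_pairing k _ _ (nz_arrow J) (nz_arrow J')
  (lin F) (lin G) (fun a a' h h' => lin_inv hJ hJ' Fm Gm FK (asboolW h) (asboolW h'))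
  (fun c c' h h' => lin_inv hJ' hJ Gm Fm GK (asboolW h) (asboolW h')).
have s'P' q : nz J' q -> all (fun c => isSome (s' c)) (parr q).
  by move=> Nq; apply/allP => c /(nz_arrow_in hJ' Nq)/asboolP/s'P.
have ends c a : s' c = Some a -> src a = r (src c) /\ tgt a = r (tgt c).
  by move/ss'/sn => -[_ /asboolP Nc]; exact: lin_ends.
exists r, r', s, s'; split=> //; split=> // [p Np|q Nq].
  by apply/allP => a /(nz_arrow_in hJ Np)/asboolP/sP.
have sq := s'P' _ Nq; have ap := parr_arrow_map (pi := r) ends sq.
have [q0|qn] := pselect (parr q = [::]).
  by rewrite (path_nil (p := arrow_map r s' q)) ?ap ?q0 //; exact: nz_vpath.
move=> Jp; have : cf q (F (qpi J (kpath k (arrow_map r s' q)))) != 0.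
  apply: (lin_path hJ hJ' Fm) => //; rewrite ap.
    by move=> /(congr1 size)/eqP; rewrite size_pmap -size_filter (all_filterP sq) size_eq0 => /eqP.
  elim: (parr q) sq => //= c t IH /andP[]; case e: (s' c) => [a|] //= _ /IH ->.
  by have [_ _ ->] := sn _ _ ((ss' a c).2 e).
by rewrite ((qpi0 hJ _).2 Jp) (amor0 Fm) cf0 // eqxx.
Qed.
End IsoCorrespondence.

(** The correspondence of arrows need not be the same for F and for its
    inverse, so it is not clear that nonzero paths have nonzero images. But
    nonzero paths are finite in number: pulling back is injective, and the
    same construction for the inverse of F gives the opposite inequality of
    cardinals. *)
Theorem iso_path_iso (k : fieldType) (Q Q' : quiver)
    (J : set (path_alg k Q)) (J' : set (path_alg k Q'))
    (hJ : monomial_ideal J) (hJ' : monomial_ideal J') (F : quo J -> quo J') :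
  is_alg_iso F -> exists b b', path_iso J J' b b'.
Proof.
move=> Fi; have [G [Gi FK GK]] := iso_inv Fi.
have [Fm Gm] := (iso_mor Fi, iso_mor Gi).
have [r [r' [s [s' [rK r'K ss' [ends sJ s'J rnz]]]]]] :=
  iso_correspondence hJ hJ' Fm Gm FK GK.
(* f with left inverse f' injects the nonzero paths of J1 into those of J2 *)
have le (Q1 Q2 : quiver) (J1 : set (path_alg k Q1)) (J2 : set (path_alg k Q2))
    (h1 : monomial_ideal J1) (h2 : monomial_ideal J2) (f : qpath Q1 -> qpath Q2) f' :
    (forall q, nz J1 q -> nz J2 (f q)) -> (forall q, nz J1 q -> f' (f q) = q) ->
    [/\ [fset f q | q in nzset J1]%fset `<=` nzset J2
      & #|` [fset f q | q in nzset J1]| = #|` nzset J1| ]%fset.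
  move=> fnz fK; split.
    by apply/fsubsetP => _ /imfsetP[q /= /(nzsetP h1) /fnz Nq ->]; apply/(nzsetP h2).
  rewrite card_in_imfset //= => p q /(nzsetP h1) Np /(nzsetP h1) Nq e.
  by rewrite -(fK p Np) -(fK q Nq) e.
have ss c a : s' c = Some a -> s a = Some c by move/ss'.
have ss'' a c : s a = Some c -> s' c = Some a by move/ss'.
have ends' a c : s a = Some c -> src c = r' (src a) /\ tgt c = r' (tgt a).
  by move=> /ss'/ends[-> ->]; rewrite !rK.
have mK q : nz J' q -> arrow_map r' s (arrow_map r s' q) = q.
  by move=> Nq; apply: arrow_mapK => //; apply: s'J.
have mK' p : nz J p -> arrow_map r s' (arrow_map r' s p) = p.
  by move=> Np; apply: arrow_mapK => //; apply: sJ.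
have [sub card] := le _ _ _ _ hJ' hJ _ _ rnz mK.
(* the correspondence of G is only used for this bound *)
have leJ : (#|` nzset J| <= #|` nzset J'|)%N.
  have [u [u' [t [t' [uK u'K tt' [tends tJ t'J unz]]]]]] :=
    iso_correspondence hJ' hJ Gm Fm GK FK.
  have tt c a : t' c = Some a -> t a = Some c by move/tt'.
  have uK2 q : nz J q -> arrow_map u' t (arrow_map u t' q) = q.
    by move=> Nq; apply: arrow_mapK => //; apply: t'J.
  have [sub2 <-] := le _ _ _ _ hJ hJ' _ _ unz uK2.
  exact: fsubset_leq_card.
have eqN : [fset arrow_map r s' q | q in nzset J']%fset = nzset J.
  by apply/eqP; rewrite eqEfcard sub card.
exists (arrow_map r' s), (arrow_map r s'); split=> //; last first.
  exact: arrow_map_pmor.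
apply: arrow_map_pmor => // p /(nzsetP hJ).
by rewrite -eqN => /imfsetP[q /= /(nzsetP hJ') Nq ->]; rewrite mK.
Qed.

(** * Paths of a fractional Brauer configuration *)

Local Arguments src : simpl never.
Local Arguments tgt : simpl never.

Section FbcPaths.
Variable E : fbc_data.
Local Notation g := (@rotate E).
Local Notation d := (@Defs.fdeg E).
Implicit Types (e h : angle E).

Lemma Pcl_self e : e \in Pcl e.
Proof. by rewrite mem_pblock (cover_partition (Ppart_partition E)) finset.in_setT. Qed.
Lemma Lcl_self e : e \in Lcl e.
Proof. by rewrite mem_pblock (cover_partition (Lpart_partition E)) finset.in_setT. Qed.
Lemma Lcl_eq e h : e \in Lcl h -> Lcl e = Lcl h.
Proof.
move=> he; apply: same_pblock => //.
by have /and3P[_ ] := Lpart_partition E.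
Qed.
Lemma Pcl_eq e h : e \in Pcl h -> Pcl e = Pcl h.
Proof.
move=> he; apply: same_pblock => //.
by have /and3P[_ ] := Ppart_partition E.
Qed.
Lemma Pvert_eq e h : Pvert e = Pvert h <-> Pcl e = Pcl h.
Proof. by split=> [/(congr1 val)|H] //; apply: val_inj. Qed.
Lemma Larrow_eq e h : Larrow e = Larrow h <-> Lcl e = Lcl h.
Proof. by split=> [/(congr1 val)|H] //; apply: val_inj. Qed.

Lemma Larrow_mem (a : arrow (QE E)) e : e \in val a -> a = Larrow e.
Proof.
move=> ea; apply: val_inj => /=; rewrite /Lcl.
have /and3P[_ triv _] := Lpart_partition E.
by rewrite (def_pblock triv (valP a) ea).
Qed.
Lemma Larrow_surj (a : arrow (QE E)) : exists e, a = Larrow e.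
Proof. by have [e ea] := Larrow_ex a; exists e; exact: Larrow_mem. Qed.
Lemma Pvert_surj (v : vert (QE E)) : exists e, v = Pvert e.
Proof.
have /and3P[_ triv n0] := Ppart_partition E.
have /set0Pn[e ev] : val v != finset.set0 by apply: contraNneq n0 => <-; exact: valP.
exists e; apply: val_inj => /=; rewrite /Pcl.
by rewrite (def_pblock triv (valP v) ev).
Qed.

Hypothesis hE : is_fBC E.

Lemma src_Larrow e : src (Larrow e : arrow (QE E)) = Pvert e.
Proof.
apply/Pvert_eq; move: (xchooseP (Larrow_ex (Larrow e))).
set h := xchoose _ => /(fintype.subsetP (fBC_f1 hE e)); exact: Pcl_eq.
Qed.
Lemma tgt_Larrow e : tgt (Larrow e : arrow (QE E)) = Pvert (g e).
Proof.
apply/Pvert_eq; apply: (fBC_f2 hE).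
by move: (xchooseP (Larrow_ex (Larrow e))); exact: Lcl_eq.
Qed.

Lemma fdeg_iter n e : d (iter n g e) = d e.
Proof. by apply: (fBC_f3 hE); rewrite -permX mem_porbit. Qed.

Lemma size_Larrows e n : size (Larrows e n) = n.
Proof. by rewrite size_map size_iota. Qed.
Lemma LarrowsS e n : Larrows e n.+1 = Larrow e :: Larrows (g e) n.
Proof.
rewrite /Larrows /= -[1%N]/(1 + 0)%N iotaDl -map_comp; congr (_ :: _).
by apply: eq_map => i /=; rewrite -iterSr.
Qed.
Lemma LarrowsD e m n : Larrows e (m + n) = Larrows e m ++ Larrows (iter m g e) n.
Proof. by elim: m e => // m IH e; rewrite addSn !LarrowsS IH -iterSr. Qed.
Lemma nth_Larrows e n i a : (i < n)%N -> nth a (Larrows e n) i = Larrow (iter i g e).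
Proof. by move=> ltin; rewrite (nth_map 0%N) ?size_iota // nth_iota. Qed.
Lemma take_Larrows e n i : (i <= n)%N -> take i (Larrows e n) = Larrows e i.
Proof. by move=> le; rewrite -(subnKC le) LarrowsD take_size_cat ?size_Larrows. Qed.
Lemma drop_Larrows e n i : (i <= n)%N ->
  drop i (Larrows e n) = Larrows (iter i g e) (n - i).
Proof. by move=> le; rewrite -{1}(subnKC le) LarrowsD drop_size_cat ?size_Larrows. Qed.
Lemma mem_Larrows e n a : reflect (exists2 i, (i < n)%N & a = Larrow (iter i g e))
  (a \in (Larrows e n : seq (arrow (QE E)))).
Proof.
apply: (iffP mapP) => -[i]; first by rewrite mem_iota => h ->; exists i.
by move=> h ->; exists i; rewrite ?mem_iota.
Qed.
Lemma Larrows_eqP e h n m : (Larrows e n = Larrows h m :> seq (arrow (QE E))) <->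
  n = m /\ forall i, (i < n)%N -> Lcl (iter i g e) = Lcl (iter i g h).
Proof.
split=> [eqn|[<- H]]; last first.
  by apply/eq_in_map => i; rewrite mem_iota => /H/Larrow_eq.
have nm : n = m by rewrite -(size_Larrows e n) eqn size_Larrows.
split=> // i ltin; apply/Larrow_eq.
by rewrite -(nth_Larrows e (Larrow e) ltin) eqn nth_Larrows // -nm.
Qed.

Lemma walk_Larrows e n : walk (Pvert e : vert (QE E)) (Larrows e n).
Proof. by elim: n e => // n IH e; rewrite LarrowsS /= src_Larrow eqxx tgt_Larrow IH. Qed.
Lemma last_Larrows e n :
  last (Pvert e : vert (QE E)) (map (@tgt _) (Larrows e n)) = Pvert (iter n g e).
Proof. by elim: n e => // n IH e; rewrite LarrowsS /= tgt_Larrow IH -iterSr. Qed.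

(** The path L(p), for the standard sequence p = (e, n). *)
Definition lpath e n : qpath (QE E) := @QPath (QE E) (Pvert e, Larrows e n) (walk_Larrows e n).
Lemma psrc_lpath e n : psrc (lpath e n) = Pvert e. Proof. by []. Qed.
Lemma parr_lpath e n : parr (lpath e n) = Larrows e n. Proof. by []. Qed.
Lemma ptgt_lpath e n : ptgt (lpath e n) = Pvert (iter n g e).
Proof. exact: last_Larrows. Qed.
Lemma lpathD e m n : pcat (lpath (iter m g e) n) (lpath e m) = lpath e (m + n).
Proof.
have ce : psrc (lpath (iter m g e) n) = ptgt (lpath e m) by rewrite ptgt_lpath.
apply: qpath_eq; first by rewrite psrc_pcat.
by rewrite parr_pcat // !parr_lpath LarrowsD.
Qed.
Lemma lpath_take e n i : (i <= n)%N -> ptake i (lpath e n) = lpath e i.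
Proof.
by move=> le; apply: qpath_eq; rewrite ?psrc_ptake // parr_ptake parr_lpath take_Larrows.
Qed.
Lemma lpath_drop e n i : (i <= n)%N -> pdrop i (lpath e n) = lpath (iter i g e) (n - i).
Proof.
move=> le; apply: qpath_eq; last by rewrite parr_pdrop parr_lpath drop_Larrows.
by rewrite psrc_pdrop lpath_take // ptgt_lpath.
Qed.
Lemma lpath_parr p e n : parr p = Larrows e n -> psrc p = Pvert e -> p = lpath e n.
Proof. by move=> e1 e2; apply: qpath_eq. Qed.
Lemma lpath_parrS p e n : (0 < n)%N -> parr p = Larrows e n -> p = lpath e n.
Proof.
case: n => // n _ e1; apply: lpath_parr => //.
by move: e1; rewrite LarrowsS => /psrc_head ->; exact: src_Larrow.
Qed.

(** The paths that are not killed by the zero relations. *)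
Definition std (p : qpath (QE E)) := exists e n, (n <= d e)%N /\ p = lpath e n.

Lemma std_fc : factor_closed std.
Proof.
move=> p i [e [n [le ->]]]; have [lei|lti] := leqP i n; last first.
  rewrite -(size_Larrows e n) -parr_lpath in lti.
  split.
    exists e, n; split=> //; apply: qpath_eq; rewrite ?psrc_ptake ?parr_ptake //.
    by rewrite take_oversize // ltnW.
  exists (iter n g e), 0%N; split=> //; apply: qpath_eq.
    by rewrite psrc_pdrop /ptgt psrc_ptake parr_ptake take_oversize ?(ltnW lti) // last_Larrows.
  by rewrite parr_pdrop drop_oversize // ltnW.
rewrite lpath_take // lpath_drop //; split; first by exists e, i; rewrite (leq_trans lei).
exists (iter i g e), (n - i)%N; split=> //; rewrite fdeg_iter.
exact: leq_trans (leq_subr _ _) le.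
Qed.

Lemma std_vpath v : std (vpath v).
Proof. by have [e ->] := Pvert_surj v; exists e, 0%N; split=> //; apply: qpath_eq. Qed.

Lemma Larrows_arrow_prod k e n : (0 < n)%N ->
  arrow_prod k (Larrows e n : seq (arrow (QE E))) = kpath k (lpath e n).
Proof. by case: n => // n _; rewrite -parr_lpath arrow_prod_path // parr_lpath LarrowsS. Qed.

(** Otherwise the special path of e would be a proper part of another special
    path, against fBC_f6. *)
Lemma R3_not_std e n : (d e < n)%N -> ~ std (lpath e n).
Proof.
move=> den [h [m [mh eqp]]].
have /Larrows_eqP[nm H] : Larrows e n = Larrows h m :> seq (arrow (QE E)).
  by rewrite -!parr_lpath eqp.
have eqL : Lseq e (d e) = Lseq h (d e).
  by apply/eq_in_map => i; rewrite mem_iota => /= hi; rewrite H //; apply: ltn_trans den.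
have deh : (d e <= d h)%N by rewrite (leq_trans (ltnW den)) // nm.
have : infix (Lseq e (d e)) (Lseq h (d h)).
  rewrite eqL; apply/infixP; exists [::], (drop (d e) (Lseq h (d h))).
  rewrite -[LHS](cat_take_drop (d e)) /=; congr (_ ++ _).
  by rewrite /Lseq -map_take take_iota (minn_idPl deh).
move/(fBC_f6 hE)/(congr1 size); rewrite !size_map !size_iota => deq.
by move: mh; rewrite -nm -deq leqNgt den.
Qed.

Section Relations.
Variable k : fieldType.

Definition R1_data e h j := [/\ Pcl e = Pcl h, (j < d e)%N, (j < d h)%N
  & forall i, (1 <= i <= j)%N -> Lcl (iter (d e - i) g e) = Lcl (iter (d h - i) g h)].

Lemma IE_R1_path e h j : R1_data e h j ->
  IE E k (kpath k (lpath e (d e - j)) - kpath k (lpath h (d h - j))).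
Proof.
case=> P1 je jh tl; rewrite -!Larrows_arrow_prod ?subn_gt0 //.
by apply: sub_ideal_gen; apply: IE_R1.
Qed.

(** A path whose arrows are not the classes of consecutive angles of one
    orbit is of the form considered in IE_R2; otherwise it is too long, and
    IE_R3 applies. *)
Lemma IE_not_std p : ~ std p -> IE E k (kpath k p).
Proof.
move=> nstd; have pn : parr p <> [::].
  by move=> e; apply: nstd; rewrite (path_nil e); exact: std_vpath.
rewrite -(arrow_prod_path k pn).
have [[e pe]|nre] := pselect (exists e, parr p = Larrows e (size (parr p))).
  have [le|lt] := leqP (size (parr p)) (d e); last first.
    by rewrite pe; apply: sub_ideal_gen; apply: IE_R3.
  case: nstd; exists e, (size (parr p)); split=> //.
  by apply: lpath_parrS => //; case: (parr p) pn.
have [e0 _] : exists e0 : angle E, True.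
  by case: (parr p) pn => // a s _; have [e _] := Larrow_surj a; exists e.
pose a0 : arrow (QE E) := Larrow e0.
have [f fP] := choice (fun i => Larrow_surj (nth a0 (parr p) i)).
have sE : parr p = [seq Larrow (f i) : arrow (QE E) | i <- iota 0 (size (parr p))].
  by rewrite -[LHS](mkseq_nth a0); apply: eq_map => i; rewrite fP.
rewrite sE; apply: sub_ideal_gen; apply: IE_R2.
- by case: (parr p) pn.
- move=> i ilt; apply/Pvert_eq; rewrite -tgt_Larrow -src_Larrow -!fP.
  have := qpathP p; rewrite -{1}(cat_take_drop i (parr p)) walk_cat => /andP[_].
  rewrite (drop_nth a0 (ltnW ilt)) (drop_nth a0 ilt) /=.
  by case/and3P=> _ /eqP/esym.
apply/eqP; apply/negPn; apply/negP => /finset.set0Pn[x /bigcapP xP].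
apply: nre; set n := size (parr p) in xP *.
have n0 : (0 < n)%N by rewrite /n; case: (parr p) pn.
have /finset.imsetP[y yL _] := xP (Ordinal n0) isT.
pose z := iter n.-1 (g^-1)%g x.
have gz i : (i < n)%N -> Lcl (iter i g z) = Lcl (f i).
  move=> ilt; have /finset.imsetP[w wL xw] := xP (Ordinal ilt) isT.
  suff -> : iter i g z = w by apply: Lcl_eq.
  apply: (@perm_inj _ (g ^+ (n.-1 - i))%g).
  rewrite !permX /= -xw -iterD subnK; last by rewrite -ltnS prednK.
  by rewrite /z -!permX -permM expVgn mulVg perm1.
exists z; rewrite sE -/n; apply/eq_in_map => i; rewrite mem_iota => /= ilt.
by apply/Larrow_eq; rewrite gz.
Qed.

(** Together with IE_not_std and IE_R1_path, this replaces the relations by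
    differences of standard paths and by the paths that are not standard. *)
Lemma IE_rel_cases x : @IE_rel E k x ->
  (exists2 p, ~ std p & x = kpath k p) \/
  (exists e h j, R1_data e h j /\
     x = kpath k (lpath e (d e - j)) - kpath k (lpath h (d h - j))).
Proof.
case=> [e h j Peh je jh tl|n e n0 Pe cap|e n en].
- right; exists e, h, j; split=> //.
  by rewrite !Larrows_arrow_prod ?subn_gt0.
- left; have w : walk (Pvert (e 0%N) : vert (QE E)) [seq Larrow (e i) : arrow (QE E) | i <- iota 0 n].
    have: forall i m, (i + m <= n)%N -> walk (Pvert (e i) : vert (QE E))
        [seq Larrow (e i) : arrow (QE E) | i <- iota i m].
      move=> i m; elim: m i => // m IH i im /=; rewrite src_Larrow eqxx /=.
      rewrite tgt_Larrow; case: m IH im => // m IH im.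
      have -> : Pvert (g (e i)) = Pvert (e i.+1).
        by apply/Pvert_eq; apply: Pe; rewrite (leq_trans _ im) // !addnS !ltnS leq_addr.
      by apply: IH; rewrite addSnnS.
    by apply.
  exists (QPath (pval := (_, _)) w).
    move=> [h [m [_ /(congr1 (@parr _))]]]; rewrite [parr _ in LHS]/= parr_lpath => eqs.
    have nm : n = m by have := congr1 size eqs; rewrite size_map size_iota size_Larrows.
    suff : iter n.-1 g h \in finset.set0 by rewrite finset.inE.
    rewrite -cap; apply/bigcapP => i _; apply/finset.imsetP; exists (iter i g h).
      suff -> : Lcl (e i) = Lcl (iter i g h) by exact: Lcl_self.
      apply/Larrow_eq; have := congr1 (fun s => nth (Larrow h) s i) eqs.
      by rewrite nth_Larrows -?nm // (nth_map 0%N) ?size_iota // nth_iota.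
    by rewrite -iterD subnK // -ltnS prednK.
  by rewrite -arrow_prod_path //= => /(congr1 size); rewrite size_map size_iota; case: (n) n0.
left; exists (lpath e n); first exact: R3_not_std.
by rewrite Larrows_arrow_prod //; apply: leq_trans en.
Qed.

End Relations.
End FbcPaths.

(** * Admissible cuts *)

Section SpecialCycles.
Variable E : fbc_data.
Local Notation g := (@rotate E).
Local Notation d := (@Defs.fdeg E).
Implicit Types (e h : angle E).
Hypotheses (hE : is_fBC E) (symE : fbc_symmetric E).

Lemma size_special e : size (special e) = d e.
Proof. exact: size_Larrows. Qed.

Lemma special_rot i e : (i <= d e)%N -> special (iter i g e) = rot i (special e).
Proof.
move=> le; rewrite /special fdeg_iter // /rot take_Larrows // drop_Larrows //.
rewrite -{1}(subnK le) LarrowsD; congr (_ ++ Larrows _ _).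
by rewrite -iterD subnK.
Qed.

Lemma iter_back i e : (i <= d e)%N -> iter (d e - i) g (iter i g e) = e.
Proof. by move=> le; rewrite -iterD subnK. Qed.

Lemma special_iter e h i : special e = special h ->
  special (iter i g e) = special (iter i g h).
Proof.
have s1 x : special (g x) = rot 1 (special x).
  by apply: (special_rot (i := 1)); exact: fdeg_gt0.
by move=> eh; elim: i => //= i IH; rewrite !s1 IH.
Qed.

Lemma special_back e h i : (i <= d e)%N -> d e = d h ->
  special (iter i g e) = special (iter i g h) -> special e = special h.
Proof.
move=> le deh eqs; rewrite -(iter_back le) -(iter_back (i := i) (e := h)) -?deh //.
exact: special_iter.
Qed.

Lemma cyclic_eqP e h :
  reflect (exists i, special h = special (iter i g e)) (cyclic_eq e h).
Proof.
apply: (iffP existsP) => [[i /eqP ->]|[i ->]].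
  by exists i; rewrite special_rot // -ltnS.
have d0 := fdeg_gt0 hE e.
have lt : (i %% d e < (d e).+1)%N by rewrite ltnS ltnW // ltn_mod.
exists (Ordinal lt) => /=; rewrite -special_rot // {1}(divn_eq i (d e)) addnC.
rewrite iterD; suff -> : iter (i %/ d e * d e) g e = e by [].
by elim: (i %/ d e)%N => // m IH; rewrite mulSn iterD IH symE.
Qed.

Lemma cyclic_eq_refl e : cyclic_eq e e.
Proof. by apply/cyclic_eqP; exists 0%N. Qed.
Lemma cyclic_eq_trans e h l : cyclic_eq e h -> cyclic_eq h l -> cyclic_eq e l.
Proof.
move=> /cyclic_eqP[i hi] /cyclic_eqP[j lj]; apply/cyclic_eqP; exists (j + i)%N.
by rewrite lj iterD; exact: special_iter.
Qed.
Lemma cyclic_eq_sym e h : cyclic_eq e h -> cyclic_eq h e.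
Proof.
move=> /existsP[[i ile] /= /eqP]; rewrite ltnS in ile; rewrite -special_rot // => eqs.
apply/cyclic_eqP; exists (d e - i)%N.
by rewrite (special_iter _ eqs) iter_back.
Qed.
Lemma cyclic_eq_equiv : {in [set: angle E] & &, equivalence_rel (@cyclic_eq E)}.
Proof.
move=> e h l _ _ _; split=> [|eh]; first exact: cyclic_eq_refl.
by apply/idP/idP; apply: cyclic_eq_trans; rewrite // cyclic_eq_sym.
Qed.

(** For the configuration of a monomial algebra this form of the cut condition
    is immediate, whereas the definition of admissible_cut refers to the number
    of special cycles. *)
Record cycle_cut (D : {set arrow (QE E)}) : Prop := {
  cut_once : forall e, count (mem D) (special e) = 1%N;
  cut_det : forall e h, Larrow e \in D -> Larrow e = Larrow h ->
    special e = special h }.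

Variable D : {set arrow (QE E)}.

(** Special cycles up to rotation are in bijection with D: each goes through
    one arrow of D, every arrow of D is reached, and both sets have the same
    cardinal. Hence an arrow of D lies on one cycle up to rotation, and as it
    occurs there only once, the rotation is determined too. *)
Lemma admissible_cycle_cut : admissible_cut D -> cycle_cut D.
Proof.
case=> cutD cardD onceD.
have ex1 e : exists a, [set a in D | a \in special e] = finset.set1 a.
  by have /eqP/cards1P := cutD e.
have [f fP] := choice ex1.
have fD e : f e \in D.
  by have := finset.set11 (f e); rewrite -fP finset.inE => /andP[].
have fs e : f e \in special e.
  by have := finset.set11 (f e); rewrite -fP finset.inE => /andP[].
have fu e a : a \in D -> a \in special e -> a = f e.
  by move=> aD ae; apply/set1P; rewrite -fP finset.inE aD.
have fc e h : cyclic_eq e h -> f e = f h.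
  by move=> /existsP[i /eqP eqs]; apply: fu => //; rewrite eqs mem_rot.
have once e : count (mem D) (special e) = 1%N.
  apply/eqP; rewrite eqn_leq -has_count; apply/andP; split.
    apply: leq_trans (onceD (f e) e (fD e)); rewrite -!size_filter.
    rewrite (@eq_in_filter _ (mem D) (pred1 (f e))) // => a ae /=.
    by apply/idP/eqP => [aD|->]; [exact: fu|exact: fD].
  by apply/hasP; exists (f e); rewrite ?fs /=.
split=> // e h eD eqL.
have ce : cyclic_eq e h.
  have feh : f e = f h.
    have in_special x : Larrow x \in (special x : seq (arrow (QE E))).
      by apply/mem_Larrows; exists 0%N => //; apply: fdeg_gt0.
    rewrite -(fu e (Larrow e)) ?in_special // eqL.
    by apply: fu; rewrite -?eqL ?in_special // eqL in_special.
  pose P := equivalence_partition (@cyclic_eq E) [set: angle E].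
  have PP : finset.partition P [set: angle E] by apply: equivalence_partitionP; exact: cyclic_eq_equiv.
  have [/eqP cov triv n0] := and3P PP.
  have blk x y : (y \in finset.pblock P x) = cyclic_eq x y.
    by apply: pblock_equivalence_partition; rewrite ?finset.inE //; exact: cyclic_eq_equiv.
  pose phi (B : {set angle E}) := omap f [pick x in B].
  have phiE x : phi (finset.pblock P x) = Some (f x).
    rewrite /phi; case: pickP => [y|/(_ x)]; first by rewrite blk => /fc ->.
    by rewrite blk cyclic_eq_refl.
  have inP x : finset.pblock P x \in P by rewrite pblock_mem // cov finset.inE.
  have sub : Some @: D \subset phi @: P.
    apply/fintype.subsetP => _ /finset.imsetP[a aD ->]; have [x ax] := Larrow_surj a.
    apply/finset.imsetP; exists (finset.pblock P x) => //; rewrite phiE.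
    congr Some; apply: fu => //; rewrite ax.
    by apply/mem_Larrows; exists 0%N => //; apply: fdeg_gt0.
  have /imset_injP inj : #|phi @: P| == #|P|.
    rewrite eqn_leq leq_imset_card /= -/(ncycles E) -cardD.
    by rewrite -(card_imset (mem D) (@Some_inj _)); apply: subset_leq_card.
  have : finset.pblock P e = finset.pblock P h by apply: inj; rewrite ?inP // !phiE feh.
  by move=> eqB; rewrite -blk eqB blk cyclic_eq_refl.
have {ce} /existsP[[i /= ile] /eqP eqs] := ce; rewrite ltnS in ile.
rewrite eqs; have d0 := fdeg_gt0 hE e.
have dh : d h = d e by have := congr1 size eqs; rewrite size_rot !size_special.
have [->|i0] := posnP i; first by rewrite rot0.
move: ile; rewrite leq_eqVlt => /orP[/eqP ->|ilt]; first by rewrite -size_special rot_size.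
(* otherwise the arrow occurs at the positions 0 and i of the cycle of e *)
have := onceD _ e eD; have hd : nth (Larrow e) (special e) i = Larrow e.
  have := congr1 (fun s => nth (Larrow e) s 0) eqs.
  rewrite /= nth_Larrows ?dh //= -eqL => {2}->.
  by rewrite /rot nth_cat size_drop size_special subn_gt0 ilt nth_drop addn0.
rewrite -(cat_take_drop i (special e)) count_cat => le1; exfalso; move: le1.
apply/negP; rewrite -ltnNge; apply: (@leq_add 1 1); rewrite -has_count has_pred1.
  apply/(nthP (Larrow e)); exists 0%N.
    by rewrite size_takel ?size_special // ltnW.
  by rewrite nth_take // nth_Larrows.
apply/(nthP (Larrow e)); exists 0%N; first by rewrite size_drop size_special subn_gt0.
by rewrite nth_drop addn0.
Qed.
End SpecialCycles.

(** * Complementary paths and the symmetrizing form *)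

Section Complements.
Variable E : fbc_data.
Local Notation g := (@rotate E).
Local Notation d := (@Defs.fdeg E).
Implicit Types (e h : angle E) (p q c : qpath (QE E)).
Hypotheses (hE : is_fBC E) (symE : fbc_symmetric E).
Local Notation lp := (lpath hE).

Definition cycle_path p := exists e, p = lp e (d e).

(** In a trivial extension, one of c and p is the dual basis element of the
    other. *)
Definition compl c p := psrc c = ptgt p /\ cycle_path (pcat c p).

Lemma complP c p : compl c p -> exists e n,
  [/\ (n <= d e)%N, p = lp e n & c = lp (iter n g e) (d e - n)].
Proof.
case=> e1 [e ee]; have sz : size (parr (pcat c p)) = d e by rewrite ee size_Larrows.
have le : (size (parr p) <= d e)%N by rewrite -sz parr_pcat // size_cat leq_addr.
exists e, (size (parr p)); split=> //.
  by rewrite -(lpath_take hE e le) -ee ptake_pcat.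
by rewrite -(lpath_drop hE e le) -ee pdrop_pcat.
Qed.
Lemma compl_lpath e n : (n <= d e)%N -> compl (lp (iter n g e) (d e - n)) (lp e n).
Proof.
move=> le; split; first by rewrite ptgt_lpath.
by exists e; rewrite lpathD subnKC.
Qed.
(** Rotations of special cycles are special. *)
Lemma compl_sym c p : compl c p -> compl p c.
Proof.
move=> /complP[e [n [le -> ->]]].
have := @compl_lpath (iter n g e) (d e - n).
by rewrite fdeg_iter // leq_subr subKn // iter_back // => /(_ isT).
Qed.
Lemma compl_assoc p q r : psrc p = ptgt q -> psrc q = ptgt r ->
  compl p (pcat q r) <-> compl (pcat p q) r.
Proof.
by move=> pq qr; rewrite /compl pcatA // ptgt_pcat // psrc_pcat //; split=> -[].
Qed.
Lemma compl_std c p : compl c p -> std hE p.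
Proof. by move=> /complP[e [n [le -> _]]]; exists e, n. Qed.
Lemma std_compl p : std hE p -> exists c, compl c p.
Proof. by case=> e [n [le ->]]; eexists; apply: compl_lpath. Qed.

(** Up to the description of p as a common tail, this is IE_R1. Nontriviality
    of the two complements is the condition j < d of that relation. *)
Lemma compl_R1 (k : fieldType) c1 c2 p : compl c1 p -> compl c2 p ->
  parr c1 <> [::] -> parr c2 <> [::] -> IE E k (kpath k c1 - kpath k c2).
Proof.
move=> h1 h2; have [s1 _] := h1; have [s2 _] := h2.
have /complP[e [n [ne c1E p1]]] := compl_sym h1.
have /complP[h [m [mh c2E p2]]] := compl_sym h2.
have sp : size (parr p) = (d e - n)%N by rewrite p1 size_Larrows.
have sp2 : size (parr p) = (d h - m)%N by rewrite p2 size_Larrows.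
rewrite c1E c2E => n0 m0.
have -> : n = (d e - size (parr p))%N by rewrite sp subKn.
have -> : m = (d h - size (parr p))%N by rewrite sp2 subKn.
have n1 : (0 < n)%N by case: (n) n0.
have m1 : (0 < m)%N by case: (m) m0.
apply: IE_R1_path; split.
- by apply/Pvert_eq; rewrite -[LHS](psrc_lpath hE e n) -[RHS](psrc_lpath hE h m) -c1E -c2E s1.
- by rewrite sp ltn_subrL n1 fdeg_gt0.
- by rewrite sp2 ltn_subrL m1 fdeg_gt0.
move=> i /andP[i1 ile].
have /Larrows_eqP[_ H] : Larrows (iter n g e) (size (parr p)) = Larrows (iter m g h) (size (parr p)) :> seq (arrow (QE E)).
  by rewrite {1}sp {1}sp2 -!(parr_lpath hE) -p1 -p2.
have lt : (size (parr p) - i < size (parr p))%N by rewrite ltn_subrL i1 (leq_trans i1).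
have := H _ lt; rewrite -!iterD.
have aux a b : (b <= a)%N -> size (parr p) = (a - b)%N ->
    (size (parr p) - i + b = a - i)%N.
  by move=> ba sab; rewrite addnC addnBA // sab subnKC.
by rewrite (aux (d e)) // (aux (d h)).
Qed.

Section Trace.
Variable k : fieldType.
Local Notation kQ := (path_alg k (QE E)).
Implicit Types (x y z : kQ).

Definition cycles : seq (qpath (QE E)) := undup [seq lp e (d e) | e <- enum (angle E)].
Lemma cyclesP p : reflect (cycle_path p) (p \in cycles).
Proof.
rewrite mem_undup; apply: (iffP mapP) => [[e _ ->]|[e ->]]; first by exists e.
by exists e; rewrite ?mem_enum.
Qed.

(** The symmetrizing form of the algebra of E: the sum of the coefficients at
    the special cycles. *)
Definition tr y : k := \sum_(p <- cycles) y@_p.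

Lemma trD y z : tr (y + z) = tr y + tr z.
Proof. by rewrite /tr -big_split; apply: eq_bigr => p _; rewrite mcoeffD. Qed.
Lemma tr0 : tr 0 = 0.
Proof. by rewrite /tr big1 // => p _; rewrite mcoeff0. Qed.
Lemma trZ a y : tr (algmap a * y) = a * tr y.
Proof. by rewrite /tr mulr_sumr; apply: eq_bigr => p _; rewrite mcoeff_algmap. Qed.
Lemma tr_kpathc a p : tr (kpathc a p) = a *+ (p \in cycles).
Proof.
rewrite /tr; have [pc|pc] := boolP (p \in cycles).
  rewrite (bigD1_seq p) ?undup_uniq //= mcoeff_kpathc eqxx big1 ?addr0 // => q qp.
  by rewrite mcoeff_kpathc eq_sym (negPf qp).
rewrite big1_seq // => q /= qc; rewrite mcoeff_kpathc.
by case: eqP => // e; rewrite e qc in pc.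
Qed.
Lemma tr_kpathcM a b p q :
  tr (kpathc a p * kpathc b q) = a * b *+ `[< compl p q >].
Proof.
rewrite kpathcM /path_mul; case: eqP => [e|e].
  rewrite tr_kpathc; congr (_ *+ nat_of_bool _).
  by apply/cyclesP/asboolP => [|[]].
by rewrite tr0; case: asboolP => // -[].
Qed.
Lemma trC x y : tr (x * y) = tr (y * x).
Proof.
elim/kQ_ind: x => [|x x' IH IH'|a p]; first by rewrite mul0r mulr0.
  by rewrite mulrDl mulrDr !trD IH IH'.
elim/kQ_ind: y => [|y y' IH IH'|b q]; first by rewrite mul0r mulr0.
  by rewrite mulrDl mulrDr !trD IH IH'.
rewrite !tr_kpathcM mulrC; congr (_ *+ nat_of_bool _).
by apply/asboolP/asboolP => /compl_sym.
Qed.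
End Trace.
End Complements.

Section CutPaths.
Variable E : fbc_data.
Local Notation g := (@rotate E).
Local Notation d := (@Defs.fdeg E).
Implicit Types (e h : angle E) (p q c : qpath (QE E)).
Hypotheses (hE : is_fBC E) (symE : fbc_symmetric E).
Local Notation lp := (lpath hE).
Local Notation compl := (compl hE).
Local Notation cycle_path := (cycle_path hE).
Variable D : {set arrow (QE E)}.
Hypothesis cutD : cycle_cut D.

(** The degree of a path for the grading that puts D in degree 1. *)
Definition nD p := count (mem D) (parr p).
Lemma nD_pcat p q : psrc p = ptgt q -> nD (pcat p q) = (nD q + nD p)%N.
Proof. by move=> e; rewrite /nD parr_pcat // count_cat. Qed.
Lemma nD_cycle p : cycle_path p -> nD p = 1%N.
Proof. by case=> e ->; exact: (cut_once cutD e). Qed.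
Lemma nD_compl c p : compl c p -> (nD p + nD c = 1)%N.
Proof. by case=> e1 /nD_cycle <-; rewrite nD_pcat. Qed.
Lemma nD_nil p : nD p <> 0%N -> parr p <> [::].
Proof. by rewrite /nD => h e; apply: h; rewrite e. Qed.

(** The cycle that begins at the arrow in D is determined, and rotating it
    back by i steps gives the two cycles. *)
Lemma cut_share e h i : (i < d e)%N -> Larrow (iter i g e) \in D ->
  Larrow (iter i g e) = Larrow (iter i g h) -> special e = special h.
Proof.
move=> lt eD eqL; have eqs := cut_det cutD eD eqL.
have := congr1 size eqs; rewrite !size_special !fdeg_iter // => deh.
exact: (special_back hE symE (ltnW lt)).
Qed.

Lemma cut_prefix e h n : (n <= d e)%N -> nD (lp e n) <> 0%N ->
  Larrows e n = Larrows h n :> seq (arrow (QE E)) -> special e = special h.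
Proof.
move=> le; have [/hasP[a /mem_Larrows[i ltin ->] aD]|] := boolP (has (mem D) (Larrows e n)).
  move=> _ /Larrows_eqP[_ H]; apply: (@cut_share e h i) => //.
    exact: leq_trans le.
  by apply/Larrow_eq/H.
by rewrite has_count -leqNgt leqn0 => /eqP.
Qed.

(** A path through D lies at one place of one special cycle only. *)
Lemma compl_inj c p q : nD c <> 0%N -> compl c p -> compl c q -> p = q.
Proof.
move=> c0 /(compl_sym symE)/[dup][[sp _]] /complP[e [n [le cE ->]]].
move=> /(compl_sym symE)/[dup][[sq _]] /complP[h [m [lh cE' ->]]].
have nm : n = m.
  by rewrite -(size_Larrows e n) -(size_Larrows h m) -!(parr_lpath hE) -cE -cE'.
subst m; have eqL : Larrows e n = Larrows h n :> seq (arrow (QE E)).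
  by rewrite -!(parr_lpath hE) -cE -cE'.
have eqs : special e = special h by apply: (cut_prefix le); rewrite -?cE.
have deh : d e = d h by have := congr1 size eqs; rewrite !size_special.
apply: qpath_eq; first by rewrite !psrc_lpath -!(ptgt_lpath hE) -cE -cE'.
by rewrite !parr_lpath -!drop_Larrows -?deh // -/(special e) eqs /special deh.
Qed.

(** The nonzero paths of the cut algebra. *)
Definition cut_std p := std hE p /\ nD p = 0%N.

Lemma cut_std_fc : factor_closed cut_std.
Proof.
move=> p i [ps p0]; have [s1 s2] := std_fc i ps.
have /eqP : (nD (ptake i p) + nD (pdrop i p) = 0)%N.
  by rewrite -nD_pcat ?psrc_pdrop // pcat_drop_take.
by rewrite addn_eq0 => /andP[/eqP t0 /eqP d0].
Qed.
Lemma cut_std_vpath v : cut_std (vpath v).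
Proof. by split=> //; exact: std_vpath. Qed.
Lemma std_apath a : std hE (apath a).
Proof.
have [e ->] := Larrow_surj a; exists e, 1%N; split; first exact: fdeg_gt0.
by apply: qpath_eq; rewrite ?psrc_lpath // -(src_Larrow hE).
Qed.
Lemma std_bounded p : std hE p -> (size (parr p) < (\max_(e : angle E) d e).+1)%N.
Proof.
by case=> e [n [le ->]]; rewrite ltnS size_Larrows; apply: leq_trans le _; apply: leq_bigmax.
Qed.

Variable k : fieldType.
Local Notation kQ := (path_alg k (QE E)).
Local Notation J := (ideal_gen (IE E k `|` [set kpath k (apath a) | a in [set` D]])%classic).

Lemma R1_sym e h j : R1_data e h j -> R1_data h e j.
Proof. by case=> P1 je jh tl; split=> // i /tl. Qed.

Lemma R1_tail e h j : R1_data e h j ->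
  lp (iter (d e - j) g e) j = lp (iter (d h - j) g h) j.
Proof.
case=> P1 je jh tl.
have eqL : Larrows (iter (d e - j) g e) j = Larrows (iter (d h - j) g h) j :> seq (arrow (QE E)).
  apply/Larrows_eqP; split=> // i ij.
  have := tl (j - i)%N; rewrite subn_gt0 ij leq_subr => /(_ isT).
  have aux a : (j < a)%N -> (a - (j - i) = i + (a - j))%N.
    by move=> ja; rewrite subnBA ?(ltnW ij) // addnC addnBA // ltnW.
  by rewrite -!iterD !aux.
have [j0|jp] := posnP j; last first.
  by apply: (lpath_parrS hE jp).
by rewrite j0 !subn0 !symE; apply: qpath_eq => //; apply/Pvert_eq.
Qed.

Lemma R1_compl e h j : R1_data e h j -> compl (lp (iter (d e - j) g e) j) (lp e (d e - j)).
Proof.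
by case=> _ je _ _; have := compl_lpath hE (leq_subr j (d e)); rewrite subKn // ltnW.
Qed.

(** A common tail that goes through D determines the special cycles, hence
    also the two sides of the relation. So after cutting, the relation is
    trivial or both of its sides vanish. *)
Lemma R1_cut e h j : R1_data e h j ->
  lp e (d e - j) = lp h (d h - j) \/
  nD (lp e (d e - j)) <> 0%N /\ nD (lp h (d h - j)) <> 0%N.
Proof.
move=> R1; have [P1 je jh _] := R1.
have ce := R1_compl R1; have ch := R1_compl (R1_sym R1); have tE := R1_tail R1.
have [t0|t0] := eqVneq (nD (lp (iter (d e - j) g e) j)) 0%N.
  by right; have := nD_compl ce; have := nD_compl ch; rewrite -tE t0 !addn0 => -> ->.
left; have eqs : special (iter (d e - j) g e) = special (iter (d h - j) g h).
  apply: (cut_prefix (n := j)) => //; [by rewrite fdeg_iter // ltnW|exact/eqP|].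
  by rewrite -!(parr_lpath hE) tE.
have := congr1 size eqs; rewrite !size_special !fdeg_iter // => deh.
have {}eqs : special e = special h.
  by apply: (special_back hE symE (leq_subr j (d e)) deh); rewrite eqs deh.
apply: qpath_eq; first by rewrite !psrc_lpath; apply/Pvert_eq.
rewrite !parr_lpath -(take_Larrows e (leq_subr j (d e))) -(take_Larrows h (leq_subr j (d h))).
by rewrite -/(special e) -/(special h) eqs deh.
Qed.

(** This is why the cut algebra is monomial: all the binomial relations
    disappear, and what is left says which paths vanish. *)
Lemma cut_idealE : J = vanish cut_std.
Proof.
apply/seteqP; split.
  apply: ideal_genS; first exact/vanish_ideal/cut_std_fc.
  move=> x [|[a aD <-]]; last first.
    by apply/vanish_path => -[_]; rewrite /nD /= -[a \in mem D]/(a \in D) aD.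
  apply: ideal_genS; first exact/vanish_ideal/cut_std_fc.
  move=> {}x /(IE_rel_cases hE)[[p ns ->]|[e [h [j [R1 ->]]]]].
    by apply/vanish_path => -[].
  have [->|[n1 n2]] := R1_cut R1; first by rewrite subrr => p _; exact: mcoeff0.
  have NI : is_ideal (vanish cut_std : set kQ) by exact/vanish_ideal/cut_std_fc.
  by apply: (idealB NI); apply/vanish_path => -[].
apply: vanish_sub; first exact: ideal_gen_ideal.
move=> p np; have [ps|ns] := pselect (std hE p); last first.
  by apply: sub_ideal_gen; left; exact: IE_not_std.
have /hasP[a ap aD] : has (mem D) (parr p).
  by rewrite has_count lt0n; apply/eqP => h; apply: np.
have JI := @ideal_gen_ideal k kQ (IE E k `|` [set kpath k (apath a) | a in [set` D]])%classic.
rewrite -(pcat_drop_take (index a (parr p)) p) -kpathM ?psrc_pdrop //.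
apply: (idealMr JI).
set q := pdrop _ p; have qa : parr q = a :: drop 1 (parr q).
  rewrite /q parr_pdrop {1}(drop_nth a) ?index_mem // nth_index //.
  by rewrite drop_drop add1n.
rewrite -(pcat_drop_take 1 q) -kpathM ?psrc_pdrop //; apply: (idealMl JI).
rewrite (path_apath (p := ptake 1 q) (a := a)); last first.
  by rewrite parr_ptake qa /= take0.
by apply: sub_ideal_gen; right; exists a.
Qed.

Lemma cut_ideal_monomial : monomial_ideal J.
Proof.
rewrite cut_idealE; apply: monomial_vanish; first exact: cut_std_fc.
  exact: cut_std_vpath.
by move=> p [ps _]; exact: std_bounded ps.
Qed.
Lemma nz_cut : nz J = cut_std.
Proof. by rewrite cut_idealE nz_vanish. Qed.
End CutPaths.

(** * Algebras with a cut as trivial extensions *)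

Definition cut_ideal (k : fieldType) (E : fbc_data) (D : {set arrow (QE E)}) :
    set (path_alg k (QE E)) :=
  ideal_gen (IE E k `|` [set kpath k (apath a) | a in [set` D]])%classic.

Section CutTrivext.
Variable E : fbc_data.
Local Notation g := (@rotate E).
Local Notation d := (@Defs.fdeg E).
Implicit Types (e h : angle E) (p q c : qpath (QE E)).
Hypotheses (hE : is_fBC E) (symE : fbc_symmetric E).
Local Notation lp := (lpath hE).
Local Notation compl := (compl hE).
Variable D : {set arrow (QE E)}.
Hypothesis cutD : cycle_cut D.
Variable k : fieldType.
Local Notation kQ := (path_alg k (QE E)).
Local Notation J := (@cut_ideal k E D).
Local Notation A := (quo J).
Local Notation L := (quo (IE E k)).
Local Notation tr := (tr hE (k := k)).
Local Notation nD := (nD D).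
Implicit Types (x : A) (y z : kQ).

Let hJ : monomial_ideal J := cut_ideal_monomial hE symE cutD k.
Lemma nzJ p : nz J p <-> std hE p /\ nD p = 0%N.
Proof. by rewrite /cut_ideal (nz_cut hE symE cutD k). Qed.

Fact pairing_form y : is_form (fun x => tr (nform x * y)).
Proof.
by apply/asboolP => a x x'; rewrite (nformD hJ) (nformZ hJ) mulrDl -mulrA trD trZ.
Qed.
(** This linear form vanishes for y in degree 0, and for a standard path y in
    degree 1 it is the dual basis element of the path that y completes. *)
Definition pairing y : dual A := Dual (pairing_form y).
Lemma pairingE y x : pairing y x = tr (nform x * y). Proof. by []. Qed.
(** The first component is the part of degree 0 of y for the grading by D,
    and the second one is the part of degree 1, seen in the dual of the first
    by means of the symmetrizing form. *)
Definition to_trivext y : trivext A := (qpi J y, pairing y).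

(** Used to expand the product of two elements in the trivial extension: all
    its terms are traces of products of three paths. *)
Definition cyc3 p q r := psrc q = ptgt r /\ compl p (pcat q r).

Lemma tr3 (a b c : k) p q r :
  tr (kpathc a p * (kpathc b q * kpathc c r)) = a * b * c *+ `[< cyc3 p q r >].
Proof.
rewrite (kpathcM b c) /path_mul; case: eqP => [e|e]; last first.
  by rewrite mulr0 tr0; case: asboolP => // -[].
rewrite tr_kpathcM mulrA; congr (_ *+ nat_of_bool _).
by apply/asboolP/asboolP => [|[]].
Qed.

Lemma cyc3_rot p q r : cyc3 p q r -> cyc3 r p q.
Proof.
move=> [e h]; have [pq _] := h; rewrite ptgt_pcat // in pq.
have h' := (compl_assoc hE pq e).1 h.
by split=> //; apply: (compl_sym symE).
Qed.

Lemma cyc3_nD p q r : cyc3 p q r -> (nD p + nD q + nD r = 1)%N.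
Proof.
move=> [e h]; rewrite -(nD_compl cutD h) nD_pcat //.
by rewrite addnC addnA addnAC addnC addnA.
Qed.

Lemma cyc3_nz p q r : cyc3 p q r -> nD p = 0%N -> psrc p = ptgt q /\
  (nz J (pcat p q) <-> nD q = 0%N).
Proof.
move=> h p0; have [pq h'] := cyc3_rot h; split=> //.
rewrite nzJ nD_pcat // p0 addn0; split=> [[]//|->]; split=> //.
exact: compl_std h'.
Qed.

Lemma tr_nz a b p q : nz J p -> nz J q -> tr (kpathc a p * kpathc b q) = 0.
Proof.
move=> /nzJ[_ p0] /nzJ[_ q0]; rewrite tr_kpathcM; case: asboolP => // h.
by have := nD_compl cutD h; rewrite p0 q0.
Qed.

Lemma nform_mul a b p q : nform (qpi J (kpathc a p * kpathc b q)) =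
  if `[< psrc p = ptgt q /\ nz J (pcat p q) >] then kpathc a p * kpathc b q else 0.
Proof.
have n0 := nform0 hJ.
rewrite kpathcM /path_mul; case: eqP => [e|e]; last first.
  by rewrite (amor0 (qpi_mor J)) n0 if_same.
case: asboolP => [[_ N]|N]; first by rewrite nform_path.
by rewrite (qpi_zero_path hJ) // => N'; apply: N.
Qed.

(** If the product of three paths p, q, r is a special cycle and p is in
    degree 0, then exactly one of q and r is in degree 1. Accordingly exactly
    one of the products p q and r p survives in the cut algebra, and exactly
    one of the two terms of the right-hand side is equal to the left-hand
    side. *)
Lemma pairingM x y z : tr (nform x * (y * z)) =
  tr (nform (x * qpi J y) * z) + tr (nform (qpi J z * x) * y).
Proof.
elim/(quo_kpath_ind hJ): x => [|x x' IH IH'|a p Np].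
- have n0 := nform0 hJ.
  by rewrite mul0r mulr0 n0 !mul0r tr0 addr0.
- by rewrite [in RHS]mulrDl [in RHS]mulrDr !(nformD hJ) !mulrDl !trD IH IH' addrACA.
elim/kQ_ind: y => [|y y' IH IH'|b q].
- have n0 := nform0 hJ.
  by rewrite mul0r (amor0 (qpi_mor J)) !mulr0 n0 mul0r tr0 addr0.
- rewrite [in LHS]mulrDl (amorD (qpi_mor J)) !mulrDr (nformD hJ) mulrDl !trD IH IH'.
  by rewrite addrACA.
elim/kQ_ind: z => [|z z' IH IH'|c r].
- have n0 := nform0 hJ.
  by rewrite mulr0 (amor0 (qpi_mor J)) mul0r !mulr0 n0 mul0r tr0 addr0.
- rewrite [in LHS]mulrDr (amorD (qpi_mor J)) !mulrDr mulrDl (nformD hJ) mulrDl !trD IH IH'.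
  by rewrite addrACA.
rewrite -!qpi_mul nform_path // !nform_mul tr3.
have p0 : nD p = 0%N by have /nzJ[] := Np.
have [h3|h3] := asboolP (cyc3 p q r); last first.
  have z1 : tr (kpathc a p * kpathc b q * kpathc c r) = 0.
    by rewrite -mulrA tr3; case: asboolP => // /h3.
  have z2 : tr (kpathc c r * kpathc a p * kpathc b q) = 0.
    by rewrite -mulrA tr3; case: asboolP => // /cyc3_rot/cyc3_rot.
  by rewrite mulr0n; case: ifP => _; case: ifP => _; rewrite ?z1 ?z2 ?mul0r ?tr0 ?addr0.
have [pq N1] := cyc3_nz h3 p0; have h3' := cyc3_rot h3.
have [rp h4] := cyc3_rot h3'.
have N2 : nz J (pcat r p) <-> nD r = 0%N.
  by rewrite nzJ nD_pcat // p0 add0n; split=> [[]//|->]; split=> //; exact: compl_std h4.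
have rot : tr (kpathc c r * kpathc a p * kpathc b q) = a * b * c.
  by rewrite -mulrA tr3 asboolT // mulr1n [c * a]mulrC mulrAC.
have := cyc3_nD h3; rewrite p0 add0n mulr1n => sum.
case q0 : (nD q) N1 sum => [|n] N1 sum.
  rewrite asboolT; last by split=> //; apply/N1.
  rewrite asboolF; last by case=> _ /N2 r0; rewrite r0 in sum.
  by rewrite mul0r tr0 addr0 -[in RHS]mulrA tr3 asboolT.
have r0 : nD r = 0%N by case: (nD r) sum => // m; rewrite addnS addSn.
rewrite asboolF; last by case=> _ /N1.
by rewrite mul0r tr0 add0r asboolT ?rot //; split=> //; apply/N2.
Qed.

Lemma pairing0 y : (forall (a : k) p, nz J p -> tr (kpathc a p * y) = 0) -> pairing y = 0.
Proof.
move=> H; apply: dual_eq => x; rewrite pairingE /nform mulr_suml.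
have -> : (0 : dual A) x = 0 by [].
rewrite big_seq_cond; elim/big_ind: _ => [|u v|p]; first exact: tr0.
  by rewrite trD => -> ->; rewrite addr0.
by rewrite andbT => /(nzsetP hJ) Np; apply: H.
Qed.

Lemma pairing_nz (a : k) p : nz J p -> pairing (kpathc a p) = 0.
Proof. by move=> Np; apply: pairing0 => c' p' Np'; exact: tr_nz. Qed.

Lemma to_trivextB y z : to_trivext (y - z) = to_trivext y - to_trivext z.
Proof.
congr (_, _); first exact: qpiB.
apply: dual_eq => x; rewrite pairingE mulrBr.
have -> : forall u v, tr (u - v) = tr u - tr v.
  by move=> u v; apply: (addIr (tr v)); rewrite -trD !subrK.
by [].
Qed.

Lemma to_trivext_mor : is_alg_mor to_trivext.
Proof.
have Pa a : to_trivext (algmap a) = algmap a.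
  congr (_, _); apply: dual_eq => x; rewrite pairingE -algmapC trZ.
  have -> : tr (nform x) = 0; last by rewrite mulr0.
  have -> : nform x = nform x * 1 by rewrite mulr1.
  rewrite -pairingE (_ : pairing 1 = 0) //; apply: pairing0 => c p Np.
  rewrite mulr1 tr_kpathc; case: cyclesP => // h.
  by have := nD_cycle cutD h; have [_ ->] := (nzJ p).1 Np.
split=> //; first exact: to_trivextB.
split=> [|y z].
  by have := Pa 1; rewrite [algmap 1](algmap_monoid.1) [algmap 1](algmap_monoid.1).
congr (_, _); first exact: qpi_mul.
by apply: dual_eq => x; exact: pairingM.
Qed.

(** The trace is compatible with IE_R1: for a path in degree 1, the
    complement is unique, so it has to be the common tail, which completes
    the other side of the relation as well. *)
Lemma to_trivext_IE y : IE E k y -> to_trivext y = 0.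
Proof.
move=> Iy; apply: (ideal_genS (ker_ideal to_trivext_mor) _ Iy) => {Iy}y Ry /=.
have Jy : J y by apply: sub_ideal_gen; left; exact: sub_ideal_gen.
congr (_, _); first by apply/qpi0.
apply: pairing0 => c q Nq.
have [[p ns ->]|[e [h [j [R1 ->]]]]] := IE_rel_cases hE Ry.
  rewrite tr_kpathcM; case: asboolP => // h.
  by case: ns; exact: compl_std h.
have trE p : tr (kpathc c q * kpath k p) = c *+ `[< compl q p >].
  by rewrite tr_kpathcM mulr1.
have [->|[n1 n2]] := R1_cut hE symE cutD R1; first by rewrite subrr mulr0 tr0.
have H e1 h1 : R1_data e1 h1 j -> nD (lp e1 (d e1 - j)) <> 0%N ->
    compl q (lp e1 (d e1 - j)) -> compl q (lp h1 (d h1 - j)).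
  move=> R1' n0 h0; have c1 := R1_compl hE R1'.
  have -> := compl_inj symE cutD n0 (compl_sym symE h0) (compl_sym symE c1).
  by rewrite (R1_tail hE symE R1'); exact: (R1_compl hE (R1_sym R1')).
rewrite mulrBr; have trB u v : tr (u - v) = tr u - tr v.
  by apply: (addIr (tr v)); rewrite -trD !subrK.
rewrite trB !trE; apply/eqP; rewrite subr_eq0; apply/eqP; congr (_ *+ nat_of_bool _).
by apply/asboolP/asboolP; apply: H => //; exact: R1_sym.
Qed.

Lemma star_ex p : exists c, nz J p -> compl c p.
Proof.
have [Np|nN] := pselect (nz J p); last by exists p.
by have [c h] := std_compl ((nzJ p).1 Np).1; exists c.
Qed.
(** A chosen complement of each nonzero path, the candidate for its dual
    basis element. *)
Definition star p := projT1 (cid (star_ex p)).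
Lemma starP p : nz J p -> compl (star p) p.
Proof. exact: (projT2 (cid (star_ex p))). Qed.
Lemma nz_nD p : nz J p -> nD p = 0%N. Proof. by move=> /nzJ[]. Qed.
Lemma compl_nD c p : nz J p -> compl c p -> nD c = 1%N.
Proof. by move=> /nz_nD p0 /(nD_compl cutD); rewrite p0. Qed.

Lemma dual_ext (f h : dual A) :
  (forall p, nz J p -> f (qpi J (kpath k p)) = h (qpi J (kpath k p))) -> f = h.
Proof.
move=> fh; apply: dual_eq => x; elim/(quo_kpath_ind hJ): x => [|x y IH IH'|a p Np].
- by rewrite !dual0.
- by rewrite !dual_add IH IH'.
have E1 (u : dual A) : u (qpi J (kpathc a p)) = a * u (qpi J (kpath k p)).
  rewrite kpathcE qpi_mul (amorZ (qpi_mor J)) -[X in u X]addr0 dual_form.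
  by rewrite dual0 addr0.
by rewrite !E1 fh.
Qed.

Lemma pairing_compl (a : k) c p q : nz J p -> nz J q -> compl c p ->
  pairing (kpathc a c) (qpi J (kpath k q)) = a *+ (q == p).
Proof.
move=> Np Nq cp; rewrite pairingE nform_path // tr_kpathcM mul1r.
congr (_ *+ nat_of_bool _); apply/asboolP/eqP => [h|->]; last exact: (compl_sym symE).
apply: (compl_inj symE cutD _ (compl_sym symE h) cp).
by rewrite (compl_nD Np cp).
Qed.

(** The candidate for the inverse of the isomorphism: normal forms on the
    first component, and complements instead of dual basis elements on the
    second one. *)
Definition of_trivext (u : trivext A) : L := qpi (IE E k) (nform u.1) +
  \sum_(p <- nzset J) qpi (IE E k) (kpathc (u.2 (qpi J (kpath k p))) (star p)).

Lemma of_trivextE x f : of_trivext (x, f) = qpi (IE E k) (nform x) +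
  \sum_(p <- nzset J) qpi (IE E k) (kpathc (f (qpi J (kpath k p))) (star p)).
Proof. by []. Qed.

Lemma of_trivextD : {morph of_trivext : u v / u + v}.
Proof.
move=> u v; rewrite /of_trivext (nformD hJ) (amorD (qpi_mor _)) addrACA; congr (_ + _).
rewrite -big_split; apply: eq_bigr => p _ /=.
by rewrite -(amorD (qpi_mor _)) -kpathcD.
Qed.

Definition cut_map : L -> trivext A := qlift to_trivext.
Lemma cut_mapE y : cut_map (qpi (IE E k) y) = to_trivext y.
Proof. exact: (qliftE to_trivext_mor to_trivext_IE). Qed.
Lemma cut_map_mor : is_alg_mor cut_map.
Proof. exact: (qlift_mor to_trivext_mor to_trivext_IE). Qed.

Lemma qpi_D (a : k) c : nD c <> 0%N -> qpi J (kpathc a c) = 0.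
Proof. by move=> n0; apply: (qpi_zero_path hJ) => /nz_nD. Qed.

Lemma dual_sum I (r : seq I) (P : pred I) (F : I -> dual A) x :
  (\sum_(i <- r | P i) F i : dual A) x = \sum_(i <- r | P i) F i x.
Proof. by elim/big_rec2: _ => // i u v _ <-. Qed.

Lemma of_trivextK : cancel of_trivext cut_map.
Proof.
case=> x f; rewrite /of_trivext (amorD cut_map_mor) cut_mapE (amor_sum cut_map_mor) /=.
have -> : to_trivext (nform x) = (x, 0).
  congr (_, _); first exact: nformK.
  by apply: pairing0 => a p Np; rewrite trC // -pairingE pairing_nz.
pose P p : dual A := pairing (kpathc (f (qpi J (kpath k p))) (star p)).
have -> : \sum_(p <- nzset J) cut_map (qpi (IE E k) (kpathc (f (qpi J (kpath k p))) (star p)))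
    = (0, \sum_(p <- nzset J) P p).
  rewrite big_seq [in RHS]big_seq; elim/big_rec2: _ => // p u v /(nzsetP hJ) Np ->.
  rewrite cut_mapE /to_trivext qpi_D; last by rewrite (compl_nD Np (starP Np)).
  by congr (_, _); rewrite /= ?addr0.
congr (_, _) => /=; first by rewrite addr0.
rewrite add0r; apply: dual_ext => q Nq.
have PE p : nz J p -> P p (qpi J (kpath k q)) = f (qpi J (kpath k p)) *+ (q == p).
  by move=> Np; exact: (pairing_compl _ Np Nq (starP Np)).
rewrite dual_sum (big_fsetD1 q) /=; last exact/(nzsetP hJ).
rewrite -[X in X + _]/(P q (qpi J (kpath k q))) PE // eqxx big1_seq ?addr0 // => p.
rewrite !inE => /andP[_ /andP[pq /(nzsetP hJ) Np]].
by rewrite -[LHS]/(P p (qpi J (kpath k q))) PE // eq_sym (negPf pq).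
Qed.

Lemma of_trivext0 : of_trivext 0 = 0.
Proof. by apply: (addrI (of_trivext 0)); rewrite -of_trivextD !addr0. Qed.

(** A standard path in degree 0 is a nonzero path of the cut algebra. One in
    degree 1 has a complement q in degree 0, and it is identified by IE_R1
    with the chosen complement of q. *)
Lemma cut_mapK : cancel cut_map of_trivext.
Proof.
elim/quo_ind => y; rewrite cut_mapE; elim/kQ_ind: y => [|y z IH IH'|a p].
- by rewrite (amor0 to_trivext_mor) (amor0 (qpi_mor _)) of_trivext0.
- by rewrite (amorD to_trivext_mor) (amorD (qpi_mor _)) of_trivextD IH IH'.
have [ps|ns] := pselect (std hE p); last first.
  have I0 : IE E k (kpathc a p).
    by rewrite kpathcE; apply: (idealMl (ideal_gen_ideal _)); exact: IE_not_std.
  rewrite (to_trivext_IE I0) of_trivext0; apply/esym/qpi_eq0.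
  by rewrite ideal_genid //; exact: ideal_gen_ideal.
have [p0|/eqP p0] := eqVneq (nD p) 0%N.
  have Np : nz J p by apply/nzJ.
  rewrite /to_trivext pairing_nz // of_trivextE (nform_path hJ) // big1 ?addr0 // => q _.
  by rewrite dual_zero kpathc0 (amor0 (qpi_mor _)).
have [q qp] := std_compl ps; have sum := nD_compl cutD qp.
have q0 : nD q = 0%N by case: (nD p) p0 sum => // n _ /eqP; rewrite addSn eqSS addn_eq0 => /andP[_ /eqP].
have Nq : nz J q by apply/nzJ; split=> //; exact: (compl_std (compl_sym symE qp)).
have pq := compl_sym symE qp.
rewrite /to_trivext qpi_D // of_trivextE (nform0 hJ) (amor0 (qpi_mor _)) add0r.
rewrite (big_fsetD1 q); last exact/(nzsetP hJ).
rewrite (pairing_compl _ Nq Nq pq) eqxx mulr1n big1_seq ?addr0 => [|r]; last first.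
  rewrite !inE => /andP[_ /andP[rq /(nzsetP hJ) Nr]].
  rewrite (pairing_compl _ Nq Nr pq) (negPf rq) mulr0n kpathc0.
  exact: (amor0 (qpi_mor _)).
rewrite [LHS]addr0; apply/qpi_eq; rewrite ideal_genid; last exact: ideal_gen_ideal.
rewrite [kpathc a (star q)]kpathcE [kpathc a p]kpathcE -mulrBr.
apply: (idealMl (ideal_gen_ideal _)); apply: (compl_R1 symE (starP Nq) pq).
  by apply: (@nD_nil _ D); rewrite (compl_nD Nq (starP Nq)).
exact: nD_nil p0.
Qed.

Lemma cut_map_iso : is_alg_iso cut_map.
Proof. by apply: mor_iso; [exact: cut_map_mor|exists of_trivext; [exact: cut_mapK|exact: of_trivextK]]. Qed.

Lemma cut_map_nz p : nz J p -> cut_map (qpi (IE E k) (kpath k p)) = (qpi J (kpath k p), 0).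
Proof. by move=> Np; rewrite cut_mapE /to_trivext pairing_nz. Qed.

Lemma apath_nD b : nD (apath b) = (b \in D).
Proof. by rewrite /nD /= addn0. Qed.

Lemma cut_map_compl c m : nz J m -> compl c m ->
  (cut_map (qpi (IE E k) (kpath k c))).1 = 0 /\
  is_dual_basis_elt m (cut_map (qpi (IE E k) (kpath k c))).2.
Proof.
move=> Nm cm; rewrite cut_mapE; split=> [|q Nq] /=.
  by rewrite qpi_D // (compl_nD Nm cm).
exact: (pairing_compl 1 Nm Nq cm).
Qed.

(** If the complement of m has at least two arrows, then the first or the
    last one is not in D, because the complement goes through D only once;
    this arrow extends m to a path in degree 0. *)
Lemma maximal_compl m : maximal_path J m -> exists2 a, a \in D & compl (apath a) m.
Proof.
move=> /(maximal_pathP hJ)[Nm m1 m2]; have h := starP Nm; set c := star m in h.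
have c1 := compl_nD Nm h; have m0 := nz_nD Nm; have [cm _] := h.
have c0 : (0 < size (parr c))%N by rewrite lt0n size_eq0; apply/eqP/(@nD_nil _ D); rewrite c1.
have [s1|sn] := eqVneq (size (parr c)) 1%N.
  have [a ca] := size1_apath s1; rewrite ca apath_nD in c1 h.
  by exists a => //; case: (a \in D) c1.
exfalso; pose u := ptake 1 c; pose v := pdrop 1 c.
have vu : psrc v = ptgt u by exact: psrc_pdrop.
have cE : c = pcat v u by rewrite pcat_drop_take.
have [b ub] : exists b, u = apath b by apply: size1_apath; rewrite parr_ptake size_takel.
have um : psrc u = ptgt m by rewrite psrc_ptake.
have su : (nD u + nD v = 1)%N by rewrite -nD_pcat // -cE.
have [u0|u0] := eqVneq (nD u) 0%N.
  have h' : compl v (pcat u m) by apply/compl_assoc => //; rewrite -cE.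
  apply: (m1 b); first by rewrite -um ub.
  by apply/nzJ; rewrite -ub nD_pcat // m0 u0; split=> //; exact: compl_std h'.
have v0 : nD v = 0%N by case: (nD u) u0 su => // n _ /eqP; rewrite addSn eqSS addn_eq0 => /andP[_ /eqP].
pose w := ptake (size (parr v)).-1 v; pose l := pdrop (size (parr v)).-1 v.
have lw : psrc l = ptgt w by exact: psrc_pdrop.
have vE : v = pcat l w by rewrite pcat_drop_take.
have szv : (0 < size (parr v))%N.
  by rewrite parr_pdrop size_drop subn_gt0 ltn_neqAle eq_sym sn c0.
have [b' lb] : exists b, l = apath b.
  by apply: size1_apath; rewrite parr_pdrop size_drop -{1}(prednK szv) subSnn.
have wu : psrc w = ptgt u by rewrite psrc_ptake.
have l0 : nD l = 0%N by move: v0; rewrite vE nD_pcat // => /eqP; rewrite addn_eq0 => /andP[_ /eqP].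
have cE' : c = pcat l (pcat w u) by rewrite pcatA // -vE.
have wum : psrc (pcat w u) = ptgt m by rewrite psrc_pcat.
have lwu : psrc l = ptgt (pcat w u) by rewrite ptgt_pcat.
have h3 : cyc3 l (pcat w u) m.
  by split=> //; apply/compl_assoc => //; rewrite -cE'.
have [ml h4] := cyc3_rot h3.
have h5 := compl_sym symE h4; have [h6 _] := h5.
have [ml' h7] := cyc3_rot (cyc3_rot h3).
apply: (m2 b'); first by rewrite ml' lb.
apply/nzJ; rewrite -lb nD_pcat // l0 m0; split=> //.
exact: compl_std h7.
Qed.
End CutTrivext.

Section CutMaximal.
Variable E : fbc_data.
Local Notation g := (@rotate E).
Local Notation d := (@Defs.fdeg E).
Hypotheses (hE : is_fBC E) (symE : fbc_symmetric E).
Local Notation compl := (compl hE).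
Variable D : {set arrow (QE E)}.
Hypothesis cutD : cycle_cut D.
Variable k : fieldType.
Hypothesis adm : admissible_ideal (IE E k).
Local Notation J := (@cut_ideal k E D).

Let hJ : monomial_ideal J := cut_ideal_monomial hE symE cutD k.

(** By IE_R1 the arrow would be equal to c modulo the ideal, which lies in
    the square of the arrow ideal. *)
Lemma compl_arrow_long a c m : compl (apath a) m -> compl c m ->
  (1 < size (parr c))%N -> False.
Proof.
move=> am cm c2; have cn : parr c <> [::] by case: (parr c) c2.
have an : parr (apath a) <> [::] by [].
have I := @compl_R1 _ hE symE k _ _ _ am cm an cn.
have [_ sub _] := adm; have := sub _ I; rewrite ideal_powE => /(_ (apath a) isT).
rewrite mcoeffB !mcoeff_kpathc eqxx; case: eqP => [e|_ /eqP].
  by rewrite e in c2.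
by rewrite subr0 oner_eq0.
Qed.

(** An extension of m by an arrow b would have a complement s, and then s b
    or b s would be a complement of m of length at least 2, next to the arrow
    a. *)
Lemma compl_maximal a m : a \in D -> compl (apath a) m -> maximal_path J m.
Proof.
move=> aD am; have nDm := nD_compl cutD am; rewrite apath_nD aD addn1 in nDm.
have Nm : nz J m.
  by apply/(nzJ hE symE cutD); split; [exact: compl_std am|case: nDm].
have long w : nz J w -> exists2 s, compl s w & (0 < size (parr s))%N.
  move=> /(nzJ hE symE cutD)[ws w0]; have [s sw] := std_compl ws; exists s => //.
  have := nD_compl cutD sw; rewrite w0 add0n => s1; rewrite lt0n size_eq0.
  by apply/eqP/(@nD_nil _ D); rewrite s1.
apply/(maximal_pathP hJ); split=> // b bm Nw; have [s sw s0] := long _ Nw.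
  have [sb _] := sw; rewrite ptgt_pcat // in sb.
  have h := (compl_assoc hE sb bm).1 sw.
  by apply: (compl_arrow_long am h); rewrite parr_pcat.
have h3 : cyc3 hE s m (apath b) by split.
have [sm h4] := cyc3_rot symE h3; have [bs _] := h4; rewrite ptgt_pcat // in bs.
have h := (compl_assoc hE bs sm).1 h4.
apply: (compl_arrow_long am h); rewrite parr_pcat // size_cat.
by rewrite -[size (parr (apath b))]/1%N addn1 ltnS.
Qed.

Lemma arrow_compl (a : arrow (QE E)) : exists m, compl (apath a) m.
Proof.
have [e ->] := Larrow_surj a; have d0 := fdeg_gt0 hE e.
exists (lpath hE (iter 1 g e) (d e - 1)); apply: (compl_sym symE).
suff <- : lpath hE e 1 = apath (Larrow e : arrow (QE E)) by exact: compl_lpath.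
exact: path_apath.
Qed.

Lemma cut_map_image :
  (@cut_map E hE symE D cutD k @` [set qpi (IE E k) (kpath k (apath a)) | a in [set` D]] =
   dual_maximal J)%classic.
Proof.
apply/seteqP; split=> [_ [_ [a aD <-] <-]|[x f] [/= x0 [m mm fm]]].
  have [m am] := arrow_compl a; have mm := compl_maximal aD am.
  have Nm : nz J m by case/(maximal_pathP hJ): mm.
  by have [h1 h2] := cut_map_compl symE cutD Nm am; split=> //; exists m.
have Nm : nz J m by case/(maximal_pathP hJ): mm.
have [a aD am] := maximal_compl hE symE cutD mm.
exists (qpi (IE E k) (kpath k (apath a))); first by exists a.
have [h1 h2] := cut_map_compl symE cutD Nm am.
rewrite [LHS]surjective_pairing h1 x0; congr (_, _).
by apply: (dual_ext hE symE cutD) => p Np; rewrite h2 // fm.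
Qed.
End CutMaximal.

(** The arrows of D are the complements of the maximal paths, so the
    isomorphism with the trivial extension sends them to the dual basis
    elements of these. *)
Theorem cut_pair_trivext (k : fieldType) (E : fbc_data) (D : {set arrow (QE E)}) :
  is_fBC E -> fbc_symmetric E -> cycle_cut D -> admissible_ideal (IE E k) ->
  pair_class (cut_pair k D) =
  pair_class (@AlgPair k (trivext (quo (@cut_ideal k E D))) (dual_maximal _)).
Proof.
move=> hE symE cutD adm.
apply: (@pair_classE k (cut_pair k D) (AlgPair _) (@cut_map E hE symE D cutD k)).
  exact: cut_map_iso.
exact: cut_map_image.
Qed.

(** * Type S and admissibility *)

Section CutTypeS.
Variable E : fbc_data.
Local Notation g := (@rotate E).
Local Notation d := (@Defs.fdeg E).
Implicit Types (u w : angle E * nat).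
Hypotheses (hE : is_fBC E) (symE : fbc_symmetric E).
Local Notation compl := (compl hE).
Local Notation path_of w := (lpath hE w.1 w.2).

Lemma Lseq_Larrows (e : angle E) n : Lseq e n = map val (Larrows e n).
Proof. by rewrite -map_comp. Qed.

Lemma Lstd_lpath u w : Lstd u = Lstd w <-> path_of u = path_of w.
Proof.
case: u w => [e n] [h m]; split=> [[P1]|eqp].
  rewrite !Lseq_Larrows => /(inj_map val_inj) eqL.
  by apply: qpath_eq => //; apply/Pvert_eq.
congr (_, _); first by apply/Pvert_eq; exact: (congr1 (@psrc _) eqp).
by rewrite !Lseq_Larrows; congr (map _ _); exact: (congr1 (@parr _) eqp).
Qed.

(** Going back by d(e) - n steps amounts to going forward by n steps, because
    d(e) steps bring e back to itself. *)
Lemma rcomplE w : standard w -> rcompl w = lcompl w.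
Proof.
case: w => e n; rewrite /standard /= => le; congr (_, _) => /=.
apply: (@perm_inj _ (g ^+ (d e - n))%g).
by rewrite -[in LHS]permX -permM expgVn mulVg perm1 permX iter_back.
Qed.
Lemma lcompl_standard w : standard w -> standard (lcompl w).
Proof. by case: w => e n; rewrite /standard /= => le; rewrite fdeg_iter // leq_subr. Qed.
Lemma lcompl_compl w : standard w -> compl (path_of (lcompl w)) (path_of w).
Proof. by case: w => e n; exact: compl_lpath. Qed.

Variable D : {set arrow (QE E)}.
Hypothesis cutD : cycle_cut D.

(** Of a path p and a complement of p, exactly one goes through D, and this
    one determines the other by compl_inj. If it is p, then the complements
    of p and q are the same path. If it is the complement, then the two
    closures consist of the sequences whose path is that of p. *)
Lemma cycle_cut_type_S : type_S E.
Proof.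
suff H p q : standard p -> standard q -> Lstd p = Lstd q ->
    (std_closure (@rcompl E @` std_closure [set lcompl p]) `<=`
     std_closure (@rcompl E @` std_closure [set lcompl q]))%classic.
  by move=> p q sp sq pq; apply/seteqP; split; apply: H.
move=> sp sq /Lstd_lpath pq r [sr [_ [w [sw [_ -> /Lstd_lpath wp]] <-]]].
rewrite rcomplE // => /Lstd_lpath rw.
have c1 := lcompl_compl sp; have c2 := lcompl_compl sq; have cw := lcompl_compl sw.
split=> //; have [n0|/eqP n0] := eqVneq (nD D (path_of p)) 0%N; last first.
  exists (lcompl w); last exact/Lstd_lpath.
  exists w; last exact: rcomplE.
  split=> //; exists (lcompl q) => //; apply/Lstd_lpath; rewrite wp.
  rewrite -pq in c2.
  exact: (compl_inj symE cutD n0 (compl_sym symE c1) (compl_sym symE c2)).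
have sq' := lcompl_standard sq; have c3 := lcompl_compl sq'.
exists (lcompl (lcompl q)).
  exists (lcompl q); last exact: rcomplE.
  by split=> //; exists (lcompl q).
apply/Lstd_lpath; rewrite rw; rewrite wp in cw; rewrite -pq in c2.
have nz1 : nD D (path_of (lcompl p)) <> 0%N.
  by have := nD_compl cutD c1; rewrite n0 add0n => ->.
have nz2 : nD D (path_of (lcompl q)) <> 0%N.
  by have := nD_compl cutD c2; rewrite n0 add0n => ->.
rewrite (compl_inj symE cutD nz1 (compl_sym symE cw) c1).
exact: (compl_inj symE cutD nz2 c2 (compl_sym symE c3)).
Qed.

Variable k : fieldType.

(** The zero relations are paths of length at least 2, as arrows are
    standard, and IE_R1 gives a difference of two such paths unless one side
    is an arrow. *)
Lemma IE_admissible :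
  (forall e h j, R1_data e h j -> (d e - j = 1)%N ->
     lpath hE e (d e - j) = lpath hE h (d h - j)) ->
  admissible_ideal (IE E k).
Proof.
move=> H; have II : is_ideal (IE E k) by exact: ideal_gen_ideal.
split=> //.
  rewrite ideal_powE; apply: ideal_genS; first exact/vanish_ideal/shorter_fc.
  have VI : is_ideal (vanish (shorter 2) : set (path_alg k (QE E))).
    exact/vanish_ideal/shorter_fc.
  move=> x /(IE_rel_cases hE)[[p ns ->]|[e [h [j [R1 ->]]]]].
    apply/vanish_path => p2; apply: ns; move: p2; rewrite /shorter.
    case ep: (parr p) => [|a [|]] // _; first by rewrite (path_nil ep); exact: std_vpath.
    by rewrite (path_apath ep); exact: std_apath.
  have [_ je jh _] := R1; have [e1|e1] := eqVneq (d e - j)%N 1%N.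
    by rewrite (H _ _ _ R1 e1) subrr => p _; exact: mcoeff0.
  have [h1|h1] := eqVneq (d h - j)%N 1%N.
    by rewrite (H _ _ _ (R1_sym R1) h1) subrr => p _; exact: mcoeff0.
  have ge2 f (e0 : angle E) : (j < d e0)%N -> (d e0 - j != 1)%N -> f = lpath hE e0 (d e0 - j) ->
      vanish (shorter 2) (kpath k f).
    move=> j0 n1 ->; apply/vanish_path; rewrite /shorter parr_lpath size_Larrows ltnS.
    by rewrite leq_eqVlt (negPf n1) ltnS leqn0 subn_eq0 leqNgt j0.
  by apply: (idealB VI); [exact: (ge2 _ e)|exact: (ge2 _ h)].
exists (\max_(e : angle E) d e).+1; rewrite ideal_powE; apply: vanish_sub => // p np.
by apply: IE_not_std => ps; apply: np; exact: std_bounded ps.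
Qed.
End CutTypeS.

(** * The configuration of a monomial algebra *)

Lemma pblock_preim (T : finType) (rT : eqType) (f : T -> rT) x y :
  finset.pblock (preim_partition f [set: T]) x = finset.pblock (preim_partition f [set: T]) y
  <-> f x = f y.
Proof.
pose P := preim_partition f [set: T].
have blk z t : (t \in finset.pblock P z) = (f z == f t).
  apply: (pblock_equivalence_partition (R := [rel u v | f u == f v])); rewrite ?finset.inE //.
  by move=> u v w _ _ _; split=> //= /eqP ->.
split=> [eqB|eqf]; first by apply/eqP; rewrite -blk eqB blk.
by apply/setP => z; rewrite !blk eqf.
Qed.

(** The classes of R are the nonempty fibres of f. *)
Lemma card_equivalence_partition (T rT : finType) (R : rel T) (f : T -> rT) :
  (forall x y, R x y = (f x == f y)) ->
  #|equivalence_partition R [set: T]| = #|f @: [set: T]|.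
Proof.
move=> Rf; pose h a := [set y | a == f y].
have -> : equivalence_partition R [set: T] = h @: (f @: [set: T]).
  rewrite -imset_comp; apply: eq_imset => x /=.
  by apply/setP => y; rewrite !finset.inE Rf.
apply: card_in_imset => a b /finset.imsetP[x _ ->] /finset.imsetP[y _ ->] /setP/(_ y).
by rewrite !finset.inE eqxx => /eqP.
Qed.

Lemma modn_top j i s : (j <= s)%N -> (i <= s)%N ->
  ((j + i) %% s.+1 == s)%N = (i == s - j)%N.
Proof.
move=> js si; have [lt|gt] := leqP (j + i) s.
  by rewrite modn_small ?ltnS //; apply/eqP/eqP; lia.
have -> : ((j + i) %% s.+1 = j + i - s.+1)%N.
  by rewrite -{1}(subnK gt) modnDr modn_small //; lia.
by apply/eqP/eqP; lia.
Qed.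

Section MonomialConfiguration.
Variables (k : fieldType) (Q : quiver) (J : set (path_alg k Q)).
Hypothesis hJ : monomial_ideal J.
Local Notation E := (EA J).
Local Notation M := (maximal_paths J).
Local Notation g := (@rotate E).
Local Notation d := (@Defs.fdeg E).
Local Notation len m := (size (parr (val m))).
Implicit Types (m : M) (x y : angle E).

(** For i at most the length of m, the angle at the vertex of position i. *)
Definition ang m (i : nat) : angle E := Tagged _ (inord i : 'I_(len m).+1).

Lemma tagged_ang m i : (i <= len m)%N -> tagged (ang m i) = i :> nat.
Proof. by move=> le; rewrite /= inordK. Qed.
Lemma angE x : x = ang (tag x) (tagged x).
Proof. by case: x => m i; rewrite /ang /= inord_val. Qed.
Lemma ang_le x : (tagged x <= len (tag x))%N.
Proof. by rewrite -ltnS. Qed.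

Lemma maximalP m : maximal_path J (val m).
Proof. by apply/asboolP; rewrite -(in_maximal_paths hJ); exact: valP. Qed.
Lemma maximal_nz m : nz J (val m).
Proof. by case/(maximal_pathP hJ): (maximalP m). Qed.

Lemma EA_degE x : d x = (len (tag x)).+1. Proof. by []. Qed.
Lemma EA_iter n m i : (i <= len m)%N -> iter n g (ang m i) = ang m ((i + n) %% (len m).+1).
Proof.
move=> le; elim: n => [|n IH]; first by rewrite addn0 modn_small.
rewrite iterS IH permE /EA_rot /ang; congr (Tagged _ _).
apply: val_inj; rewrite /= !inordK ?ltn_mod //.
by rewrite -addn1 modnDml addn1 addnS.
Qed.
Lemma EA_iter_small n m i : (i + n <= len m)%N -> iter n g (ang m i) = ang m (i + n).
Proof.
by move=> le; rewrite EA_iter ?modn_small //; apply: leq_trans le; exact: leq_addr.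
Qed.
Lemma EA_iterx n x :
  iter n g x = ang (tag x) ((tagged x + n) %% (len (tag x)).+1).
Proof. by rewrite {1}[x]angE EA_iter // ang_le. Qed.
Lemma EA_tag_iter n x : tag (iter n g x) = tag x.
Proof. by rewrite [x in LHS]angE EA_iter // ang_le. Qed.
Lemma EA_sym : fbc_symmetric E.
Proof.
move=> x; rewrite [x in RHS]angE [x in LHS]angE EA_degE EA_iter ?ang_le //.
by rewrite modnDr modn_small // ltnS ang_le.
Qed.

Lemma EA_PclP x y : Pcl x = Pcl y <-> EA_vertex x = EA_vertex y.
Proof. exact: pblock_preim. Qed.
Lemma EA_LclP x y : Lcl x = Lcl y <-> EA_label x = EA_label y.
Proof. exact: pblock_preim. Qed.

Lemma EA_vertexE m i : (i <= len m)%N -> EA_vertex (ang m i) = ptgt (ptake i (val m)).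
Proof.
move=> le; rewrite /EA_vertex tagged_ang // /ptgt psrc_ptake parr_ptake.
rewrite map_take (last_nth (psrc (val m))) size_takel ?size_map //.
by case: i le => // i le /=; rewrite nth_take.
Qed.
Lemma EA_label_lt m i a : (i < len m)%N -> EA_label (ang m i) = inl (nth a (parr (val m)) i).
Proof.
move=> lt; have := onthTE (parr (val m)) i; rewrite lt /EA_label tagged_ang ?(ltnW lt) //=.
by case e : (onth _ _) => [b|] // _; congr inl; apply/esym; exact: onth_nth.
Qed.
Lemma EA_label_max m : EA_label (ang m (len m)) = inr (ang m (len m)).
Proof. by rewrite /EA_label tagged_ang // onth_default. Qed.
Lemma EA_label_inr x y : EA_label x = inr y -> x = y.
Proof. by rewrite /EA_label; case: (onth _ _) => // -[]. Qed.
Lemma EA_label_inl x a : EA_label x = inl a ->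
  (tagged x < len (tag x))%N /\ nth a (parr (val (tag x))) (tagged x) = a.
Proof.
rewrite /EA_label; case e : (onth _ _) => [b|] // [<-].
by split; [rewrite -onthTE e|exact: onth_nth].
Qed.
Lemma alphaE m : alpha m = Larrow (ang m (len m)).
Proof. by congr Larrow; apply: congr1; apply: val_inj; rewrite /= inordK. Qed.
Lemma Larrow_alpha x m : Larrow x = alpha m <-> x = ang m (len m).
Proof.
rewrite alphaE; split=> [/Larrow_eq/EA_LclP|-> //].
by rewrite EA_label_max => /EA_label_inr.
Qed.
Lemma Larrow_alphas x : (Larrow x \in alphas J) = (tagged x == len (tag x) :> nat).
Proof.
apply/finset.imsetP/eqP => [[m _ /Larrow_alpha ->]|e]; first by rewrite tagged_ang.
by exists (tag x) => //; apply/Larrow_alpha; rewrite {1}[x]angE e.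
Qed.

Lemma EA_vertex_src x a : EA_label x = inl a -> EA_vertex x = src a.
Proof.
move=> /EA_label_inl[lt ea]; rewrite {1}[x]angE EA_vertexE ?ang_le //.
rewrite -psrc_pdrop; apply: (psrc_head (s := drop (tagged x).+1 (parr (val (tag x))))).
by rewrite parr_pdrop (drop_nth a lt) ea.
Qed.
Lemma EA_g x : g x = if tagged x == len (tag x) :> nat then ang (tag x) 0
  else ang (tag x) (tagged x).+1.
Proof.
rewrite {1}[x]angE -[g _]/(iter 1 g _) EA_iter ?ang_le // addn1.
case: eqP => [->|/eqP ne]; first by rewrite modnn.
by rewrite modn_small // ltnS ltn_neqAle ne ang_le.
Qed.
Lemma EA_vertex_tgt x a : EA_label x = inl a -> EA_vertex (g x) = tgt a.
Proof.
move=> /EA_label_inl[lt ea]; rewrite EA_g (ltn_eqF lt) EA_vertexE //.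
rewrite /ptgt parr_ptake psrc_ptake (take_nth a lt) ea map_rcons last_rcons.
by [].
Qed.

Lemma EA_special_alpha x : alpha (tag x) \in (special x : seq (arrow (QE E))).
Proof.
pose s := len (tag x); apply/mem_Larrows; exists (s - tagged x)%N.
  by rewrite EA_degE ltnS leq_subr.
by apply/esym/Larrow_alpha; rewrite EA_iterx subnKC ?ang_le // modn_small.
Qed.
Lemma EA_special_alpha_tag x m : alpha m \in (special x : seq (arrow (QE E))) -> m = tag x.
Proof.
move=> /mem_Larrows[i _ /esym/Larrow_alpha eqx].
by rewrite -[RHS](EA_tag_iter i) eqx.
Qed.

Lemma EA_fBC : is_fBC E.
Proof.
split=> [x|x|x y /EA_LclP eqL|x y|x y|x y|x y].
- by [].
- apply/fintype.subsetP => y /Lcl_eq/EA_LclP eqL.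
  suff -> : Pcl x = Pcl y by exact: Pcl_self.
  apply/EA_PclP; case ex : (EA_label x) => [a|z]; last first.
    by rewrite (EA_label_inr ex) (EA_label_inr (etrans eqL ex)).
  by rewrite (EA_vertex_src ex) (EA_vertex_src (etrans eqL ex)).
- apply/EA_PclP; case ex : (EA_label x) => [a|z]; last first.
    by rewrite (EA_label_inr ex) -(EA_label_inr (etrans (esym eqL) ex)).
  by rewrite (EA_vertex_tgt ex) (EA_vertex_tgt (etrans (esym eqL) ex)).
- by case/porbitP => i ->; rewrite permX !EA_degE EA_tag_iter.
- by rewrite !EA_sym.
- by rewrite !EA_sym.
move=> inf; have /mem_infix sub := inf.
have txy : tag x = tag y.
  have /mapP[z zs ez] : Lcl (ang (tag x) (len (tag x))) \in Lseq y (d y).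
    apply: sub; have /mem_Larrows[i ilt ei] := EA_special_alpha x.
    have <- : Lcl (iter i g x) = Lcl (ang (tag x) (len (tag x))).
      by apply/Larrow_eq; rewrite -ei alphaE.
    by apply/mapP; exists i; rewrite ?mem_iota.
  have /esym/EA_LclP := ez; rewrite EA_label_max => /EA_label_inr e.
  by rewrite -(EA_tag_iter z y) e.
case/infixP: inf => s [t e]; have := congr1 size e.
rewrite !size_cat !size_map !size_iota !EA_degE txy => /eqP.
rewrite addnCA -{1}[(len (tag y)).+1]addn0 eqn_add2l eq_sym addn_eq0 => /andP[].
move=> /nilP s0 /nilP t0; rewrite s0 t0 cats0 cat0s in e.
by rewrite -[RHS]/(Lseq y (d y)) e EA_degE txy.
Qed.

Lemma EA_reach x y : tag x = tag y -> exists n, y = iter n g x.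
Proof.
case: y => m i /= e; subst m; have le := ang_le x.
exists (i + ((len (tag x)).+1 - tagged x))%N; rewrite EA_iterx.
rewrite addnC -addnA subnK; last exact: leqW.
by rewrite modnDr modn_small ?ltn_ord // /ang inord_val.
Qed.

Lemma EA_free : fdeg_free E.
Proof.
move=> x; have -> : porbit g x = [set (Tagged (fun m : M => 'I_(len m).+1) i : angle E)
    | i in [set: 'I_(len (tag x)).+1]].
  apply/setP => y; apply/porbitP/finset.imsetP => [[i ->]|[i _ ->]].
    rewrite permX EA_iterx.
    by eexists.
  have [n ->] := @EA_reach x (Tagged (fun m : M => 'I_(len m).+1) i) erefl.
  by exists n; rewrite permX.
rewrite card_imset; first by rewrite cardsT card_ord.
by move=> i j /eqP; rewrite eq_Tagged => /eqP.
Qed.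

(** The last angle of each maximal path is alone in its class, and a special
    cycle goes once around the positions of one maximal path. *)
Lemma EA_cycle_cut : cycle_cut (alphas J).
Proof.
split=> [x|x y]; last first.
  case/finset.imsetP => m _ xm; rewrite xm => /esym/Larrow_alpha ->.
  by move/Larrow_alpha: xm => ->.
rewrite /special /Larrows count_map; pose s := len (tag x).
rewrite (@eq_in_count _ _ (pred1 (s - tagged x)%N)); last first.
  move=> i; rewrite mem_iota /= ltnS => ile.
  rewrite Larrow_alphas EA_iterx.
  have le := ang_le x; rewrite tagged_ang ?EA_tag_iter; last by rewrite -ltnS ltn_mod.
  exact: modn_top.
by rewrite count_uniq_mem ?iota_uniq // mem_iota /= ltnS leq_subr.
Qed.

Lemma EA_cyclic x y : cyclic_eq x y = (tag x == tag y).
Proof.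
apply/(cyclic_eqP EA_fBC EA_sym)/eqP => [[i eqs]|/EA_reach[i ->]]; last by exists i.
have := EA_special_alpha y; rewrite eqs => /EA_special_alpha_tag ->.
by rewrite EA_tag_iter.
Qed.

Lemma EA_admissible_cut : admissible_cut (alphas J).
Proof.
split=> [x||a x aD].
- apply/eqP/cards1P; exists (alpha (tag x)); apply/setP => a.
  rewrite !finset.inE; apply/andP/eqP => [[/finset.imsetP[m _ ->] /EA_special_alpha_tag ->]|->] //.
  by split; [apply/finset.imsetP; exists (tag x)|exact: EA_special_alpha].
- rewrite /ncycles (card_equivalence_partition EA_cyclic) /alphas [LHS]card_imset; last first.
    move=> m m' e; have : Larrow (ang m (len m)) = alpha m' by rewrite -alphaE e.
    by move/Larrow_alpha/(congr1 tag).
  apply: eq_card => m; rewrite finset.inE; apply/esym/finset.imsetP.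
  by exists (ang m 0); rewrite ?finset.inE.
rewrite -(cut_once EA_cycle_cut x); apply: sub_count => b /eqP -> //.
Qed.
End MonomialConfiguration.

(** * The cut algebra of the configuration of a monomial algebra *)

Section CutOfConfiguration.
Variables (k : fieldType) (Q : quiver) (J : set (path_alg k Q)).
Hypothesis hJ : monomial_ideal J.
Local Notation E := (EA J).
Local Notation M := (maximal_paths J).
Local Notation g := (@rotate E).
Local Notation d := (@Defs.fdeg E).
Local Notation len m := (size (parr (val m))).
Local Notation ang := (@ang k Q J).
Implicit Types (m : M) (x y : angle E).

Let hE : is_fBC E := EA_fBC J.
Let symE : fbc_symmetric E := @EA_sym k Q J.
Let cutE : cycle_cut (alphas J) := EA_cycle_cut J.
Local Notation lp := (lpath hE).
Local Notation J2 := (@cut_ideal k E (alphas J)).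

(** The arrows of E other than the alpha_m are arrows of Q; the label of a class
    is read off any of its elements. *)
Definition EA_arrow (a : arrow (QE E)) : option (arrow Q) :=
  if EA_label (xchoose (Larrow_ex a)) is inl c then Some c else None.
Definition EA_vert (v : vert (QE E)) : vert Q :=
  EA_vertex (projT1 (cid (Pvert_surj v))).

Lemma EA_arrowE x : EA_arrow (Larrow x) = if EA_label x is inl c then Some c else None.
Proof.
rewrite /EA_arrow; set y := xchoose _.
have /EA_LclP -> // : Lcl y = Lcl x.
by apply: Lcl_eq; exact: (xchooseP (Larrow_ex (Larrow x))).
Qed.
Lemma EA_vertE x : EA_vert (Pvert x) = EA_vertex x.
Proof.
rewrite /EA_vert; case: (cid _) => y /= xy.
by have /Pvert_eq/EA_PclP : Pvert x = Pvert y := xy.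
Qed.

Lemma EA_nD m i n : (i <= len m)%N -> (nD (alphas J) (lp (ang m i) n) = 0)%N <-> (i + n <= len m)%N.
Proof.
move=> le; split=> [n0|ln].
  rewrite leqNgt; apply/negP => lt; have : has (mem (alphas J)) (Larrows (ang m i) n).
    apply/hasP; exists (Larrow (ang m (len m))); last first.
      by rewrite /= Larrow_alphas tagged_ang.
    apply/mem_Larrows; exists (len m - i)%N; first by rewrite ltn_subLR.
    by rewrite EA_iter_small ?subnKC.
  by rewrite has_count -[count _ _]/(nD (alphas J) (lp (ang m i) n)) n0.
apply/eqP; rewrite -leqn0 leqNgt -has_count; apply/hasPn => a /mem_Larrows[l ll ->] /=.
have lt : (i + l < len m)%N by apply: leq_trans ln; rewrite ltn_add2l.
by rewrite EA_iter_small ?(ltnW lt) // Larrow_alphas tagged_ang ?(ltnW lt) // ltn_eqF.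
Qed.

(** A standard path that avoids the arrows alpha does not wrap around the end
    of the maximal path of its angle. *)
Lemma EA_nz p : nz J2 p <-> exists m i n, (i + n <= len m)%N /\ p = lp (ang m i) n.
Proof.
rewrite (nzJ hE symE cutE); split=> [[[x [n [le ->]]]]|[m [i [n [le ->]]]]].
  rewrite [x]angE => /EA_nD; rewrite ang_le => /(_ isT) ln.
  by exists (tag x), (tagged x), n.
have lei : (i <= len m)%N by apply: leq_trans le; exact: leq_addr.
split; last exact/EA_nD.
exists (ang m i), n; split=> //; apply: leqW; apply: leq_trans le; exact: leq_addl.
Qed.

Lemma EA_arrow_ends a c : EA_arrow a = Some c -> src c = EA_vert (src a) /\ tgt c = EA_vert (tgt a).
Proof.
have [x ->] := Larrow_surj a; rewrite EA_arrowE src_Larrow // tgt_Larrow // !EA_vertE.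
by case e : (EA_label x) => [b|] // [<-]; rewrite (EA_vertex_src e) (EA_vertex_tgt e).
Qed.

Lemma EA_arrow_def p : nz J2 p -> all (fun a => isSome (EA_arrow a)) (parr p).
Proof.
move=> /EA_nz[m [i [n [le ->]]]]; apply/allP => a /mem_Larrows[l ll ->].
have lt : (i + l < len m)%N by apply: leq_trans le; rewrite ltn_add2l.
rewrite EA_iter_small ?(ltnW lt) // EA_arrowE.
by have [b _] : exists b : arrow Q, True; [case: (parr _) lt => // b s; exists b|];
  rewrite (EA_label_lt b lt).
Qed.

Lemma EA_map_lpath m i n : (i + n <= len m)%N ->
  arrow_map EA_vert EA_arrow (lp (ang m i) n) = ptake n (pdrop i (val m)).
Proof.
move=> le; have lei : (i <= len m)%N by apply: leq_trans le; exact: leq_addr.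
have N : nz J2 (lp (ang m i) n) by apply/EA_nz; exists m, i, n.
apply: qpath_eq; first by rewrite psrc_arrow_map psrc_ptake psrc_pdrop EA_vertE EA_vertexE.
rewrite (parr_arrow_map EA_arrow_ends (EA_arrow_def N)) parr_lpath parr_ptake parr_pdrop.
have [->|n0] := posnP n; first by rewrite take0.
have [a0 _] : exists b : arrow Q, True.
  by case: (parr (val m)) le => [|b s]; [rewrite leqn0 addn_eq0 => /andP[_ /eqP e]; rewrite e in n0|exists b].
have -> : Larrows (ang m i) n = [seq Larrow (ang m (i + l)) | l <- iota 0 n].
  apply/eq_in_map => l; rewrite mem_iota /= => ll.
  by rewrite EA_iter_small //; apply: leq_trans le; rewrite leq_add2l ltnW.
have -> : pmap EA_arrow [seq Larrow (ang m (i + l)) | l <- iota 0 n] =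
    [seq nth a0 (parr (val m)) (i + l) | l <- iota 0 n].
  have : {in iota 0 n, forall l, (i + l < len m)%N}.
    by move=> l; rewrite mem_iota /= => ll; apply: leq_trans le; rewrite ltn_add2l.
  elim: (iota 0 n) => //= l s IH H; rewrite EA_arrowE (EA_label_lt a0) ?H ?mem_head //=.
  by rewrite IH // => l' l's; apply: H; rewrite inE l's orbT.
apply: (@eq_from_nth _ a0) => [|l]; rewrite size_map size_iota.
  by rewrite size_takel // size_drop leq_subRL.
by move=> ll; rewrite (nth_map 0%N) ?size_iota // nth_iota // nth_take // nth_drop.
Qed.

Lemma EA_vertex_surj v : exists x, EA_vertex x = v.
Proof.
have [m [mm [i [n [le e _]]]]] := maximal_ext hJ (@nz_vpath k Q J hJ v).
have mM : m \in M by rewrite (in_maximal_paths hJ); apply/asboolP.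
exists (ang [` mM]%fset i).
have lei : (i <= size (parr m))%N by apply: leq_trans le; exact: leq_addr.
by rewrite EA_vertexE //= -psrc_pdrop -(psrc_ptake n) -e.
Qed.
Definition EA_at v : angle E := projT1 (cid (EA_vertex_surj v)).
Lemma EA_atE v : EA_vertex (EA_at v) = v.
Proof. exact: projT2 (cid (EA_vertex_surj v)). Qed.

Definition EA_vert' v : vert (QE E) := Pvert (EA_at v).
Definition EA_arrow' c : option (arrow (QE E)) :=
  omap (fun x => Larrow x : arrow (QE E)) [pick x : angle E | EA_label x == inl c].

Lemma EA_arrowP a c : EA_arrow a = Some c <-> EA_arrow' c = Some a.
Proof.
rewrite /EA_arrow'; have [x ->] := Larrow_surj a; rewrite EA_arrowE.
split.
  case e : (EA_label x) => [b|] // [<-]; case: pickP => [y /eqP ey|/(_ x)] /=.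
    by have -> : Larrow y = Larrow x by apply/Larrow_eq/EA_LclP; rewrite ey e.
  by rewrite e eqxx.
case: pickP => //= y /eqP ey e.
have /Larrow_eq/EA_LclP <- : @Larrow E y = Larrow x := Some_inj e.
by rewrite ey.
Qed.
Lemma EA_vertK v : EA_vert (EA_vert' v) = v.
Proof. by rewrite EA_vertE EA_atE. Qed.
Lemma EA_vertK' v : EA_vert' (EA_vert v) = v.
Proof.
have [x ->] := Pvert_surj v; rewrite EA_vertE; apply/Pvert_eq/EA_PclP.
exact: EA_atE.
Qed.
Lemma EA_arrow_ends' c a : EA_arrow' c = Some a -> src a = EA_vert' (src c) /\ tgt a = EA_vert' (tgt c).
Proof. by move=> /EA_arrowP/EA_arrow_ends[-> ->]; rewrite !EA_vertK'. Qed.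

Lemma EA_ext q : nz J q -> exists m i n, (i + n <= len m)%N /\ q = ptake n (pdrop i (val m)).
Proof.
move=> Nq; have [m [mm [i [n [le e _]]]]] := maximal_ext hJ Nq.
have mM : m \in M by rewrite (in_maximal_paths hJ); apply/asboolP.
by exists [` mM]%fset, i, n.
Qed.

Lemma EA_map' m i n : (i + n <= len m)%N ->
  arrow_map EA_vert' EA_arrow' (ptake n (pdrop i (val m))) = lp (ang m i) n.
Proof.
move=> le; rewrite -EA_map_lpath //; apply: (arrow_mapK EA_arrow_ends).
- exact: EA_vertK'.
- by move=> a c /EA_arrowP.
by apply: EA_arrow_def; apply/EA_nz; exists m, i, n.
Qed.

Lemma EA_arrow_def' q : nz J q -> all (fun a => isSome (EA_arrow' a)) (parr q).
Proof.
move=> /EA_ext[m [i [n [le ->]]]]; rewrite -EA_map_lpath //.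
have N : nz J2 (lp (ang m i) n) by apply/EA_nz; exists m, i, n.
rewrite (parr_arrow_map EA_arrow_ends (EA_arrow_def N)).
apply/allP => c; rewrite -(mem_map (@Some_inj _)) pmapS_filter => /mapP[a _].
by move=> /esym/EA_arrowP ->.
Qed.

(** By EA_nz and EA_ext, the nonzero paths are the factors of the maximal paths
    on both sides. *)
Lemma EA_path_iso : path_iso J2 J (arrow_map EA_vert EA_arrow) (arrow_map EA_vert' EA_arrow').
Proof.
have hJ2 : monomial_ideal J2 := cut_ideal_monomial hE symE cutE k.
split.
- apply: arrow_map_pmor => //; [exact: EA_arrow_ends|exact: EA_arrow_def|].
  move=> _ /EA_nz[m [i [n [le ->]]]]; rewrite EA_map_lpath //.
  by have [_ N] := mono_fc hJ i (@maximal_nz k Q J hJ m); have [] := mono_fc hJ n N.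
- apply: arrow_map_pmor => //; [exact: EA_arrow_ends'|exact: EA_arrow_def'|].
  by move=> q /EA_ext[m [i [n [le ->]]]]; rewrite EA_map' //; apply/EA_nz; exists m, i, n.
- by move=> _ /EA_nz[m [i [n [le ->]]]]; rewrite EA_map_lpath // EA_map'.
by move=> q /EA_ext[m [i [n [le ->]]]]; rewrite EA_map' // EA_map_lpath.
Qed.

End CutOfConfiguration.

Section MaximalFactor.
Variables (k : fieldType) (Q : quiver) (J : set (path_alg k Q)).
Hypothesis hJ : monomial_ideal J.

Lemma maximal_pcatl m q : maximal_path J m -> psrc q = ptgt m -> nz J (pcat q m) ->
  parr q = [::].
Proof.
move=> /(maximal_pathP hJ)[_ m1 _] qm N; case eq : (parr q) => [|a s] //.
have qa : ptake 1 q = apath a by apply: path_apath; rewrite parr_ptake eq /= take0.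
have am : psrc (apath a) = ptgt m by rewrite -qa psrc_ptake.
exfalso; apply: (m1 a) => //; rewrite -qa.
have := (mono_fc hJ (size (parr m)).+1 N).1.
suff -> : ptake (size (parr m)).+1 (pcat q m) = pcat (ptake 1 q) m by [].
apply: qpath_eq; first by rewrite psrc_ptake !psrc_pcat // qa.
by rewrite parr_ptake !parr_pcat ?qa // eq -addn1 take_cat ltnNge leq_addr /= addKn /= take0.
Qed.
Lemma maximal_pcatr m q : maximal_path J m -> psrc m = ptgt q -> nz J (pcat m q) ->
  parr q = [::].
Proof.
move=> /(maximal_pathP hJ)[_ _ m2] mq N; case/lastP eq : (parr q) => [|s a] //.
have qa : pdrop (size s) q = apath a.
  by apply: path_apath; rewrite parr_pdrop eq -cats1 drop_size_cat.
have ma : psrc m = ptgt (apath a) by rewrite -qa ptgt_pdrop.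
exfalso; apply: (m2 a) => //.
have := (mono_fc hJ (size s) N).2.
suff -> : pdrop (size s) (pcat m q) = pcat m (apath a) by [].
rewrite -qa -{1}(pcat_drop_take (size s) q) pcatA ?psrc_pdrop // ?ptgt_pdrop //.
rewrite -{1}[size s](_ : size (parr (ptake (size s) q)) = _); last first.
  by rewrite parr_ptake eq -cats1 take_size_cat.
by rewrite pdrop_pcat // psrc_pcat ?psrc_pdrop // ptgt_pdrop.
Qed.

(** The parts of m' before and after its factor m would extend m. *)
Lemma maximal_factor m m' i n : maximal_path J m -> nz J m' ->
  m = ptake n (pdrop i m') -> m = m'.
Proof.
move=> mm N' e; have N1 := (mono_fc hJ i N').2.
have q0 : parr (pdrop n (pdrop i m')) = [::].
  by apply: (maximal_pcatl mm); rewrite e ?psrc_pdrop ?pcat_drop_take.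
have e1 : m = pdrop i m'.
  rewrite e -[RHS](pcat_drop_take n) [in RHS](path_nil q0) pcat_vl //.
  exact: psrc_pdrop.
have r0 : parr (ptake i m') = [::].
  by apply: (maximal_pcatr mm); rewrite e1 ?psrc_pdrop ?pcat_drop_take.
rewrite e1 -[RHS](pcat_drop_take i) [in RHS](path_nil r0) pcat_vr //.
by rewrite psrc_pdrop ptgt_nil.
Qed.
End MaximalFactor.

Section TrivextOfMonomial.
Variables (k : fieldType) (Q : quiver) (J : set (path_alg k Q)).
Hypothesis hJ : monomial_ideal J.
Local Notation E := (EA J).
Local Notation M := (maximal_paths J).
Local Notation g := (@rotate E).
Local Notation d := (@Defs.fdeg E).
Local Notation len m := (size (parr (val m))).
Local Notation ang := (@ang k Q J).
Let hE : is_fBC E := EA_fBC J.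
Let symE : fbc_symmetric E := @EA_sym k Q J.
Let cutE : cycle_cut (alphas J) := EA_cycle_cut J.
Local Notation lp := (lpath hE).
Local Notation J2 := (@cut_ideal k E (alphas J)).

Lemma EA_alphas_nD (x : angle E) : nD (alphas J) (lp x 1) <> 0%N -> x = ang (tag x) (len (tag x)).
Proof.
rewrite /nD parr_lpath LarrowsS /= addn0 Larrow_alphas; case: eqP => // e _.
by rewrite {1}[x]angE e.
Qed.

(** If one side of IE_R1 is an arrow and the sides differ, this arrow is
    alpha_m for some m and the common tail is the whole of m. On the other
    side the tail avoids the arrows alpha, so m is a factor of the
    maximal path m' of that cycle, which forces m' = m. *)
Lemma EA_admissible : admissible_ideal (IE E k).
Proof.
apply: (@IE_admissible E hE k) => e h j R1 e1.
have [//|[n1 n2]] := R1_cut hE symE cutE R1; rewrite e1 in n1 *.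
have [_ je jh _] := R1; have ee := EA_alphas_nD n1.
set m := tag e in ee; have dj : j = len m by move: e1 je; rewrite EA_degE -/m; lia.
have te := R1_tail hE symE R1; rewrite e1 in te.
have ge : iter 1 g e = ang m 0 by rewrite ee EA_iter // addn1 modnn.
have c := nD_compl cutE (R1_compl hE R1); rewrite e1 in c.
have t0 : nD (alphas J) (lp (iter 1 g e) j) = 0%N by move: n1 c; case: (nD _ _) => // n _; lia.
pose y := iter (d h - j) g h.
have yE : y = ang (tag y) (tagged y) := angE y.
have ly : (tagged y + j <= len (tag y))%N.
  by apply/(@EA_nD k Q J (tag y) (tagged y) j (ang_le y)); rewrite -yE -te.
have := congr1 (arrow_map (@EA_vert k Q J) (@EA_arrow k Q J)) te.
rewrite ge -/y yE !EA_map_lpath // ?dj // => mE.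
have {mE} : val m = val (tag y).
  apply: (maximal_factor hJ (i := tagged y) (n := len m)); first exact: maximalP.
    exact: maximal_nz.
  by rewrite -mE pdrop0 ptake_size.
move/val_inj; rewrite EA_tag_iter => mh.
have dh : d h = (len m).+1 by rewrite EA_degE -mh.
have h1 : (d h - j = 1)%N by rewrite dh dj; lia.
rewrite h1 in n2 *; have := EA_alphas_nD n2; rewrite -mh => hh.
by have -> : h = e by [exact: etrans hh (esym ee)]; rewrite -dj e1.
Qed.

Lemma EA_sym_fsBC : sym_fsBC E k.
Proof.
split; [exact: hE|exact: (cycle_cut_type_S hE symE cutE)|exact: symE| |exact: EA_admissible].
exact: EA_free.
Qed.

Let hJ2 : monomial_ideal J2 := cut_ideal_monomial hE symE cutE k.

Lemma EA_cut_iso : iso_class (quo J2) = iso_class (quo J).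
Proof. exact: iso_classE (path_map_iso hJ2 hJ (EA_path_iso hJ)). Qed.

Lemma EA_pair_class : pair_class (cut_pair k (alphas J)) =
  pair_class (@AlgPair k (trivext (quo J)) (dual_maximal J)).
Proof.
rewrite (cut_pair_trivext hE symE cutE EA_admissible).
exact: (path_iso_pair_class hJ2 hJ (EA_path_iso hJ)).
Qed.

Definition TA_map : fBCA E k -> trivext (quo J) :=
  path_trivext hJ2 hJ (EA_path_iso hJ) \o @cut_map E hE symE (alphas J) cutE k.

Lemma TA_map_nz p : nz J2 p -> TA_map (qpi (IE E k) (kpath k p)) =
  (qpi J (kpath k (arrow_map (@EA_vert k Q J) (@EA_arrow k Q J) p)), 0).
Proof.
move=> Np; rewrite /TA_map /= cut_map_nz //; congr (_, _).
  by rewrite /= path_map_kpath.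
by apply: dual_eq => x.
Qed.

(** The arrow alpha_m is a complement of the path of E that runs through m. *)
Lemma TA_map_alpha m : exists2 h : dual (quo J), is_dual_basis_elt (val m) h &
  TA_map (qpi (IE E k) (kpath k (apath (alpha m)))) = (0, h).
Proof.
have lt : (0 + len m <= len m)%N by [].
pose p := lp (ang m 0) (len m).
have Np : nz J2 p by apply/EA_nz; exists m, 0%N, (len m).
have cp : compl hE (apath (alpha m)) p.
  have := @compl_lpath _ hE (ang m 0) (len m) (leqnSn _).
  rewrite EA_iter_small // EA_degE /= subSnn add0n.
  by rewrite (path_apath (p := lp _ 1) (a := alpha m)) // parr_lpath LarrowsS alphaE.
have [h1 h2] := cut_map_compl symE cutE Np cp.
have [h3 h4] := path_trivext_dual hJ2 hJ (EA_path_iso hJ) Np h1 h2.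
have eb : arrow_map (@EA_vert k Q J) (@EA_arrow k Q J) p = val m.
  by rewrite EA_map_lpath // pdrop0 ptake_size.
rewrite eb in h4; exists (TA_map (qpi (IE E k) (kpath k (apath (alpha m))))).2 => //.
by rewrite [LHS]surjective_pairing; congr (_, _).
Qed.

Lemma TA_map_identification : TA_identification TA_map.
Proof.
split.
- by apply: iso_comp; [exact: path_trivext_iso|exact: cut_map_iso].
- move=> x; rewrite TA_map_nz; last exact: nz_vpath.
  congr (qpi J (kpath k _), 0); apply: qpath_eq; first by rewrite psrc_arrow_map EA_vertE.
  by rewrite (parr_arrow_map (@EA_arrow_ends k Q J)).
- move=> x a ex; have [lt ea] := EA_label_inl ex.
  have pE : apath (@Larrow E x : arrow (QE E)) = lp (ang (tag x) (tagged x)) 1.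
    by apply/esym/path_apath; rewrite parr_lpath LarrowsS -[ang _ _](angE (x : angle E)).
  have Np : nz J2 (apath (@Larrow E x : arrow (QE E))).
    by apply/EA_nz; exists (tag x), (tagged x), 1%N; rewrite addn1.
  rewrite TA_map_nz //; congr (qpi J (kpath k _), 0); apply: path_apath.
  rewrite (parr_arrow_map (@EA_arrow_ends k Q J) (EA_arrow_def Np)) /=.
  by rewrite EA_arrowE ex.
exact: TA_map_alpha.
Qed.
End TrivextOfMonomial.

(** * Invariance of the cut algebra *)

Section CutAlgebras.
Variable k : fieldType.

Lemma cut_algebra_class (E : fbc_data) (D : {set arrow (QE E)}) :
  iso_class (cut_algebra k D) = iso_class (quo (@cut_ideal k E D)).
Proof. exact: iso_classE (quo_gen_iso _). Qed.

Section Map.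
Variables (E E' : fbc_data) (D : {set arrow (QE E)}) (D' : {set arrow (QE E')}).
Variable f : fBCA E k -> fBCA E' k.
Hypothesis fi : is_alg_iso f.
Hypothesis fD : (f @` [set qpi (IE E k) (kpath k (apath a)) | a in [set` D]] =
  [set qpi (IE E' k) (kpath k (apath a)) | a in [set` D']])%classic.
Local Notation X' := (IE E' k `|` [set kpath k (apath a) | a in [set` D']])%classic.

Definition to_cut : fBCA E' k -> cut_algebra k D' := qlift (qpi X').
Lemma to_cut_cond x : IE E' k x -> qpi X' x = 0.
Proof. by move=> Ix; apply/qpi_eq0; apply: sub_ideal_gen; left. Qed.
(** Going down from the path algebra avoids the two-sided ideal generated by
    the image of D in the algebra of E. *)
Definition cut_transport : path_alg k (QE E) -> cut_algebra k D' :=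
  to_cut \o f \o qpi (IE E k).

Lemma cut_transport_mor : is_alg_mor cut_transport.
Proof.
apply: (amor_comp _ (qpi_mor (IE E k))); apply: (amor_comp _ (iso_mor fi)).
exact: (qlift_mor (qpi_mor X') to_cut_cond).
Qed.
Lemma cut_transport0 x :
  (IE E k `|` [set kpath k (apath a) | a in [set` D]])%classic x -> cut_transport x = 0.
Proof.
rewrite /cut_transport /=; case=> [Ix|[a aD <-]].
  have -> : qpi (IE E k) x = 0 by apply/qpi_eq0; rewrite ideal_genid //; exact: ideal_gen_ideal.
  rewrite (amor0 (iso_mor fi)).
  exact: (amor0 (qlift_mor (qpi_mor X') to_cut_cond)).
have : (f @` [set qpi (IE E k) (kpath k (apath a)) | a in [set` D]])%classic
    (f (qpi (IE E k) (kpath k (apath (a : arrow (QE E)))))).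
  by exists (qpi (IE E k) (kpath k (apath (a : arrow (QE E))))) => //; exists a.
rewrite fD => -[a' aD' <-].
rewrite /to_cut (qliftE (qpi_mor X') to_cut_cond).
by apply/qpi_eq0; apply: sub_ideal_gen; right; exists a'.
Qed.
End Map.

Lemma cut_pair_cut_algebra (E E' : fbc_data) (D : {set arrow (QE E)}) (D' : {set arrow (QE E')}) :
  pair_class (cut_pair k D) = pair_class (cut_pair k D') ->
  iso_class (cut_algebra k D) = iso_class (cut_algebra k D').
Proof.
move=> /pair_class_ex[f fi fD]; have [f' [f'i fK f'K]] := iso_inv fi.
have f'D : (f' @` [set qpi (IE E' k) (kpath k (apath a)) | a in [set` D']] =
  [set qpi (IE E k) (kpath k (apath a)) | a in [set` D]])%classic.
  rewrite -[X in (_ @` X)%classic]fD image_comp; apply/seteqP.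
  split=> [_ [x Xx <-]|x Xx] /=; first by rewrite fK.
  by exists x => //=; rewrite fK.
have T (E1 E2 : fbc_data) (D1 : {set arrow (QE E1)}) (D2 : {set arrow (QE E2)})
    (u : fBCA E1 k -> fBCA E2 k) (v : fBCA E2 k -> fBCA E1 k)
    (ui : is_alg_iso u) (vi : is_alg_iso v)
    (vD : (v @` [set qpi (IE E2 k) (kpath k (apath a)) | a in [set` D2]] =
      [set qpi (IE E1 k) (kpath k (apath a)) | a in [set` D1]])%classic) :
    cancel u v -> forall x, qlift (cut_transport D1 v) (cut_transport D2 u x) =
      qpi (IE E1 k `|` [set kpath k (apath a) | a in [set` D1]])%classic x.
  move=> uK x; rewrite [cut_transport D2 u x]/(to_cut D2 (u (qpi (IE E1 k) x))) /to_cut.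
  rewrite -[u (qpi (IE E1 k) x)]qreprK.
  rewrite (qliftE (qpi_mor _) (@to_cut_cond E2 D2)).
  rewrite (qliftE (cut_transport_mor D1 vi) (cut_transport0 vi vD)).
  rewrite /cut_transport /= qreprK uK /to_cut.
  exact: (qliftE (qpi_mor _) (@to_cut_cond E1 D1)).
apply: iso_classE; apply: (quo_iso (g := cut_transport D f')).
- exact: (cut_transport_mor D' fi).
- exact: cut_transport_mor.
- exact: (cut_transport0 fi fD).
- exact: cut_transport0.
- exact: T.
- exact: T.
Qed.
End CutAlgebras.

(** * The bijection *)

Section Bijection.
Variable k : fieldType.

Lemma monomial_rep (C : monomial_classes k) :
  exists R : {Q : quiver & set (path_alg k Q)},
    monomial_ideal (projT2 R) /\ sval C = iso_class (quo (projT2 R)).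
Proof. by case: C => C [Q [J [hJ e]]]; exists (existT _ Q J). Qed.

Lemma cut_rep (C : cut_classes k) :
  exists R : {E : fbc_data & {set arrow (QE E)}},
    [/\ sym_fsBC (projT1 R) k, admissible_cut (projT2 R)
      & sval C = pair_class (cut_pair k (projT2 R))].
Proof. by case: C => C [E [D [hE hD e]]]; exists (existT _ E D). Qed.

Lemma sym_fsBC_cut (E : fbc_data) (D : {set arrow (QE E)}) :
  sym_fsBC E k -> admissible_cut D ->
  [/\ is_fBC E, fbc_symmetric E, cycle_cut D & admissible_ideal (IE E k)].
Proof. by case=> hE _ symE _ adm hD; split=> //; exact: admissible_cycle_cut. Qed.

Lemma sym_fsBC_monomial (E : fbc_data) (D : {set arrow (QE E)}) :
  sym_fsBC E k -> admissible_cut D -> monomial_ideal (@cut_ideal k E D).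
Proof. by move=> hE /(sym_fsBC_cut hE)[h1 h2 h3 _]; exact: cut_ideal_monomial. Qed.

Lemma cut_rep_monomial (E : fbc_data) (D : {set arrow (QE E)}) (T : Prop) :
  [/\ sym_fsBC E k, admissible_cut D & T] -> monomial_ideal (@cut_ideal k E D).
Proof. by case=> hE hD _; exact: sym_fsBC_monomial. Qed.

Definition to_cut_class (C : monomial_classes k) : cut_classes k :=
  let R := cid (monomial_rep C) in
  cut_class (EA_sym_fsBC (projT2 R).1) (EA_admissible_cut (projT2 (projT1 R))).

Definition to_monomial_class (C : cut_classes k) : monomial_classes k :=
  let R := cid (cut_rep C) in monomial_class (cut_rep_monomial (projT2 R)).

(** The maps on classes are defined by a choice of representatives.
    Isomorphic monomial algebras have isomorphic pairs because they are also
    isomorphic by a bijection of paths; an arbitrary isomorphism does not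
    preserve the dual basis elements of the maximal paths. *)
Lemma to_cut_classE C (Q : quiver) (J : set (path_alg k Q)) :
  monomial_ideal J -> sval C = iso_class (quo J) ->
  sval (to_cut_class C) = pair_class (@AlgPair k (trivext (quo J)) (dual_maximal J)).
Proof.
move=> hJ eC; rewrite /to_cut_class; case: (cid _) => -[Q1 J1] /= [hJ1 e1].
rewrite EA_pair_class //; rewrite e1 in eC.
have [F Fi] := iso_class_ex eC; have [b [b' bi]] := iso_path_iso hJ1 hJ Fi.
exact: path_iso_pair_class bi.
Qed.

Lemma to_monomial_classE C (E : fbc_data) (D : {set arrow (QE E)}) :
  sval C = pair_class (cut_pair k D) ->
  sval (to_monomial_class C) = iso_class (cut_algebra k D).
Proof.
move=> eC; rewrite /to_monomial_class; case: (cid _) => -[E1 D1] /= [hE hD e1] /=.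
change (iso_class (quo (@cut_ideal k E1 D1)) = iso_class (cut_algebra k D)).
by rewrite -cut_algebra_class; apply: cut_pair_cut_algebra; rewrite -e1.
Qed.

Lemma to_cut_classK : cancel to_cut_class to_monomial_class.
Proof.
move=> C; apply: eq_sig_hprop; first by move=> x; exact: Prop_irrelevance.
have [[Q J] /= [hJ eC]] := monomial_rep C.
change (sval (to_monomial_class (to_cut_class C)) = sval C).
rewrite (@to_monomial_classE _ (EA J) (alphas J)); last first.
  by rewrite (to_cut_classE hJ eC) EA_pair_class.
by rewrite cut_algebra_class EA_cut_iso.
Qed.

Lemma to_monomial_classK : cancel to_monomial_class to_cut_class.
Proof.
move=> C; apply: eq_sig_hprop; first by move=> x; exact: Prop_irrelevance.
have [[E D] /= [hE hD eC]] := cut_rep C.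
have [h1 h2 h3 h4] := sym_fsBC_cut hE hD.
change (sval (to_cut_class (to_monomial_class C)) = sval C).
rewrite [RHS]eC (cut_pair_trivext h1 h2 h3 h4); apply: to_cut_classE.
  exact: sym_fsBC_monomial.
by rewrite (to_monomial_classE eC) cut_algebra_class.
Qed.
End Bijection.

Theorem corollary5p6 (k : fieldType) :
  (forall (Q : quiver) (J : set (path_alg k Q)), monomial_ideal J ->
     [/\ sym_fsBC (EA J) k, admissible_cut (alphas J)
       & exists f : fBCA (EA J) k -> trivext (quo J), TA_identification f]) /\
  exists (phi : monomial_classes k -> cut_classes k)
         (psi : cut_classes k -> monomial_classes k),
    [/\ cancel phi psi, cancel psi phi,
        forall (Q : quiver) (J : set (path_alg k Q)) (hJ : monomial_ideal J),
          sval (phi (monomial_class hJ)) = pair_class (cut_pair k (alphas J)) /\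
          sval (phi (monomial_class hJ)) =
            pair_class (@AlgPair k (trivext (quo J)) (dual_maximal J))
      & forall (E : fbc_data) (D : {set arrow (QE E)})
               (hE : sym_fsBC E k) (hD : admissible_cut D),
          sval (psi (cut_class hE hD)) = iso_class (cut_algebra k D)].
Proof.
split=> [Q J hJ|].
  split; [exact: EA_sym_fsBC|exact: EA_admissible_cut|].
  by exists (TA_map hJ); exact: TA_map_identification.
exists (@to_cut_class k), (@to_monomial_class k); split.
- exact: to_cut_classK.
- exact: to_monomial_classK.
- move=> Q J hJ; have e := @to_cut_classE k (monomial_class hJ) Q J hJ erefl.
  by split=> //; rewrite e EA_pair_class.
by move=> E D hE hD; exact: to_monomial_classE.
Qed.
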